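(* Let $k$ be a field of characteristic $0$. For every co-irreducible domain $D$ let $\mathcal R(D)$ be a finite family of linearly independent (over $k$) irreducible nc rational functions such that every irreducible nc rational function with domain $D$ lies in the $k$-linear span of $\mathcal R(D)$ (such a family exists for every co-irreducible $D$). If a nc rational function $\mathbb r$ over $k$ in $x_1,\dots,x_g$ is defined at the origin, then $\operatorname{dom}\mathbb r=D_1\cap\cdots\cap D_s$ for some $s\in\mathbb N$ and co-irreducible domains $D_1,\dots,D_s$ such that $\mathbb r$ is a noncommutative polynomial (with coefficients in $k$) in the elements of $\{x_1,\dots,x_g\}\cup\mathcal R(D_1)\cup\cdots\cup\mathcal R(D_s)$.
   Context: Nc rational functions. Let $k\langle x\rangle=k\langle x_1,\dots,x_g\rangle$ be the free $k$-algebra of noncommutative (nc) polynomials. A nc rational expression is a syntactically valid combination of nc polynomials, the operations $+,\cdot,{}^{-1}$ and parentheses. An expression $r$ can be evaluated at $X\in M_n(k)^g$ whenever all inverses appearing in $r$ exist at $X$; $\operatorname{dom}_n r$ is the set of such $X$ and $\operatorname{dom} r=\bigcup_n\operatorname{dom}_n r$. Expressions $r_1,r_2$ with nonempty domains are equivalent if $r_1(X)=r_2(X)$ for all $X\in\operatorname{dom} r_1\cap\operatorname{dom} r_2$. Nc rational functions are the equivalence classes; they form a skew field containing $k\langle x\rangle$. For a nc rational function $\mathbb r$, $\operatorname{dom}_n\mathbb r$ is the union of $\operatorname{dom}_n r$ over all representatives $r$ of $\mathbb r$, and $\operatorname{dom}\mathbb r=\bigcup_n\operatorname{dom}_n\mathbb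 r$. Pencils. For $A_1,\dots,A_g\in M_d(k)$, $L_A=I_d-\sum_iA_ix_i$ is a monic linear pencil of size $d$; for $X\in M_n(k)^g$, $L_A(X)=I_d\otimes I_n-\sum_iA_i\otimes X_i$; the free locus is $\mathscr Z(L_A)=\bigcup_n\{X\in M_n(k)^g:\det L_A(X)=0\}$. $\mathcal A\subseteq M_d(k)$ denotes the (possibly non-unital) $k$-algebra generated by $A_1,\dots,A_g$. A monic pencil $L$ is minimal if it has the smallest size among all monic pencils with free locus equal to $\mathscr Z(L)$. Domains and irreducibility. Let $\mathfrak{Dom}_0$ be the set of all $\operatorname{dom}\mathbb r$, where $\mathbb r$ is a nc rational function with $0\in\operatorname{dom}\mathbb r$. A set in $\mathfrak{Dom}_0$ is co-irreducible if it is not an intersection of two strictly larger sets in $\mathfrak{Dom}_0$. A nc rational function $\mathbb r$ is irreducible if $\mathbb r=\mathbf c^tL_A^{-1}\mathbf b$ for some column vectors $\mathbf b,\mathbf c$ over $k$ and some minimal monic pencil $L_A$ such that $\mathcal A$ is a simple algebra (with nonzero multiplication). *)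

(* Defs.v *)
From HB Require Import structures.
From mathcomp Require Import all_boot all_order all_algebra generic_quotient.
From mathcomp Require Import boolp classical_sets.
From mathcomp.real_closed Require Import mxtens.
Set Implicit Arguments.
Unset Strict Implicit.
Unset Printing Implicit Defensive.
Import GRing.Theory.
Local Open Scope classical_set_scope.
Local Open Scope ring_scope.
Local Open Scope quotient_scope.

Inductive ncexpr (k : Type) (g : nat) : Type :=
  | NcConst of k
  | NcVar of 'I_g
  | NcAdd of ncexpr k g & ncexpr k g
  | NcMul of ncexpr k g & ncexpr k g
  | NcInv of ncexpr k g.
Arguments NcConst {k g}.
Arguments NcVar {k g}.
Arguments NcAdd {k g}.
Arguments NcMul {k g}.
Arguments NcInv {k g}.

HB.instance Definition _ (k : Type) (g : nat) := gen_eqMixin (ncexpr k g).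
HB.instance Definition _ (k : Type) (g : nat) := gen_choiceMixin (ncexpr k g).

Section Evaluation.
Variables (k : fieldType) (g : nat) (A : unitAlgType k) (X : 'I_g -> A).

Fixpoint nceval (e : ncexpr k g) : A :=
  match e with
  | NcConst c => c%:A
  | NcVar i => X i
  | NcAdd e1 e2 => nceval e1 + nceval e2
  | NcMul e1 e2 => nceval e1 * nceval e2
  | NcInv e1 => (nceval e1)^-1
  end.

(* Since [x^-1] is a total operation, this guards [nceval]. *)
Fixpoint ncdef (e : ncexpr k g) : bool :=
  match e with
  | NcConst _ | NcVar _ => true
  | NcAdd e1 e2 | NcMul e1 e2 => ncdef e1 && ncdef e2
  | NcInv e1 => ncdef e1 && (nceval e1 \is a GRing.unit)
  end.

End Evaluation.

(* The disjoint union over n >= 1 of M_n(k)^g; the tag n stands for size n.+1. *)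
Definition ncpoint (k : fieldType) (g : nat) : Type :=
  {n : nat & 'I_g -> 'M[k]_n.+1}.

Definition ncorigin (k : fieldType) (g : nat) : ncpoint k g :=
  existT (fun n => 'I_g -> 'M[k]_n.+1) 0 (fun=> 0).

Definition exprdom (k : fieldType) (g : nat) (e : ncexpr k g) :
  set (ncpoint k g) := [set X | ncdef (projT2 X) e].

Definition expr_equiv (k : fieldType) (g : nat) (e1 e2 : ncexpr k g) : Prop :=
  forall X, (exprdom e1 `&` exprdom e2) X ->
  nceval (projT2 X) e1 = nceval (projT2 X) e2.

Definition ndexpr (k : fieldType) (g : nat) : Type :=
  {e : ncexpr k g | `[< exprdom e !=set0 >]}.

HB.instance Definition _ (k : fieldType) (g : nat) :=
  Choice.on (ndexpr k g).

Section Morphism.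
Variables (k : fieldType) (g : nat) (A B : unitAlgType k).
Variables (phi : {lrmorphism A -> B}) (X : 'I_g -> A).

Lemma ncdef_morph e : ncdef X e ->
  ncdef (phi \o X) e /\ nceval (phi \o X) e = phi (nceval X e).
Proof.
elim: e => [c|i|e1 IH1 e2 IH2|e1 IH1 e2 IH2|e IH] //=.
- by rewrite linearZ rmorph1.
- by move=> /andP[/IH1[-> ->] /IH2[-> ->]]; rewrite rmorphD.
- by move=> /andP[/IH1[-> ->] /IH2[-> ->]]; rewrite rmorphM.
- by move=> /andP[/IH[-> ->] u]; rewrite rmorphV // rmorph_unit.
Qed.

End Morphism.

Section Ampliation.
Variables (k : fieldType) (m n : nat).

Definition ampl (M : 'M[k]_m.+1) : 'M[k]_((n + m * n.+1).+1) :=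
  tensmx M (1%:M : 'M_n.+1).
Definition ampr (M : 'M[k]_n.+1) : 'M[k]_((n + m * n.+1).+1) :=
  tensmx (1%:M : 'M_m.+1) M.

Fact ampl_linear : linear ampl.
Proof. by move=> a M N; apply/matrixP=> i j; rewrite !mxE mulrDl mulrA. Qed.
HB.instance Definition _ := GRing.isLinear.Build _ _ _ _ ampl ampl_linear.

Fact ampr_linear : linear ampr.
Proof.
by move=> a M N; apply/matrixP=> i j; rewrite !mxE mulrDr !mulrA [_%:R * a]mulrC.
Qed.
HB.instance Definition _ := GRing.isLinear.Build _ _ _ _ ampr ampr_linear.

Fact tensmx11 : tensmx 1%:M 1%:M = 1%:M :> 'M[k]_(m.+1 * n.+1).
Proof.
apply/matrixP=> i j; case: (mxtens_indexP i) => i1 i2.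
case: (mxtens_indexP j) => j1 j2; rewrite tensmxE !mxE -natrM mulnb -xpair_eqE.
by rewrite (can_eq (@mxtens_indexK _ _)).
Qed.

Fact ampl_monoid : monoid_morphism ampl.
Proof.
split; first exact: tensmx11.
by move=> M N; have := esym (tensmx_mul M (1%:M : 'M_n.+1) N 1%:M); rewrite mul1mx.
Qed.
HB.instance Definition _ := GRing.isMonoidMorphism.Build _ _ ampl ampl_monoid.

Fact ampr_monoid : monoid_morphism ampr.
Proof.
split; first exact: tensmx11.
by move=> M N; have := esym (tensmx_mul (1%:M : 'M_m.+1) M 1%:M N); rewrite mul1mx.
Qed.
HB.instance Definition _ := GRing.isMonoidMorphism.Build _ _ ampr ampr_monoid.

Lemma ampl_inj : injective ampl.
Proof.
pose h (i : 'I_m.+1) := @mxtens_index m.+1 n.+1 (i, ord0).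
have E Q i j : ampl Q (h i) (h j) = Q i j.
  by apply: etrans (tensmxE _ _ _ _ _ _) _; rewrite mxE eqxx mulr1.
by move=> M N MN; apply/matrixP=> i j; rewrite -E MN E.
Qed.

End Ampliation.

Section Density.
Variables (k : fieldType) (k0 : [pchar k] =i pred0) (g : nat).

Lemma poly_cofinite (p : {poly k}) : (forall n : nat, p.[n%:R] = 0) -> p = 0.
Proof.
move=> p0; apply/eqP; apply: contraT => pN0.
have := @max_poly_roots k p [seq i%:R | i <- iota 0 (size p)] pN0.
rewrite size_map size_iota ltnn; apply.
  by apply/allP=> _ /mapP[i _ ->]; apply/rootP.
rewrite map_inj_in_uniq ?iota_uniq // => i j _ _ /eqP.
wlog ij : i j / (i <= j)%N.
  move=> H; have [/H//|/ltnW ji] := leqP i j.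
  by rewrite eq_sym => /(H _ _ ji).
rewrite -(subnK ij) natrD -subr_eq0 opprD addrCA subrr addr0 oppr_eq0.
by rewrite ((pcharf0P _).1 k0) => /eqP ->.
Qed.

Variables (n : nat) (X Y : 'I_g -> 'M[k]_n.+1).

Definition ncline (t : k) : 'I_g -> 'M[k]_n.+1 :=
  fun i => X i + t *: (Y i - X i).

Let ev (t : k) (P : 'M[{poly k}]_n.+1) : 'M[k]_n.+1 := map_mx (horner_eval t) P.

Lemma ncline_eval e t0 : ncdef (ncline t0) e ->
  exists (q : {poly k}) (P : 'M[{poly k}]_n.+1), q.[t0] != 0 /\
    forall t, q.[t] != 0 ->
      ncdef (ncline t) e /\ q.[t] *: nceval (ncline t) e = ev t P.
Proof.
elim: e => [c|i|e1 IH1 e2 IH2|e1 IH1 e2 IH2|e IH] /=.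
- move=> _; exists 1, (c%:P%:M); rewrite hornerC oner_neq0; split=> // t _.
  split=> //; rewrite hornerC scale1r; apply/matrixP=> i j; rewrite !mxE.
  by rewrite /horner_eval; case: eqP; rewrite ?mulr1n ?mulr0n ?hornerC ?mulr1 ?mulr0 ?horner0.
- move=> _; exists 1, (\matrix_(a, b) ((X i a b)%:P + 'X * (Y i a b - X i a b)%:P)).
  rewrite hornerC oner_neq0; split=> // t _; split=> //.
  by rewrite hornerC scale1r; apply/matrixP=> a b; rewrite !mxE /horner_eval !hornerE.
- move=> /andP[/IH1[q1 [P1 [q1t0 H1]]] /IH2[q2 [P2 [q2t0 H2]]]].
  exists (q1 * q2), (q2 *: P1 + q1 *: P2); rewrite hornerM mulf_neq0 //; split=> // t.
  rewrite hornerM mulf_eq0 => /norP[/H1[-> E1] /H2[-> E2]]; split=> //.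
  rewrite scalerDr {1}mulrC -!scalerA E1 E2.
  by apply/matrixP=> a b; rewrite !mxE /horner_eval !hornerE.
- move=> /andP[/IH1[q1 [P1 [q1t0 H1]]] /IH2[q2 [P2 [q2t0 H2]]]].
  exists (q1 * q2), (P1 *m P2); rewrite hornerM mulf_neq0 //; split=> // t.
  rewrite hornerM mulf_eq0 => /norP[/H1[-> E1] /H2[-> E2]]; split=> //.
  by rewrite /ev map_mxM -!/(ev t _) -E1 -E2 -scalemxAl -scalemxAr scalerA.
- move=> /andP[/IH[q [P [qt0 H]]]] u.
  have detP t : q.[t] != 0 ->
      (\det P).[t] = q.[t] ^+ n.+1 * \det (nceval (ncline t) e).
    by move=> /H[_ E]; rewrite -[LHS]/(horner_eval t _) -det_map_mx -/(ev t P) -E detZ.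
  exists (q * \det P), (q ^+ 2 *: \adj P); split.
    rewrite hornerM mulf_neq0 // detP // mulf_neq0 ?expf_neq0 //.
    by rewrite -unitfE -unitmxE.
  move=> t; rewrite hornerM mulf_eq0 => /norP[qt dt]; have [-> E] := H t qt.
  have ut : nceval (ncline t) e \in unitmx.
    by rewrite unitmxE unitfE; move: dt; rewrite detP // mulf_eq0 => /norP[].
  split; first exact: ut.
  apply: (can_inj (mulKmx ut)); rewrite -scalemxAr mulmxV //.
  have -> : ev t (q ^+ 2 *: \adj P) = q.[t] ^+ 2 *: \adj (ev t P).
    by rewrite /ev map_mxZ map_mx_adj rmorphXn.
  have -> : nceval (ncline t) e *m (q.[t] ^+ 2 *: \adj (ev t P)) =
            q.[t] *: (ev t P *m \adj (ev t P)).
    by rewrite -{2}E -scalemxAl scalerA -expr2 -scalemxAr.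
  by rewrite mul_mx_adj det_map_mx !scale_scalar_mx mulr1.
Qed.

Lemma ncline0 : ncline 0 = X.
Proof. by apply/funext=> i; rewrite /ncline scale0r addr0. Qed.

Lemma ncline1 : ncline 1 = Y.
Proof. by apply/funext=> i; rewrite /ncline scale1r addrC subrK. Qed.

Lemma poly_common (p q : {poly k}) : p != 0 -> q != 0 ->
  exists t, p.[t] != 0 /\ q.[t] != 0.
Proof.
move=> p0 q0; apply: contrapT => /forallNP H.
have : p * q = 0.
  apply: poly_cofinite => i; apply/eqP; rewrite hornerM mulf_eq0.
  by have /not_andP[/negP|/negP] := H i%:R; rewrite negbK => ->; rewrite ?orbT.
by apply/eqP; rewrite mulf_neq0.
Qed.

Lemma horner_neq0 (p : {poly k}) t : p.[t] != 0 -> p != 0.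
Proof. by apply: contraNneq => ->; rewrite horner0. Qed.

Lemma ncdef_common e1 e2 : ncdef X e1 -> ncdef Y e2 ->
  exists Z : 'I_g -> 'M[k]_n.+1, ncdef Z e1 && ncdef Z e2.
Proof.
rewrite -{1}ncline0 -{1}ncline1.
move=> /ncline_eval[q1 [P1 [/horner_neq0 q10 H1]]].
move=> /ncline_eval[q2 [P2 [/horner_neq0 q20 H2]]].
have [t [/H1[d1 _] /H2[d2 _]]] := poly_common q10 q20.
by exists (ncline t); rewrite d1 d2.
Qed.

Lemma nceval_dense e1 e2 e3 : ncdef X e1 -> ncdef Y e2 -> ncdef X e3 ->
  (forall Z : 'I_g -> 'M[k]_n.+1,
     ncdef Z e1 -> ncdef Z e2 -> ncdef Z e3 -> nceval Z e1 = nceval Z e3) ->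
  nceval X e1 = nceval X e3.
Proof.
rewrite -{1 2}ncline0 -{1}ncline1.
move=> /ncline_eval[q1 [P1 [q1t H1]]] /ncline_eval[q2 [P2 [/horner_neq0 q20 H2]]].
move=> /ncline_eval[q3 [P3 [q3t H3]]] H.
have E : q3 *: P1 = q1 *: P3.
  apply/matrixP=> a b; apply/eqP; rewrite -subr_eq0.
  set p := _ - _; have : q1 * q2 * q3 * p = 0.
    apply: poly_cofinite => i; rewrite !hornerM.
    have [->|d1] := eqVneq q1.[i%:R] 0; first by rewrite !mul0r.
    have [->|d2] := eqVneq q2.[i%:R] 0; first by rewrite mulr0 !mul0r.
    have [->|d3] := eqVneq q3.[i%:R] 0; first by rewrite mulr0 !mul0r.
    have [D1 E1] := H1 _ d1; have [D3 E3] := H3 _ d3; have [D2 _] := H2 _ d2.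
    suff -> : p.[i%:R] = 0 by rewrite mulr0.
    rewrite /p !mxE hornerD hornerN !hornerM.
    have -> : (P1 a b).[i%:R] = ev i%:R P1 a b by rewrite mxE.
    have -> : (P3 a b).[i%:R] = ev i%:R P3 a b by rewrite mxE.
    by rewrite -E1 -E3 (H _ D1 D2 D3) !mxE mulrCA subrr.
  move/eqP; rewrite !mulf_eq0 (negPf q20) (negPf (horner_neq0 q1t)).
  by rewrite (negPf (horner_neq0 q3t)).
have [_ E1] := H1 _ q1t; have [_ E3] := H3 _ q3t.
rewrite ncline0 in E1 E3.
apply: (scalerI q1t); apply: (scalerI q3t).
have evZ (q : {poly k}) P : ev 0 (q *: P) = q.[0] *: ev 0 P by rewrite /ev map_mxZ.
by rewrite [in RHS]scalerA mulrC -scalerA E1 E3 -!evZ E.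
Qed.

End Density.

Section Equivalence.
Variables (k : fieldType) (k0 : [pchar k] =i pred0) (g : nat).
Implicit Types e : ncexpr k g.

Lemma exprdom_common e1 e2 : exprdom e1 !=set0 -> exprdom e2 !=set0 ->
  exprdom e1 `&` exprdom e2 !=set0.
Proof.
move=> [[m X] d1] [[n Y] d2].
have [D1 _] := ncdef_morph (@ampl k m n) d1.
have [D2 _] := ncdef_morph (@ampr k m n) d2.
have [Z /andP[Z1 Z2]] := ncdef_common k0 D1 D2.
by exists (existT _ _ Z).
Qed.

Lemma expr_equiv_trans e1 e2 e3 : exprdom e2 !=set0 ->
  expr_equiv e1 e2 -> expr_equiv e2 e3 -> expr_equiv e1 e3.
Proof.
move=> [[n Y] d2] e12 e23 [m X] [/= d1 d3].
have [D1 E1] := ncdef_morph (@ampl k m n) d1.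
have [D3 E3] := ncdef_morph (@ampl k m n) d3.
have [D2 _] := ncdef_morph (@ampr k m n) d2.
apply: (@ampl_inj _ _ n); rewrite -E1 -E3; apply: (nceval_dense k0 D1 D2 D3).
move=> Z Z1 Z2 Z3; rewrite (e12 (existT _ _ Z)) //; exact: (e23 (existT _ _ Z)).
Qed.

Definition nd_equiv (e1 e2 : ndexpr k g) : bool :=
  `[< expr_equiv (val e1) (val e2) >].

Lemma nd_dom (e : ndexpr k g) : exprdom (val e) !=set0.
Proof. exact/asboolP/(valP e). Qed.

Fact nd_equiv_refl : reflexive nd_equiv.
Proof. by move=> e; apply/asboolP. Qed.

Fact nd_equiv_sym : symmetric nd_equiv.
Proof. by move=> e f; apply/asboolP/asboolP => H X [d1 d2]; rewrite H. Qed.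

Fact nd_equiv_trans : transitive nd_equiv.
Proof.
move=> e2 e1 e3 /asboolP H1 /asboolP H2; apply/asboolP.
exact: expr_equiv_trans (nd_dom e2) H1 H2.
Qed.

Definition nd_equiv_rel : equiv_rel (ndexpr k g) :=
  EquivRel nd_equiv nd_equiv_refl nd_equiv_sym nd_equiv_trans.

Fact const_dom c : exprdom (@NcConst k g c) !=set0.
Proof. by exists (ncorigin k g). Qed.

Fact var_dom i : exprdom (@NcVar k g i) !=set0.
Proof. by exists (ncorigin k g). Qed.

Fact add_dom (e f : ndexpr k g) : exprdom (NcAdd (val e) (val f)) !=set0.
Proof.
by have [X [d1 d2]] := exprdom_common (nd_dom e) (nd_dom f); exists X; apply/andP.
Qed.

Fact mul_dom (e f : ndexpr k g) : exprdom (NcMul (val e) (val f)) !=set0.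
Proof. exact: add_dom. Qed.

Definition nd_mk e (H : exprdom e !=set0) : ndexpr k g := exist _ e (asboolT H).
Definition nd_const c := nd_mk (const_dom c).
Definition nd_var i := nd_mk (var_dom i).
Definition nd_add (e f : ndexpr k g) := nd_mk (add_dom e f).
Definition nd_mul (e f : ndexpr k g) := nd_mk (mul_dom e f).

End Equivalence.

(* The field is infinite by k0; over finite fields the relation need not be
   transitive. *)
Definition ncrat (k : fieldType) (k0 : [pchar k] =i pred0) (g : nat) : Type :=
  {eq_quot nd_equiv_rel k0 g}.

Section NcratAlgebra.
Variables (k : fieldType) (k0 : [pchar k] =i pred0) (g : nat).
Local Notation T := (ncrat k0 g).
Implicit Types (e f h : ndexpr k g) (x y z : T) (c : k).

HB.instance Definition _ := EqQuotient.on T.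
HB.instance Definition _ := Choice.on T.

Lemma ncrat_eq e f :
  (forall n (X : 'I_g -> 'M[k]_n.+1), ncdef X (val e) -> ncdef X (val f) ->
     nceval X (val e) = nceval X (val f)) -> \pi_T e = \pi_T f.
Proof.
move=> H; apply/eqmodP/asboolP => -[n X] [/= d1 d2]; exact: H.
Qed.

Lemma ncrat_eqP e f : \pi_T e = \pi_T f -> expr_equiv (val e) (val f).
Proof. by move/eqmodP/asboolP. Qed.

Definition ncconst c : T := \pi_T (nd_const g c).
Definition ncvar i : T := \pi_T (nd_var k i).
Definition ncrat_add := lift_op2 T (@nd_add k k0 g).
Definition ncrat_mul := lift_op2 T (@nd_mul k k0 g).

Lemma pi_add : {morph \pi_T : e f / @nd_add k k0 g e f >-> ncrat_add e f}.
Proof.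
move=> e f; unlock ncrat_add; apply: ncrat_eq => n X /= /andP[d1 d2] /andP[d3 d4].
have /ncrat_eqP E1 : \pi_T e = \pi_T (repr (\pi_T e)) by rewrite reprK.
have /ncrat_eqP E2 : \pi_T f = \pi_T (repr (\pi_T f)) by rewrite reprK.
by rewrite (E1 (existT _ n X)) // (E2 (existT _ n X)).
Qed.
Canonical pi_add_morph := PiMorph2 pi_add.

Lemma pi_mul : {morph \pi_T : e f / @nd_mul k k0 g e f >-> ncrat_mul e f}.
Proof.
move=> e f; unlock ncrat_mul; apply: ncrat_eq => n X /= /andP[d1 d2] /andP[d3 d4].
have /ncrat_eqP E1 : \pi_T e = \pi_T (repr (\pi_T e)) by rewrite reprK.
have /ncrat_eqP E2 : \pi_T f = \pi_T (repr (\pi_T f)) by rewrite reprK.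
by rewrite (E1 (existT _ n X)) // (E2 (existT _ n X)).
Qed.
Canonical pi_mul_morph := PiMorph2 pi_mul.

Definition ncrat_opp x := ncrat_mul (ncconst (-1)) x.
Definition ncrat_scale c x := ncrat_mul (ncconst c) x.

Fact ncrat_addA : associative ncrat_add.
Proof.
by elim/quotW=> e; elim/quotW=> f; elim/quotW=> h; rewrite !piE;
  apply: ncrat_eq => n X _ _; apply: addrA.
Qed.

Fact ncrat_addC : commutative ncrat_add.
Proof.
by elim/quotW=> e; elim/quotW=> f; rewrite !piE;
  apply: ncrat_eq => n X _ _; apply: addrC.
Qed.

Fact ncrat_add0 : left_id (ncconst 0) ncrat_add.
Proof.
elim/quotW=> e; rewrite /ncconst !piE; apply: ncrat_eq => n X _ _ /=.
by rewrite scale0r add0r.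
Qed.

Fact ncrat_addN : left_inverse (ncconst 0) ncrat_opp ncrat_add.
Proof.
elim/quotW=> e; rewrite /ncrat_opp /ncconst !piE; apply: ncrat_eq => n X _ _ /=.
by rewrite scale0r scaleN1r mulN1r addNr.
Qed.

HB.instance Definition _ :=
  GRing.isZmodule.Build T ncrat_addA ncrat_addC ncrat_add0 ncrat_addN.

Fact ncrat_mulA : associative ncrat_mul.
Proof.
by elim/quotW=> e; elim/quotW=> f; elim/quotW=> h; rewrite !piE;
  apply: ncrat_eq => n X _ _; apply: mulrA.
Qed.

Fact ncrat_mul1 : left_id (ncconst 1) ncrat_mul.
Proof.
elim/quotW=> e; rewrite /ncconst !piE; apply: ncrat_eq => n X _ _ /=.
by rewrite scale1r mul1r.
Qed.

Fact ncrat_mulr1 : right_id (ncconst 1) ncrat_mul.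
Proof.
elim/quotW=> e; rewrite /ncconst !piE; apply: ncrat_eq => n X _ _ /=.
by rewrite scale1r mulr1.
Qed.

Fact ncrat_mulDl : left_distributive ncrat_mul ncrat_add.
Proof.
by elim/quotW=> e; elim/quotW=> f; elim/quotW=> h; rewrite !piE;
  apply: ncrat_eq => n X _ _; apply: mulrDl.
Qed.

Fact ncrat_mulDr : right_distributive ncrat_mul ncrat_add.
Proof.
by elim/quotW=> e; elim/quotW=> f; elim/quotW=> h; rewrite !piE;
  apply: ncrat_eq => n X _ _; apply: mulrDr.
Qed.

Fact ncrat_1N0 : ncconst 1 != ncconst 0.
Proof.
apply/eqP => /ncrat_eqP /(_ (ncorigin k g) (conj erefl erefl)) /=.
by rewrite scale1r scale0r => /eqP; rewrite oner_eq0.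
Qed.

HB.instance Definition _ := GRing.Zmodule_isNzRing.Build T
  ncrat_mulA ncrat_mul1 ncrat_mulr1 ncrat_mulDl ncrat_mulDr ncrat_1N0.

Fact ncconstM a b : ncconst (a * b) = ncconst a * ncconst b.
Proof.
rewrite /ncconst -[RHS]pi_mul; apply: ncrat_eq => n X _ _ /=.
by rewrite -scalerAl mul1r scalerA.
Qed.

Fact ncconstD a b : ncconst (a + b) = ncconst a + ncconst b.
Proof.
rewrite /ncconst -[RHS]pi_add; apply: ncrat_eq => n X _ _ /=.
by rewrite scalerDl.
Qed.

Fact ncconst_comm a x : ncconst a * x = x * ncconst a.
Proof.
elim/quotW: x => e; rewrite /ncconst -[LHS]pi_mul -[RHS]pi_mul.
apply: ncrat_eq => n X _ _ /=.
by rewrite -scalerAl -scalerAr mul1r mulr1.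
Qed.

Fact ncrat_scaleA a b x :
  ncrat_scale a (ncrat_scale b x) = ncrat_scale (a * b) x.
Proof. by rewrite /ncrat_scale ncconstM; apply: mulrA. Qed.

Fact ncrat_scale1 : left_id 1 ncrat_scale.
Proof. exact: mul1r. Qed.

Fact ncrat_scaleDr : right_distributive ncrat_scale +%R.
Proof. by move=> a x y; apply: mulrDr. Qed.

Fact ncrat_scaleDl x : {morph ncrat_scale^~ x : a b / a + b}.
Proof. by move=> a b; rewrite /ncrat_scale ncconstD; apply: mulrDl. Qed.

HB.instance Definition _ := GRing.Zmodule_isLmodule.Build k T
  ncrat_scaleA ncrat_scale1 ncrat_scaleDr ncrat_scaleDl.

Fact ncrat_scaleAl a x y : a *: (x * y) = (a *: x) * y.
Proof. exact: mulrA. Qed.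

HB.instance Definition _ := GRing.Lmodule_isLalgebra.Build k T ncrat_scaleAl.

Fact ncrat_scaleAr a x y : a *: (x * y) = x * (a *: y).
Proof.
rewrite -[LHS]/(ncconst a * (x * y)) -[a *: y]/(ncconst a * y).
by rewrite mulrA ncconst_comm mulrA.
Qed.

HB.instance Definition _ := GRing.Lalgebra_isAlgebra.Build k T ncrat_scaleAr.

End NcratAlgebra.

Section Combinations.
Variables (k : fieldType) (T : algType k).

Definition lin_indep (s : seq T) : Prop :=
  forall c : 'I_(size s) -> k,
    \sum_(i < size s) c i *: s`_i = 0 -> forall i, c i = 0.

Definition in_span (s : seq T) (f : T) : Prop :=
  exists c : 'I_(size s) -> k, f = \sum_(i < size s) c i *: s`_i.

(* A polynomial is a list of pairs (coefficient, word with letters in S). *)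
Definition is_ncpoly_in (S : set T) (f : T) : Prop :=
  exists2 p : seq (k * seq T),
    forall m y, m \in p -> y \in m.2 -> S y &
    f = \sum_(m <- p) m.1 *: \prod_(y <- m.2) y.

End Combinations.

Section MatrixAlgebras.
Variables (k : fieldType) (d : nat).
Implicit Types S I : set 'M[k]_d.

Definition mx_subspace S : Prop :=
  S 0 /\ forall (a : k) M N, S M -> S N -> S (a *: M + N).

Definition mx_nonunital_subalg S : Prop :=
  mx_subspace S /\ forall M N, S M -> S N -> S (M *m N).

Definition gen_mxalg (g : nat) (A : 'I_g -> 'M[k]_d) : set 'M[k]_d :=
  smallest mx_nonunital_subalg (range A).

Definition mx_ideal_of S I : Prop :=
  [/\ I `<=` S, mx_subspace I &
      forall M N, S M -> I N -> I (M *m N) /\ I (N *m M)].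

Definition simple_mxalg S : Prop :=
  (exists M N, [/\ S M, S N & M *m N != 0]) /\
  (forall I, mx_ideal_of S I -> I = [set 0] \/ I = S).

End MatrixAlgebras.

Section Pencils.
Variables (k : fieldType) (g d : nat) (A : 'I_g -> 'M[k]_d).

Definition pencil_eval (n : nat) (X : 'I_g -> 'M[k]_n) : 'M[k]_(d * n) :=
  tensmx 1%:M 1%:M - \sum_(i < g) tensmx (A i) (X i).

Definition free_locus : set (ncpoint k g) :=
  [set X | \det (pencil_eval (projT2 X)) = 0].

End Pencils.

Definition minimal_pencil (k : fieldType) (g d : nat) (A : 'I_g -> 'M[k]_d) :
    Prop :=
  forall (d' : nat) (B : 'I_g -> 'M[k]_d'),
    free_locus B = free_locus A -> (d <= d')%N.

Section Domains.
Variables (k : fieldType) (k0 : [pchar k] =i pred0) (g : nat).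
Local Notation T := (ncrat k0 g).

Definition ncrat_dom (f : T) : set (ncpoint k g) :=
  [set X | exists2 e : ndexpr k g, \pi_T e = f & exprdom (val e) X].

Definition Dom0 : set (set (ncpoint k g)) :=
  [set D | exists2 f : T, D = ncrat_dom f & ncrat_dom f (ncorigin k g)].

Definition coirreducible (D : set (ncpoint k g)) : Prop :=
  Dom0 D /\
  ~ exists D1 D2, [/\ Dom0 D1, Dom0 D2, D `<` D1, D `<` D2 & D = D1 `&` D2].

Definition pencil_mx (d : nat) (A : 'I_g -> 'M[k]_d) : 'M[T]_d :=
  1%:M - \sum_(i < g) ncvar k0 i *: map_mx (in_alg T) (A i).

(* f = c^t L_A^-1 b, where M is the two-sided inverse of L_A over T. *)
Definition realizes (d : nat) (A : 'I_g -> 'M[k]_d) (b c : 'cV[k]_d) (f : T) :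
    Prop :=
  exists M : 'M[T]_d,
    [/\ M *m pencil_mx A = 1%:M, pencil_mx A *m M = 1%:M &
        f%:M = (map_mx (in_alg T) c)^T *m M *m map_mx (in_alg T) b].

Definition irreducible_ncrat (f : T) : Prop :=
  exists (d : nat) (A : 'I_g -> 'M[k]_d) (b c : 'cV[k]_d),
    [/\ minimal_pencil A, simple_mxalg (gen_mxalg A) & realizes A b c f].

(* The members of s are not required to have domain D. *)
Definition spanning_family (D : set (ncpoint k g)) (s : seq T) : Prop :=
  [/\ forall f, f \in s -> irreducible_ncrat f,
      lin_indep s &
      forall f, irreducible_ncrat f -> ncrat_dom f = D -> in_span s f].

End Domains.

(* Main.v *)
(* A function regular at 0 has a realization c L_A^-1 b; take one of least size.
   Then dom r is the complement of the free locus of A.  If L_A(X) is invertible,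
   its inverse is a polynomial in L_A(X) by Cayley-Hamilton, so after multiplying
   L_A by that polynomial every pivot of Gaussian elimination is 1 at X, and the
   entries of L_A^-1 are defined at X.  Conversely, if an expression e of r is
   defined at X, then its values at block triangular points give
   sum p_s(Y) W q_s(Z) = sum_i (c L_A^-1)(Y) (A_i (x) W) (L_A^-1 b)(Z), with p_s
   defined at X; by minimality the vectors (L_A^-1 b)(Z)_(r,s) span k^d, which puts
   the entries of c L_A^-1, and then those of L_A^-1, in the ring of functions
   defined at X.

   Block triangularising A along a composition series of k^d expresses the entries
   of L_A^-1 as polynomials in the x_i and the entries of L_B^-1, for B running over
   the nonzero irreducible factors, and the free locus of A is the union of theirs.
   For irreducible B the locus Z(B) lies in Z(C) exactly when every nc polynomial p
   without constant term that vanishes at C vanishes at B: otherwise, by density,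
   some p has p(C) = 0 and p(B) = 1, and a minimal realization X of (1 - p)^-1
   lies in Z(B) but not in Z(C).  This gives co-irreducibility of the complement of
   Z(B) (use the product of two such p), and, since faithful simple modules of a
   simple algebra are isomorphic, that Z(B) determines B up to similarity. *)
Require Import Defs.
From mathcomp Require Import all_boot all_order all_algebra generic_quotient.
From mathcomp Require Import boolp classical_sets.
From mathcomp.real_closed Require Import mxtens.
From mathcomp Require Import ring.
Set Implicit Arguments.
Unset Strict Implicit.
Unset Printing Implicit Defensive.
Import GRing.Theory.
Local Open Scope classical_set_scope.
Local Open Scope ring_scope.
Local Open Scope quotient_scope.

(** * Evaluation of rational functions at matrix points *)

Section EvaluationAtPoint.
Variables (k : fieldType) (k0 : [pchar k] =i pred0) (g : nat).
Local Notation T := (ncrat k0 g).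

(** A relation, because a function is defined at [X] as soon as one representative is; [evalsto_inj]
    makes the value independent of the representative. *)
Definition evalsto n (X : 'I_g -> 'M[k]_n.+1) (f : T) (V : 'M[k]_n.+1) : Prop :=
  exists e : ndexpr k g, [/\ \pi_T e = f, ncdef X (val e) & nceval X (val e) = V].

Section AtPoint.
Variables (n : nat) (X : 'I_g -> 'M[k]_n.+1).
Implicit Types (f h : T) (U V : 'M[k]_n.+1).

Lemma evalsto_inj f U V : evalsto X f U -> evalsto X f V -> U = V.
Proof.
move=> [e1 [E1 d1 <-]] [e2 [E2 d2 <-]].
have /ncrat_eqP H : \pi_T e1 = \pi_T e2 by rewrite E1 E2.
exact: (H (existT _ n X)).
Qed.

Lemma ncrat_domP f : ncrat_dom f (existT _ n X) <-> exists V, evalsto X f V.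
Proof.
split=> [[e Ee De]|[V [e [Ee De _]]]]; last by exists e.
by exists (nceval X (val e)), e.
Qed.

Lemma evalsto_const (c : k) : evalsto X c%:A c%:A.
Proof.
by exists (nd_const g c); split=> //; rewrite -[RHS]/(ncconst k0 g c * 1) mulr1.
Qed.

Lemma evalsto_var i : evalsto X (ncvar k0 i) (X i).
Proof. by exists (nd_var k i). Qed.

Lemma evalstoD f h U V : evalsto X f U -> evalsto X h V -> evalsto X (f + h) (U + V).
Proof.
move=> [e1 [<- d1 <-]] [e2 [<- d2 <-]]; exists (nd_add k0 e1 e2).
by split; [exact: (Defs.pi_add k0)|rewrite /= d1 d2|].
Qed.

Lemma evalstoM f h U V : evalsto X f U -> evalsto X h V -> evalsto X (f * h) (U * V).
Proof.
move=> [e1 [<- d1 <-]] [e2 [<- d2 <-]]; exists (nd_mul k0 e1 e2).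
by split; [exact: (Defs.pi_mul k0)|rewrite /= d1 d2|].
Qed.

Lemma evalstoZ c f U : evalsto X f U -> evalsto X (c *: f) (c *: U).
Proof.
by move=> /(evalstoM (evalsto_const c)); rewrite -!scalerAl !mul1r.
Qed.

Lemma evalstoN f U : evalsto X f U -> evalsto X (- f) (- U).
Proof. by move=> /(evalstoZ (-1)); rewrite !scaleN1r. Qed.

Lemma evalsto0 : evalsto X 0 0.
Proof. by have := evalsto_const 0; rewrite !scale0r. Qed.

Lemma evalsto1 : evalsto X 1 1.
Proof. by have := evalsto_const 1; rewrite !scale1r. Qed.

Lemma evalsto_sum I (r : seq I) (P : pred I) (F : I -> T) (G : I -> 'M[k]_n.+1) :
  (forall i, P i -> evalsto X (F i) (G i)) ->
  evalsto X (\sum_(i <- r | P i) F i) (\sum_(i <- r | P i) G i).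
Proof.
by move=> H; apply: (big_ind2 (evalsto X)) => //; [exact: evalsto0|move=> *; exact: evalstoD].
Qed.

Lemma evalstoV f V : evalsto X f V -> V \is a GRing.unit ->
  exists h, [/\ f * h = 1, h * f = 1 & evalsto X h V^-1].
Proof.
move=> [e [<- d EV]] uV.
have ne : exprdom (NcInv (val e)) !=set0.
  by exists (existT _ n X); rewrite /exprdom /= d EV.
have one : \pi_T (nd_const g 1) = 1 by [].
exists (\pi_T (nd_mk ne)); split; last first.
- by exists (nd_mk ne); split=> //=; [rewrite d EV|rewrite EV].
- rewrite -one; apply: etrans (esym (Defs.pi_mul k0 _ _)) _; apply: ncrat_eq => m Y /=.
  by move=> /andP[/andP[dY uY] _] _; rewrite mulVr // scale1r.
- rewrite -one; apply: etrans (esym (Defs.pi_mul k0 _ _)) _; apply: ncrat_eq => m Y /=.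
  by move=> /andP[_ /andP[dY uY]] _; rewrite mulrV // scale1r.
Qed.

Lemma evalsto_expr e f : \pi_T e = f -> ncdef X (val e) ->
  evalsto X f (nceval X (val e)).
Proof. by exists e. Qed.

End AtPoint.

(* A summand 0 * e0 shrinks the domain of a representative without changing
   the function it represents. *)
Lemma ncrat_ext (e0 : ndexpr k g) (f h : T) :
  (forall n (X : 'I_g -> 'M[k]_n.+1) U V, ncdef X (val e0) ->
     evalsto X f U -> evalsto X h V -> U = V) -> f = h.
Proof.
pose sh e := nd_add k0 e (nd_mul k0 (nd_const g 0) e0).
have shE e : \pi_T (sh e) = \pi_T e.
  apply: etrans (Defs.pi_add k0 _ _) _.
  have -> : \pi_T (nd_mul k0 (nd_const g 0) e0) = 0 * \pi_T e0 by exact: Defs.pi_mul.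
  by rewrite mul0r; apply: addr0.
elim/quotW: f => e1; elim/quotW: h => e2 H.
rewrite -[LHS]shE -[RHS]shE; apply: ncrat_eq => n X d1 d2.
have [_ d0] : ncdef X (val e1) /\ ncdef X (val e0) by move: d1 => /= /andP[-> ->].
by apply: (H n X) => //; [rewrite -(shE e1)|rewrite -(shE e2)]; apply: evalsto_expr.
Qed.

Lemma evalsto0_neq n (X : 'I_g -> 'M[k]_n.+1) : ~ evalsto X 1 0.
Proof.
by move=> /(evalsto_inj (evalsto1 X)) /eqP; rewrite oner_eq0.
Qed.

Section Matrices.
Variables (n : nat) (X : 'I_g -> 'M[k]_n.+1).

Definition evmx p q (M : 'M[T]_(p, q)) (F : 'M['M[k]_n.+1]_(p, q)) : Prop :=
  forall i j, evalsto X (M i j) (F i j).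

Lemma evmxM p q r (M : 'M[T]_(p, q)) (N : 'M[T]_(q, r)) F G :
  evmx M F -> evmx N G -> evmx (M *m N) (F *m G).
Proof.
by move=> HM HN i j; rewrite !mxE; apply: evalsto_sum => l _; apply: evalstoM.
Qed.

Lemma evmxD p q (M N : 'M[T]_(p, q)) F G :
  evmx M F -> evmx N G -> evmx (M + N) (F + G).
Proof. by move=> HM HN i j; rewrite !mxE; apply: evalstoD. Qed.

Lemma evmxN p q (M : 'M[T]_(p, q)) F : evmx M F -> evmx (- M) (- F).
Proof. by move=> HM i j; rewrite !mxE; apply: evalstoN. Qed.

Lemma evmx_const p q (M : 'M[k]_(p, q)) :
  evmx (map_mx (in_alg T) M) (map_mx (in_alg 'M[k]_n.+1) M).
Proof. by move=> i j; rewrite !mxE; apply: evalsto_const. Qed.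

Lemma evmx_scalar p f V : evalsto X f V -> evmx (f%:M : 'M_p) V%:M.
Proof.
by move=> H i j; rewrite !mxE; case: eqP => _; rewrite ?mulr1n ?mulr0n //; apply: evalsto0.
Qed.

Lemma evmx_inj p q (M : 'M[T]_(p, q)) F G : evmx M F -> evmx M G -> F = G.
Proof. by move=> HF HG; apply/matrixP=> i j; apply: evalsto_inj (HF i j) (HG i j). Qed.

Lemma evmx_choice p q (M : 'M[T]_(p, q)) :
  (forall i j, exists V, evalsto X (M i j) V) -> exists F, evmx M F.
Proof.
move=> H; pose F i j := sval (cid (H i j)).
by exists (\matrix_(i, j) F i j) => i j; rewrite mxE /F; case: cid.
Qed.

End Matrices.
End EvaluationAtPoint.

(** * Pencils over algebras and their inverses *)

Section GenericPencil.
Variables (k : fieldType) (g : nat) (R : algType k) (x : 'I_g -> R).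

(** For [R] the algebra of rational functions and [x] the variables, [gpencil] is [pencil_mx] by
    conversion; for [R] a matrix algebra it is the value of the pencil at a point. *)
Definition gsum p q (A : 'I_g -> 'M[k]_(p, q)) : 'M[R]_(p, q) :=
  \sum_i x i *: map_mx (in_alg R) (A i).

Definition gpencil d (A : 'I_g -> 'M[k]_d) : 'M[R]_d := 1%:M - gsum A.

Lemma gsumE p q (A : 'I_g -> 'M[k]_(p, q)) i j :
  gsum A i j = \sum_l A l i j *: x l.
Proof.
by rewrite summxE; apply: eq_bigr => l _; rewrite !mxE -scalerAr mulr1.
Qed.

Lemma gpencilE d (A : 'I_g -> 'M[k]_d) i j :
  gpencil A i j = (i == j)%:R - \sum_l A l i j *: x l.
Proof. by rewrite 2!mxE [X in _ + X]mxE gsumE. Qed.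

Lemma map_in_alg_mulE p q r (B : 'M[k]_(p, q)) (M : 'M[R]_(q, r)) i j :
  (map_mx (in_alg R) B *m M) i j = \sum_l B i l *: M l j.
Proof. by rewrite mxE; apply: eq_bigr => l _; rewrite mxE -scalerAl mul1r. Qed.

Lemma mul_map_in_algE p q r (B : 'M[k]_(q, r)) (M : 'M[R]_(p, q)) i j :
  (M *m map_mx (in_alg R) B) i j = \sum_l B l j *: M i l.
Proof. by rewrite mxE; apply: eq_bigr => l _; rewrite mxE -scalerAr mulr1. Qed.

Lemma gsum_mull p q r (B : 'M[k]_(p, q)) (A : 'I_g -> 'M[k]_(q, r)) :
  map_mx (in_alg R) B *m gsum A = gsum (fun i => B *m A i).
Proof.
apply/matrixP=> i j; rewrite map_in_alg_mulE gsumE.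
under eq_bigr do rewrite gsumE scaler_sumr.
rewrite exchange_big; apply: eq_bigr => l _ /=; rewrite mxE scaler_suml.
by apply: eq_bigr => m _; rewrite scalerA.
Qed.

Lemma gsum_mulr p q r (A : 'I_g -> 'M[k]_(p, q)) (B : 'M[k]_(q, r)) :
  gsum A *m map_mx (in_alg R) B = gsum (fun i => A i *m B).
Proof.
apply/matrixP=> i j; rewrite mul_map_in_algE gsumE.
under eq_bigr do rewrite gsumE scaler_sumr.
rewrite exchange_big; apply: eq_bigr => l _ /=; rewrite mxE scaler_suml.
by apply: eq_bigr => m _; rewrite scalerA mulrC.
Qed.

Lemma gsum_block p1 p2 q1 q2 (A : 'I_g -> 'M[k]_(p1, q1)) B C
    (D : 'I_g -> 'M[k]_(p2, q2)) :
  gsum (fun i => block_mx (A i) (B i) (C i) (D i)) =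
  block_mx (gsum A) (gsum B) (gsum C) (gsum D).
Proof.
apply/matrixP=> i j; rewrite gsumE; case: (split_ordP i) => i' ->;
case: (split_ordP j) => j' ->;
rewrite ?block_mxEul ?block_mxEur ?block_mxEdl ?block_mxEdr gsumE;
by apply: eq_bigr => l _;
  rewrite ?block_mxEul ?block_mxEur ?block_mxEdl ?block_mxEdr.
Qed.

Lemma gsum0 p q (A : 'I_g -> 'M[k]_(p, q)) : (forall i, A i = 0) -> gsum A = 0.
Proof. by move=> A0; apply: big1 => i _; rewrite A0 map_mx0 scaler0. Qed.

Lemma gpencil_block d1 d2 (A : 'I_g -> 'M[k]_d1) B (D : 'I_g -> 'M[k]_d2) :
  gpencil (fun i => block_mx (A i) (B i) 0 (D i)) =
  block_mx (gpencil A) (- gsum B) 0 (gpencil D).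
Proof.
rewrite /gpencil gsum_block scalar_mx_block opp_block_mx add_block_mx.
by rewrite (gsum0 (fun=> erefl)) oppr0 addr0 add0r.
Qed.

Lemma gpencil_sim d1 d2 (S : 'M[k]_(d1, d2)) (A : 'I_g -> 'M[k]_d2) (B : 'I_g -> 'M[k]_d1) :
  (forall i, S *m A i = B i *m S) ->
  map_mx (in_alg R) S *m gpencil A = gpencil B *m map_mx (in_alg R) S.
Proof.
move=> E; rewrite mulmxBr mulmxBl mulmx1 mul1mx gsum_mull gsum_mulr.
by congr (_ - _); congr gsum; apply/funext.
Qed.

Lemma gpencil_block_inv d1 d2 (A : 'I_g -> 'M[k]_d1) B (D : 'I_g -> 'M[k]_d2) F1 F2 :
  gpencil A *m F1 = 1%:M -> gpencil D *m F2 = 1%:M ->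
  gpencil (fun i => block_mx (A i) (B i) 0 (D i)) *m
    block_mx F1 (F1 *m gsum B *m F2) 0 F2 = 1%:M.
Proof.
move=> E1 E2; rewrite gpencil_block mulmx_block !mulmx0 !mul0mx !addr0 add0r !mulmxA.
by rewrite E1 E2 mul1mx mulNmx subrr -scalar_mx_block.
Qed.

Lemma gpencil_sim_inv d1 d2 (S : 'M[k]_(d1, d2)) S' (A : 'I_g -> 'M[k]_d2)
    (B : 'I_g -> 'M[k]_d1) F :
  S *m S' = 1%:M -> S' *m S = 1%:M -> (forall i, S *m A i = B i *m S) ->
  gpencil B *m F = 1%:M ->
  gpencil A *m (map_mx (in_alg R) S' *m F *m map_mx (in_alg R) S) = 1%:M.
Proof.
move=> SS' S'S E BF; rewrite !mulmxA.
have -> : gpencil A *m map_mx (in_alg R) S' = map_mx (in_alg R) S' *m gpencil B.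
  rewrite -[LHS]mul1mx -(map_mx1 (in_alg R)) -S'S map_mxM -!mulmxA; congr (_ *m _).
  by rewrite !mulmxA (gpencil_sim E) -mulmxA -map_mxM SS' map_mx1 mulmx1.
by rewrite -[_ *m F]mulmxA BF mulmx1 -map_mxM S'S map_mx1.
Qed.

End GenericPencil.

(** * Matrices over a matrix algebra as scalar matrices *)

Section Flattening.
Variables (k : fieldType) (n : nat).

(** The indexing is that of [tensmx], so that flattening the value of a pencil gives
    [pencil_eval]. *)
Definition flatmx d (F : 'M['M[k]_n]_d) : 'M[k]_(d * n) :=
  \matrix_(p, q) F (mxtens_unindex p).1 (mxtens_unindex q).1
                   (mxtens_unindex p).2 (mxtens_unindex q).2.

Definition unflatmx d (M : 'M[k]_(d * n)) : 'M['M[k]_n]_d :=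
  \matrix_(i, j) \matrix_(a, b) M (mxtens_index (i, a)) (mxtens_index (j, b)).

Lemma flatmxK d : cancel (@flatmx d) (@unflatmx d).
Proof.
by move=> F; apply/matrixP=> i j; apply/matrixP=> a b; rewrite !mxE !mxtens_indexK.
Qed.

Lemma unflatmxK d : cancel (@unflatmx d) (@flatmx d).
Proof. by move=> F; apply/matrixP=> i j; rewrite !mxE !mxtens_unindexK. Qed.

End Flattening.

Section FlatteningRing.
Variables (k : fieldType) (n d : nat).
Local Notation Mn := 'M[k]_n.+1.
Implicit Types F G : 'M[Mn]_d.

Lemma flatmxM F G : flatmx (F *m G) = flatmx F *m flatmx G.
Proof.
apply/matrixP=> p q; rewrite !mxE summxE [RHS](reindex (@mxtens_index d n.+1)).
  transitivity (\sum_i \sum_j F (mxtens_unindex p).1 i (mxtens_unindex p).2 j * G i (mxtens_unindex q).1 j (mxtens_unindex q).2).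
    by apply: eq_bigr => i _; apply: mxE.
  rewrite pair_bigA; apply: eq_bigr => -[i j] _.
  by rewrite !mxE !mxtens_indexK.
by exists (@mxtens_unindex d n.+1) => i _; rewrite ?mxtens_indexK ?mxtens_unindexK.
Qed.

Lemma flatmx1 : flatmx (1%:M : 'M[Mn]_d) = 1%:M.
Proof.
apply/matrixP=> p q; rewrite !mxE.
case: (mxtens_indexP p) => i1 i2; case: (mxtens_indexP q) => j1 j2.
rewrite !mxtens_indexK (can_eq (@mxtens_indexK _ _)) xpair_eqE /=.
by case: eqP => _; rewrite ?mulr1n ?mulr0n mxE.
Qed.

End FlatteningRing.

Lemma flatmxP (k : fieldType) n d a (F G : 'M['M[k]_n.+1]_d) :
  flatmx (a%:M *: F + G) = a *: flatmx F + flatmx G.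
Proof.
have E i j : (a%:M *: F + G) i j = a *: F i j + G i j.
  rewrite [LHS]mxE [X in X + _]mxE; congr (_ + _); exact: mul_scalar_mx.
by apply/matrixP=> p q; rewrite [LHS]mxE E !mxE.
Qed.

(* By Cayley-Hamilton the inverse of S is a polynomial in S. *)
Lemma invmx_closed (k : fieldType) N (S : 'M[k]_N) (G : 'M[k]_N -> Prop) :
  G 1%:M -> (forall a U V, G U -> G V -> G (a *: U + V)) ->
  (forall U, G U -> G (U *m S)) -> S \in unitmx -> G (invmx S).
Proof.
case: N S G => [|N] S G G1 GL GS uS; first by rewrite (_ : invmx S = 1%:M) //; apply/matrixP=> -[].
pose p := char_poly S.
have G0 : G 0 by rewrite -(subrr 1%:M) -[- _]scaleN1r addrC; apply: GL.
have Gh q : G (horner_mx S q).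
  elim/poly_ind: q => [|q c IH]; first by rewrite rmorph0.
  rewrite rmorphD rmorphM /= horner_mx_X horner_mx_C -scalemx1 addrC.
  exact/GL/GS.
(* The constant term of the characteristic polynomial is det (- S), nonzero because [S] is
   invertible. *)
have p0 : p.[0] != 0.
  rewrite /p -horner_evalE -det_map_mx.
  have -> : map_mx (horner_eval 0) (char_poly_mx S) = - S.
    by apply/matrixP=> i j; rewrite !mxE /horner_eval hornerD hornerN hornerC hornerMn hornerX mul0rn sub0r.
  by rewrite -scaleN1r detZ mulf_neq0 ?expf_neq0 ?oppr_eq0 ?oner_neq0 // -unitfE -unitmxE.
have [q Eq] : exists q, p = q * 'X + p.[0]%:P.
  have /factor_theorem[q Eq] : root (p - p.[0]%:P) 0 by rewrite /root !hornerE subrr.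
  by exists q; rewrite -[p in LHS](subrK p.[0]%:P) Eq subr0.
have := Cayley_Hamilton S; rewrite -/p Eq rmorphD rmorphM /= horner_mx_X horner_mx_C.
move=> /eqP; rewrite addr_eq0 => /eqP E.
have -> : invmx S = - p.[0]^-1 *: horner_mx S q.
  apply: (can_inj (mulmxK uS)); rewrite mulVmx // -scalemxAl.
  by rewrite [_ *m S]E scaleNr scalerN opprK scale_scalar_mx mulVf.
by rewrite -[_ *: _]addr0; apply: GL.
Qed.

Section FreeLocus.
Variables (k : fieldType) (g n : nat) (X : 'I_g -> 'M[k]_n.+1).

Lemma pencil_eval_flat d (A : 'I_g -> 'M[k]_d) :
  pencil_eval A X = flatmx (gpencil X A).
Proof.
apply/matrixP=> p q; case: (mxtens_indexP p) => i1 i2; case: (mxtens_indexP q) => j1 j2.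
rewrite [RHS]mxE !mxtens_indexK gpencilE mxE tensmxE !mxE !summxE; congr (_ - _).
  by case: (i1 == j1); rewrite ?mul1r ?mul0r mxE.
by apply: eq_bigr => l _; rewrite tensmxE mxE.
Qed.

(** Serves to transport a property to the inverse: with [G] the matrices that lift to rational
    functions, or to values at another pencil, the inverse lifts as well, being a polynomial in
    [F]. *)
Lemma flatmx_unit_closed d (F : 'M['M[k]_n.+1]_d) (G : 'M['M[k]_n.+1]_d -> Prop) :
  G 1%:M -> (forall a U V, G U -> G V -> G (a%:M *: U + V)) ->
  (forall U, G U -> G (U *m F)) -> flatmx F \in unitmx ->
  exists F', [/\ F *m F' = 1%:M, F' *m F = 1%:M & G F'].
Proof.
move=> G1 GL GF uF.
have : G (unflatmx (invmx (flatmx F))).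
  apply: (invmx_closed (G := fun M => G (unflatmx M))) uF; first by rewrite -flatmx1 flatmxK.
    move=> a U V GU GV; have -> : unflatmx (a *: U + V) = a%:M *: unflatmx U + unflatmx V.
      by apply: (can_inj (@flatmxK _ _ _)); rewrite flatmxP !unflatmxK.
    exact: GL.
  by move=> U GU; rewrite -(unflatmxK U) -flatmxM flatmxK; apply: GF.
set F' := unflatmx _ => GF'; exists F'; split=> //;
by apply: (can_inj (@flatmxK _ _ _)); rewrite flatmxM unflatmxK flatmx1 ?mulmxV ?mulVmx.
Qed.

Lemma flatmx_unitP d (F : 'M['M[k]_n.+1]_d) :
  (flatmx F \in unitmx) <-> exists F', F *m F' = 1%:M.
Proof.
split=> [|[F' E]]; last first.
  by apply: (proj1 (@mulmx1_unit _ _ _ (flatmx F') _)); rewrite -flatmxM E flatmx1.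
by move=> /(flatmx_unit_closed (G := xpredT))[] // F' [E _ _]; exists F'.
Qed.

Lemma free_locusPn d (A : 'I_g -> 'M[k]_d) :
  ~ free_locus A (existT _ n X) <-> flatmx (gpencil X A) \in unitmx.
Proof.
rewrite unitmxE unitfE -pencil_eval_flat /free_locus /=.
by split=> [/eqP|/eqP].
Qed.

(** Flattening is an injective ring map into matrices over a field, where one-sided inverses are
    two-sided. *)
Lemma mulmx1_flat d (F F' : 'M['M[k]_n.+1]_d) : F *m F' = 1%:M -> F' *m F = 1%:M.
Proof.
move=> /(congr1 (@flatmx _ _ _)); rewrite flatmxM flatmx1 => /mulmx1C E.
by apply: (can_inj (@flatmxK _ _ _)); rewrite flatmxM flatmx1.
Qed.

End FreeLocus.

(** The inverse of a block matrix: [h] stands for the inverse of the upper left block a, [S] for the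
    inverse of the Schur complement d - c h b. *)
Definition schur_block (R : nzRingType) p q (h : 'M[R]_p) (b : 'M[R]_(p, q)) c S :
    'M[R]_(p + q) :=
  block_mx (h + h *m b *m S *m c *m h) (- (h *m b *m S)) (- (S *m c *m h)) S.

Lemma schur_inverse (R : nzRingType) p q (a h : 'M[R]_p) b c (d S : 'M[R]_q) :
  a *m h = 1%:M -> h *m a = 1%:M ->
  S *m (d - c *m h *m b) = 1%:M -> (d - c *m h *m b) *m S = 1%:M ->
  schur_block h b c S *m block_mx a b c d = 1%:M /\
  block_mx a b c d *m schur_block h b c S = 1%:M.
Proof.
move=> ah ha; rewrite mulmxBr mulmxBl => /eqP; rewrite subr_eq => /eqP Sd.
move=> /eqP; rewrite subr_eq => /eqP dS.
rewrite /schur_block !mulmx_block scalar_mx_block; split; congr block_mx.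
- by rewrite mulmxDl mulNmx -!mulmxA ha mulmx1 addrK.
- by rewrite mulmxDl mulNmx -!mulmxA Sd !mulmxDr !mulmx1 !mulmxA subrr.
- by rewrite mulNmx -!mulmxA ha mulmx1 addNr.
- by rewrite mulNmx Sd addrC -!mulmxA addrK.
- by rewrite mulmxDr mulmxN !mulmxA ah mul1mx addrK.
- by rewrite mulmxN !mulmxA ah mul1mx addNr.
- by rewrite mulmxDr mulmxN ?mulmxA dS !mulmxDl !mul1mx ?mulmxA subrr.
- by rewrite mulmxN !mulmxA dS addrC addrK.
Qed.

(** * Inverting a pencil off its free locus *)

Section Elimination.
Variables (k : fieldType) (k0 : [pchar k] =i pred0) (g : nat).
Local Notation T := (ncrat k0 g).
Variables (n : nat) (X : 'I_g -> 'M[k]_n.+1).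

Lemma evmx_block p1 p2 q1 q2 (a : 'M[T]_(p1, q1)) b c (d : 'M[T]_(p2, q2)) A B C D :
  evmx X a A -> evmx X b B -> evmx X c C -> evmx X d D ->
  evmx X (block_mx a b c d) (block_mx A B C D).
Proof.
move=> Ha Hb Hc Hd i j; case: (split_ordP i) => i' ->; case: (split_ordP j) => j' ->;
by rewrite ?block_mxEul ?block_mxEur ?block_mxEdl ?block_mxEdr.
Qed.

(* Gaussian elimination: every pivot evaluates to the identity. *)
Lemma evmx1_inv d (N : 'M[T]_d) : evmx X N 1%:M ->
  exists H F, [/\ H *m N = 1%:M, N *m H = 1%:M & evmx X H F].
Proof.
elim: d N => [|d IH] N evN.
  by exists 0, 0; split; [apply/matrixP; case|apply/matrixP; case|case].
pose N' : 'M[T]_(1 + d) := N.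
have evN' : evmx X N' (block_mx 1%:M 0 0 1%:M) by rewrite -scalar_mx_block.
pose n11 := ulsubmx N'; pose n12 := ursubmx N'; pose n21 := dlsubmx N'.
pose n22 := drsubmx N'.
have e12 : evmx X n12 0 by move=> i j; have := evN' (lshift _ i) (rshift _ j); rewrite block_mxEur !mxE.
have e21 : evmx X n21 0 by move=> i j; have := evN' (rshift _ i) (lshift _ j); rewrite block_mxEdl !mxE.
have e22 : evmx X n22 1%:M by move=> i j; have := evN' (rshift _ i) (rshift _ j); rewrite block_mxEdr !mxE.
have e11 : evalsto X (n11 0 0) 1.
  by have := evN' (lshift _ 0) (lshift _ 0); rewrite block_mxEul !mxE.
have [h [nh hn eh]] := evalstoV e11 (unitr1 _).
have N11 : n11 = (n11 0 0)%:M by apply: mx11_scalar.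
have nh' : n11 *m h%:M = 1%:M by rewrite N11 -scalar_mxM nh.
have hn' : h%:M *m n11 = 1%:M by rewrite N11 -scalar_mxM hn.
have ehm : evmx X (h%:M : 'M_1) 1%:M by apply: evmx_scalar; rewrite invr1 in eh.
(* The off-diagonal blocks vanish at [X], so the Schur complement again has value 1 and the
   induction applies. *)
have : evmx X (n22 - n21 *m h%:M *m n12) 1%:M.
  have := evmxD e22 (evmxN (evmxM (evmxM e21 ehm) e12)).
  by rewrite mulmx0 subr0.
move=> /IH[S [F [SN NS eS]]].
have NE : N' = block_mx n11 n12 n21 n22 by rewrite submxK.
have [HN NH] := schur_inverse nh' hn' SN NS.
rewrite -NE in HN NH.
exists (schur_block h%:M n12 n21 S), (schur_block (1%:M : 'M_1) 0 0 F).
split=> //; rewrite /schur_block; apply: (evmx_block (p1 := 1) (q1 := 1));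
by repeat first [assumption | apply: evmxD | apply: evmxN | apply: evmxM].
Qed.

Lemma evmx_gsum p q (A : 'I_g -> 'M[k]_(p, q)) :
  evmx X (gsum (@ncvar k k0 g) A) (gsum X A).
Proof.
move=> i j; rewrite !gsumE; apply: evalsto_sum => l _.
exact/evalstoZ/evalsto_var.
Qed.

Lemma evmx1 d : evmx X (1%:M : 'M[T]_d) 1%:M.
Proof. exact/evmx_scalar/evalsto1. Qed.

Lemma evmx_pencil d (A : 'I_g -> 'M[k]_d) : evmx X (pencil_mx k0 A) (gpencil X A).
Proof. exact/evmxD/evmxN/evmx_gsum/evmx1. Qed.

(** [E] is a matrix of rational functions whose value at [X] is the inverse of L_A(X). Both products
    of [E] with the pencil have value 1, so [evmx1_inv] inverts them. *)
Lemma pencil_inverse_at d (A : 'I_g -> 'M[k]_d) :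
  ~ free_locus A (existT _ n X) ->
  exists M F, [/\ M *m pencil_mx k0 A = 1%:M, pencil_mx k0 A *m M = 1%:M & evmx X M F].
Proof.
move=> /free_locusPn; pose G F := exists E : 'M[T]_d, evmx X E F.
have ev := evmx_pencil A.
move=> /(flatmx_unit_closed (G := G)) []; first by exists 1%:M; apply: evmx1.
- move=> a U V [EU HU] [EV HV]; exists (map_mx (GRing.scale a) EU + EV) => i j.
  rewrite mxE [X in evalsto _ _ X]mxE; apply: evalstoD => //.
  rewrite !mxE -[_ * _]/(_ *m _) mul_scalar_mx; exact: evalstoZ.
- by move=> U [EU HU]; exists (EU *m pencil_mx k0 A); apply: evmxM.
move=> F' [LF FL [E HE]].
have /evmx1_inv[H [F1 [HN _ eH]]] : evmx X (E *m pencil_mx k0 A) 1%:M.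
  by rewrite -FL; apply: evmxM.
have /evmx1_inv[H' [_ [_ NH _]]] : evmx X (pencil_mx k0 A *m E) 1%:M.
  by rewrite -LF; apply: evmxM.
exists (H *m E), (F1 *m F'); split; [by rewrite -mulmxA| |exact: evmxM].
(* The left inverse and the right inverse coincide. *)
suff -> : H *m E = E *m H' by rewrite mulmxA.
rewrite -[E in RHS]mul1mx -HN -[in RHS]mulmxA -[in RHS](mulmxA H).
by rewrite -(mulmxA E) [_ *m (E *m H')]mulmxA NH mulmx1.
Qed.

End Elimination.

(** * Triangular points and noncommutative derivatives *)

Section Triangular.
Variables (k : fieldType) (m n : nat).

(** The size is a successor so that these matrices form a unit ring; it is convertible to
    [m.+1 + n.+1], the size of the block matrix. *)
Definition btri (Y : 'M[k]_m.+1) (W : 'M[k]_(m.+1, n.+1)) (Z : 'M[k]_n.+1) :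
  'M[k]_((m + n.+1).+1) := block_mx Y W 0 Z.

Lemma btri_inj Y W Z Y' W' Z' : btri Y W Z = btri Y' W' Z' ->
  [/\ Y = Y', W = W' & Z = Z'].
Proof. by move=> /(@eq_block_mx _ m.+1 n.+1 m.+1 n.+1)[]. Qed.

Lemma btriD Y W Z Y' W' Z' :
  btri Y W Z + btri Y' W' Z' = btri (Y + Y') (W + W') (Z + Z').
Proof.
by apply: etrans (@add_block_mx _ m.+1 n.+1 m.+1 n.+1 _ _ _ _ _ _ _ _) _; rewrite addr0.
Qed.

Lemma btriZ a Y W Z : a *: btri Y W Z = btri (a *: Y) (a *: W) (a *: Z).
Proof.
by apply: etrans (@scale_block_mx _ m.+1 n.+1 m.+1 n.+1 _ _ _ _ _) _; rewrite scaler0.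
Qed.

Lemma btriM Y W Z Y' W' Z' :
  btri Y W Z * btri Y' W' Z' = btri (Y * Y') (Y *m W' + W *m Z') (Z * Z').
Proof.
apply: etrans (@mulmx_block _ m.+1 n.+1 m.+1 n.+1 m.+1 n.+1 _ _ _ _ _ _ _ _) _.
by rewrite !mulmx0 !mul0mx !addr0 add0r.
Qed.

Lemma btri_scalar a : (a%:A : 'M[k]_((m + n.+1).+1)) = btri a%:A 0 a%:A.
Proof.
have E p : (a%:A : 'M[k]_p.+1) = a%:M by rewrite -[1]/(1%:M) scale_scalar_mx mulr1.
by rewrite !E; apply: etrans (@scalar_mx_block _ m.+1 n.+1 a) _.
Qed.

Lemma btri1 : btri 1 0 1 = 1.
Proof. by have := btri_scalar 1; rewrite !scale1r. Qed.

Lemma btri0 : btri 0 0 0 = 0.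
Proof. by have := btri_scalar 0; rewrite !scale0r. Qed.

Lemma btri_sum I (r : seq I) (P : pred I) F G H :
  \sum_(i <- r | P i) btri (F i) (G i) (H i) =
  btri (\sum_(i <- r | P i) F i) (\sum_(i <- r | P i) G i) (\sum_(i <- r | P i) H i).
Proof.
elim: r => [|i r IH]; first by rewrite !big_nil btri0.
by rewrite !big_cons; case: (P i); rewrite IH ?btriD.
Qed.

Lemma btriV Y W Z : Y \is a GRing.unit -> Z \is a GRing.unit ->
  btri Y W Z \is a GRing.unit /\
  (btri Y W Z)^-1 = btri Y^-1 (- (Y^-1 *m W *m Z^-1)) Z^-1.
Proof.
move=> uY uZ; have E : btri Y W Z * btri Y^-1 (- (Y^-1 *m W *m Z^-1)) Z^-1 = 1.
  by rewrite btriM !divrr // mulmxN !mulmxA [Y *m _]divrr // mul1mx addNr btri1.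
have u : btri Y W Z \is a GRing.unit by have [] := mulmx1_unit E.
by split=> //; apply: (mulrI u); rewrite divrr.
Qed.

End Triangular.

(* On block triangular points the corner entry is the noncommutative derivative:
   a list of triples (i, p, q) standing for sum p(Y) W_i q(Z). *)
Lemma nceval_btri (k : fieldType) (g : nat) (e : ncexpr k g) :
  exists D : seq ('I_g * (ncexpr k g * ncexpr k g)),
  (forall n (Y : 'I_g -> 'M[k]_n.+1), ncdef Y e ->
     all (fun t => ncdef Y t.2.1 && ncdef Y t.2.2) D) /\
  (forall m n (Y : 'I_g -> 'M[k]_m.+1) (W : 'I_g -> 'M[k]_(m.+1, n.+1))
     (Z : 'I_g -> 'M[k]_n.+1), ncdef Y e -> ncdef Z e ->
     ncdef (fun i => btri (Y i) (W i) (Z i)) e /\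
     nceval (fun i => btri (Y i) (W i) (Z i)) e =
     btri (nceval Y e)
       (\sum_(t <- D) nceval Y t.2.1 *m W t.1 *m nceval Z t.2.2) (nceval Z e)).
Proof.
elim: e => [c|i|e1 [D1 [d1 E1]] e2 [D2 [d2 E2]]|e1 [D1 [d1 E1]] e2 [D2 [d2 E2]]|e [D [d E]]].
- exists [::]; split=> // m n Y W Z _ _; split=> //=.
  by rewrite big_nil btri_scalar.
- exists [:: (i, (NcConst 1, NcConst 1))]; split=> // m n Y W Z _ _; split=> //=.
  by rewrite big_seq1 /= !scale1r mul1mx mulmx1.
- exists (D1 ++ D2); split=> [n Y /= /andP[Y1 Y2]|m n Y W Z /= /andP[Y1 Y2] /andP[Z1 Z2]].
    by rewrite all_cat d1 // d2.
  have [-> ->] := E1 _ _ _ W _ Y1 Z1; have [-> ->] := E2 _ _ _ W _ Y2 Z2.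
  by rewrite btriD big_cat.
(* Leibniz rule: [e1] stays on the left of the derivative of [e2], and [e2] on the right of that of
   [e1]. *)
- exists ([seq (t.1, (NcMul e1 t.2.1, t.2.2)) | t <- D2] ++
          [seq (t.1, (t.2.1, NcMul t.2.2 e2)) | t <- D1]).
  split=> [n Y /= /andP[Y1 Y2]|m n Y W Z /= /andP[Y1 Y2] /andP[Z1 Z2]].
    rewrite all_cat !all_map; apply/andP; split.
      by apply: sub_all (d2 _ _ Y2) => t /=; rewrite Y1.
    by apply: sub_all (d1 _ _ Y1) => t /= /andP[-> ->].
  have [-> ->] := E1 _ _ _ W _ Y1 Z1; have [-> ->] := E2 _ _ _ W _ Y2 Z2.
  split=> //; rewrite btriM big_cat !big_map mulmx_sumr mulmx_suml /=.
  congr (btri _ (_ + _) _); apply: eq_bigr => t _; by rewrite !mulmxA.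
(* The derivative of an inverse is - e^-1 (de) e^-1. *)
- exists [seq (t.1, (NcMul (NcMul (NcConst (-1)) (NcInv e)) t.2.1,
                     NcMul t.2.2 (NcInv e))) | t <- D].
  split=> [n Y /= /andP[Y1 Y2]|m n Y W Z /= /andP[Y1 uY] /andP[Z1 uZ]].
    by rewrite all_map; apply: sub_all (d _ _ Y1) => t /= /andP[-> ->]; rewrite Y1 Y2.
  have [-> ->] := E _ _ _ W _ Y1 Z1; have [-> ->] := btriV
    (\sum_(t <- D) nceval Y t.2.1 *m W t.1 *m nceval Z t.2.2) uY uZ.
  split=> //; congr btri; rewrite big_map mulmx_sumr mulmx_suml -sumrN.
  have mE p (A B : 'M[k]_p.+1) : A * B = A *m B by [].
  by apply: eq_bigr => t _ /=; rewrite scaleN1r mulN1r !mE !mulNmx !mulmxA.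
Qed.

(** * Domains of minimal realizations *)

(** [B] has the largest rank among the matrices with row space inside [G]: a vector of [G] outside
    its row space could be adjoined to raise the rank. *)
Lemma subspace_mx (k : fieldType) d (G : 'rV[k]_d -> Prop) :
  G 0 -> (forall a u v, G u -> G v -> G (a *: u + v)) ->
  exists B : 'M[k]_d, forall v, G v <-> (v <= B)%MS.
Proof.
move=> G0 GL.
pose P r := `[< exists B : 'M[k]_d, (forall v : 'rV_d, (v <= B)%MS -> G v) /\ \rank B = r >].
have P0 : exists r, P r.
  exists 0; apply/asboolP; exists 0; split=> [v|]; last exact: mxrank0.
  by rewrite submx0 => /eqP ->.
have Pm r : P r -> (r <= d)%N by move=> /asboolP[B [_ <-]]; apply: rank_leq_row.
case: (ex_maxnP P0 Pm) => r /asboolP[B [GB rB]] rmax; exists B => v; split=> [Gv|/GB//].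
apply: contraT => nvB.
have /rank_ltmx : (B < B + v)%MS.
  rewrite /ltmx addsmxSl addsmx_sub submx_refl /=; exact: nvB.
rewrite rB ltnNge rmax //; apply/asboolP; exists (B + v)%MS; split=> // w.
move=> /sub_addsmxP[[a b] /= ->]; rewrite addrC (mx11_scalar b) mul_scalar_mx.
by apply: GL => //; apply/GB/submxMl.
Qed.

Lemma subspace_full (k : fieldType) d (G : 'cV[k]_d -> Prop) :
  G 0 -> (forall a u v, G u -> G v -> G (a *: u + v)) ->
  (forall psi : 'rV[k]_d, (forall v, G v -> psi *m v = 0) -> psi = 0) ->
  forall v, G v.
Proof.
move=> G0 GL H v.
have [||B HB] := @subspace_mx k d (fun u => G u^T); first by rewrite trmx0.
  by move=> a u w Gu Gw; rewrite linearP; apply: GL.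
suff B0 : cokermx B = 0 by rewrite -[v]trmxK; apply/HB; rewrite submxE B0 mulmx0.
apply: trmx_inj; rewrite trmx0; apply/row_matrixP=> i; rewrite row0; apply: H => w.
rewrite -[w in G w]trmxK => /HB; rewrite submxE => /eqP E.
by rewrite -row_mul -[w]trmxK -trmx_mul E trmx0 row0.
Qed.

Section MinimalRealization.
Variables (k : fieldType) (k0 : [pchar k] =i pred0) (g : nat).
Local Notation T := (ncrat k0 g).
Local Notation cst := (map_mx (in_alg T)).

(* The value 0 is junk: it is returned when e has empty domain. *)
Definition ncrat_of (e : ncexpr k g) : T :=
  if pselect (exprdom e !=set0) is left H then \pi_T (nd_mk H) else 0.

Lemma evalsto_of n (X : 'I_g -> 'M[k]_n.+1) e : ncdef X e ->
  evalsto X (ncrat_of e) (nceval X e).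
Proof.
move=> d; rewrite /ncrat_of; case: pselect => [H|[]]; last by exists (existT _ n X).
exact: (evalsto_expr (e := nd_mk H)).
Qed.

(** A sum of representatives is defined exactly where all its terms are; [e0] serves to describe a
    common domain. *)
Lemma common_domain_of p q (e : ndexpr k g) (E : 'I_p -> 'I_q -> ndexpr k g) :
  exists e0 : ndexpr k g, forall n (X : 'I_g -> 'M[k]_n.+1), ncdef X (val e0) <->
    ncdef X (val e) /\ forall i j, ncdef X (val (E i j)).
Proof.
pose s := [seq E ij.1 ij.2 | ij <- enum {: 'I_p * 'I_q}].
exists (foldr (@nd_add k k0 g) e s) => n X.
have -> : ncdef X (val (foldr (@nd_add k k0 g) e s)) =
          all (fun h => ncdef X (val h)) s && ncdef X (val e).
  by elim: s => //= h s ->; rewrite andbA.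
split=> [/andP[ds de]|[-> ds]]; last by rewrite andbT all_map; apply/allP=> ij _; apply: ds.
split=> // i j; move: ds; rewrite all_map => /allP/(_ (i, j)); rewrite mem_enum; exact.
Qed.

Lemma common_domain p q (e : ndexpr k g) (M : 'M[T]_(p, q)) :
  exists e0 : ndexpr k g, forall n (X : 'I_g -> 'M[k]_n.+1), ncdef X (val e0) ->
    ncdef X (val e) /\ exists F, evmx X M F.
Proof.
have [e0 He0] := common_domain_of e (fun i j => repr (M i j)).
exists e0 => n X /He0[de dM]; split=> //; apply: evmx_choice => i j.
exists (nceval X (val (repr (M i j)))); apply: evalsto_expr => //; exact: reprK.
Qed.

(** This inverts a block triangular matrix. The corner is the derivative of the resolvent: the
    inverse at [Y], times sum A_l (x) W_l, times the inverse at [Z]. *)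
Lemma gpencil_btri d (A : 'I_g -> 'M[k]_d) m n (Y : 'I_g -> 'M[k]_m.+1)
    (W : 'I_g -> 'M[k]_(m.+1, n.+1)) (Z : 'I_g -> 'M[k]_n.+1) FY FZ FP :
  FY *m gpencil Y A = 1%:M -> gpencil Z A *m FZ = 1%:M ->
  FP *m gpencil (fun i => btri (Y i) (W i) (Z i)) A = 1%:M ->
  forall i j, FP i j = btri (FY i j)
    (\sum_a \sum_b FY i a *m (\sum_l A l a b *: W l) *m FZ b j) (FZ i j).
Proof.
move=> HY HZ HP; set P := fun i => _ in HP.
pose K a b := \sum_l A l a b *: W l.
pose Q i j := \sum_a \sum_b FY i a *m K a b *m FZ b j.
pose N := \matrix_(i, j) btri (FY i j) (Q i j) (FZ i j).
suff HN : gpencil P A *m N = 1%:M.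
  by move=> i j; rewrite -[FP]mulmx1 -HN mulmxA HP mul1mx mxE.
have LP i j : gpencil P A i j = btri (gpencil Y A i j) (- K i j) (gpencil Z A i j).
  rewrite !gpencilE (eq_bigr (fun l => btri (A l i j *: Y l) (A l i j *: W l)
    (A l i j *: Z l))); last by move=> l _; rewrite btriZ.
  rewrite btri_sum -scaleN1r btriZ !scaleN1r.
  have -> : (i == j)%:R = btri (i == j)%:R 0 (i == j)%:R :> 'M[k]_((m + n.+1).+1).
    by case: (i == j); rewrite ?btri1 ?btri0.
  by rewrite btriD add0r.
apply/matrixP=> i j; rewrite mxE.
rewrite (eq_bigr (fun l => btri (gpencil Y A i l * FY l j)
  (gpencil Y A i l *m Q l j - K i l *m FZ l j) (gpencil Z A i l * FZ l j))); last first.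
  by move=> l _; rewrite LP [N _ _]mxE btriM mulNmx.
have sumE p (U V : 'M['M[k]_p.+1]_d) a b : \sum_l U a l * V l b = (U *m V) a b.
  by rewrite mxE.
rewrite btri_sum !sumE HZ (mulmx1_flat HY) sumrB.
have -> : \sum_l gpencil Y A i l *m Q l j = \sum_l K i l *m FZ l j.
  transitivity (\sum_a \sum_b (\sum_l gpencil Y A i l * FY l a) *m (K a b *m FZ b j)).
    under eq_bigr do rewrite mulmx_sumr.
    rewrite exchange_big; apply: eq_bigr => a _ /=.
    under eq_bigr do rewrite mulmx_sumr.
    rewrite exchange_big; apply: eq_bigr => b _ /=.
    by rewrite mulmx_suml; apply: eq_bigr => l _; rewrite !mulmxA.
  rewrite (bigD1 i) //= [X in _ + X]big1 ?addr0; last first.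
    by move=> a /negPf ai; apply: big1 => b _; rewrite sumE (mulmx1_flat HY) mxE
      eq_sym ai mul0mx.
  by apply: eq_bigr => b _; rewrite sumE (mulmx1_flat HY) mxE eqxx mul1mx.
by rewrite subrr !mxE; case: (i == j); rewrite ?btri1 ?btri0.
Qed.

Lemma inverse_at d (A : 'I_g -> 'M[k]_d) M n (X : 'I_g -> 'M[k]_n.+1) F :
  M *m pencil_mx k0 A = 1%:M -> pencil_mx k0 A *m M = 1%:M -> evmx X M F ->
  F *m gpencil X A = 1%:M /\ gpencil X A *m F = 1%:M.
Proof.
move=> ML LM eM; have e1 := evmx1 k0 X (d := d); have eL := evmx_pencil k0 X A.
split; apply/esym; apply: (evmx_inj e1); first by rewrite -ML; apply: evmxM.
by rewrite -LM; apply: evmxM.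
Qed.

Lemma bilin_entry (R : algType k) p q (c : 'rV[k]_p) (b : 'cV[k]_q) (M : 'M[R]_(p, q)) :
  (map_mx (in_alg R) c *m M *m map_mx (in_alg R) b) 0 0 =
  \sum_i \sum_j (c 0 i * b j 0) *: M i j.
Proof.
rewrite mul_map_in_algE exchange_big; apply: eq_bigr => j _ /=.
rewrite map_in_alg_mulE scaler_sumr; apply: eq_bigr => i _.
by rewrite scalerA mulrC.
Qed.

Lemma mulmx_delta_entry m1 m2 m3 m4 (U : 'M[k]_(m1, m2)) (V : 'M[k]_(m3, m4)) i j a b :
  (U *m delta_mx a b *m V) i j = U i a * V b j.
Proof.
rewrite mxE (bigD1 b) //= big1 ?addr0 => [|l /negPf lb].
  rewrite mxE (bigD1 a) //= big1 ?addr0 => [|l /negPf la].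
    by rewrite mxE !eqxx mulr1.
  by rewrite mxE la mulr0.
rewrite mxE big1 ?mul0r // => l' _; by rewrite mxE lb andbF mulr0.
Qed.

(** The function has two formulas at triangular points, from the derivative of [e] and from that of
    the inverse pencil; their corner entries agree. The domain of [e0] contains the triangular
    points built from its own points, so [M] has a value there. *)
Lemma derivative_at d (A : 'I_g -> 'M[k]_d) M (c : 'rV[k]_d) (b : 'cV[k]_d)
    (e : ndexpr k g) :
  M *m pencil_mx k0 A = 1%:M -> pencil_mx k0 A *m M = 1%:M ->
  \pi_T e = (cst c *m M *m cst b) 0 0 ->
  exists (e0 : ndexpr k g) (D : seq ('I_g * (ncexpr k g * ncexpr k g))), [/\
    forall n (Y : 'I_g -> 'M[k]_n.+1), ncdef Y (val e) ->
      all (fun t => ncdef Y t.2.1 && ncdef Y t.2.2) D,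
    forall n (Y : 'I_g -> 'M[k]_n.+1), ncdef Y (val e0) ->
      ncdef Y (val e) /\ exists F, evmx Y M F &
    forall i m n (Y : 'I_g -> 'M[k]_m.+1) (Z : 'I_g -> 'M[k]_n.+1) FY FZ,
      ncdef Y (val e0) -> ncdef Z (val e0) -> evmx Y M FY -> evmx Z M FZ ->
      forall r s r' s',
      \sum_(t <- D | t.1 == i) nceval Y t.2.1 r s * nceval Z t.2.2 r' s' =
      \sum_u \sum_v A i u v * (map_mx (in_alg _) c *m FY) 0 u r s *
                    (FZ *m map_mx (in_alg _) b) v 0 r' s'].
Proof.
move=> ML LM fE; have [D [dD ED]] := nceval_btri (val e).
have [e0 He0] := common_domain e M; exists e0, D; split=> //.
move=> i m n Y Z FY FZ Y0 Z0 eY eZ r s r' s'.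
have [Ye _] := He0 _ _ Y0; have [Ze _] := He0 _ _ Z0.
(* One matrix unit in coordinate [i] isolates a single entry of each of the two outer factors. *)
pose W l : 'M[k]_(m.+1, n.+1) := if l == i then delta_mx s r' else 0.
have [D0 [_ E0]] := nceval_btri (val e0).
have [P0 _] := E0 _ _ _ W _ Y0 Z0; set P := fun l => btri _ _ _ in P0.
have [_ [FP eP]] := He0 _ _ P0.
have [HY _] := inverse_at ML LM eY; have [_ HZ] := inverse_at ML LM eZ.
have [HP _] := inverse_at ML LM eP.
have FPE := gpencil_btri HY HZ HP.
have [Pe EP] := ED _ _ _ W _ Ye Ze.
have := evalsto_expr fE Pe; rewrite EP => /evalsto_inj.
move/(_ _ (evmxM (evmxM (evmx_const k0 P c) eP) (evmx_const k0 P b) 0 0)).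
rewrite bilin_entry.
pose Q u v := \sum_a \sum_b' FY u a *m (\sum_l A l a b' *: W l) *m FZ b' v.
have -> : \sum_u \sum_v (c 0 u * b v 0) *: FP u v =
  btri (\sum_u \sum_v (c 0 u * b v 0) *: FY u v)
       (\sum_u \sum_v (c 0 u * b v 0) *: Q u v)
       (\sum_u \sum_v (c 0 u * b v 0) *: FZ u v).
  rewrite -btri_sum; apply: eq_bigr => u _.
  by rewrite -btri_sum; apply: eq_bigr => v _; rewrite FPE btriZ.
move=> /btri_inj[_ /matrixP/(_ r s') + _].
rewrite summxE (bigID (fun t => t.1 == i)) /= [X in _ + X]big1 ?addr0; last first.
  by move=> t /negPf ti; rewrite /W ti mulmx0 mul0mx mxE.
rewrite (eq_bigr (fun t => nceval Y t.2.1 r s * nceval Z t.2.2 r' s')); last first.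
  by move=> t ti; rewrite /W ti mulmx_delta_entry.
move=> ->; rewrite summxE.
transitivity (\sum_p \sum_q \sum_u \sum_v
  A i u v * (c 0 p * FY p u r s) * (b q 0 * FZ v q r' s')).
  apply: eq_bigr => p _; rewrite summxE; apply: eq_bigr => q _.
  rewrite mxE summxE mulr_sumr; apply: eq_bigr => u _.
  rewrite summxE mulr_sumr; apply: eq_bigr => v _.
  rewrite (bigD1 i) //= big1 ?addr0; last by move=> l /negPf li; rewrite /W li scaler0.
  by rewrite /W eqxx -scalemxAr -scalemxAl mxE mulmx_delta_entry; ring.
rewrite (eq_bigr _ (fun p _ => exchange_big _ _ _ _ _ _)) exchange_big.
apply: eq_bigr => u _ /=.
rewrite (eq_bigr _ (fun p _ => exchange_big _ _ _ _ _ _)) exchange_big.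
apply: eq_bigr => v _ /=.
rewrite map_in_alg_mulE mul_map_in_algE !summxE [X in _ = X * _]mulr_sumr mulr_suml.
apply: eq_bigr => p _; rewrite mulr_sumr; apply: eq_bigr => q _.
by rewrite !mxE.
Qed.

Lemma entry_evalsto p q (c : 'rV[k]_p) (M : 'M[T]_(p, q)) (b : 'cV[k]_q) n
    (X : 'I_g -> 'M[k]_n.+1) F : evmx X M F ->
  evalsto X ((cst c *m M *m cst b) 0 0)
    ((map_mx (in_alg _) c *m F *m map_mx (in_alg _) b) 0 0).
Proof. by move=> eM; apply: (evmxM (evmxM (evmx_const k0 X c) eM) (evmx_const k0 X b)). Qed.

(** The admissible [v] form a subspace containing all slices (L_A^-1 b)(Z)_(r,s). A functional [psi]
    killing these makes psi L_A^-1 b vanish on the domain of [e0], so the last hypothesis gives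
    [psi = 0]. *)
Lemma defined_left d (A : 'I_g -> 'M[k]_d) M (c : 'rV[k]_d) (b : 'cV[k]_d) f n
    (X : 'I_g -> 'M[k]_n.+1) V0 :
  M *m pencil_mx k0 A = 1%:M -> pencil_mx k0 A *m M = 1%:M ->
  f = (cst c *m M *m cst b) 0 0 -> evalsto X f V0 ->
  (forall psi : 'rV[k]_d, (cst psi *m M *m cst b) 0 0 = 0 -> psi = 0) ->
  forall i (v : 'cV[k]_d), exists V, evalsto X ((cst c *m M *m cst (A i *m v)) 0 0) V.
Proof.
move=> ML LM fE [e [eE Xe _]] Cb i.
have [|e0 [D [dD He0 core]]] := derivative_at (c := c) (b := b) (e := e) ML LM.
  by rewrite eE.
apply: subspace_full => [|a u v [U HU] [V HV]|psi Hpsi].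
- by exists 0; rewrite mulmx0 map_mx0 mulmx0 mxE; apply: evalsto0.
- exists (a *: U + V).
  have -> : (cst c *m M *m cst (A i *m (a *: u + v))) 0 0 =
    a *: (cst c *m M *m cst (A i *m u)) 0 0 + (cst c *m M *m cst (A i *m v)) 0 0.
    rewrite !mul_map_in_algE scaler_sumr -big_split; apply: eq_bigr => l _ /=.
    by rewrite mulmxDr -scalemxAr mxE [X in (X + _) *: _]mxE scalerDl scalerA.
  exact/evalstoD/HV/evalstoZ.
- apply: Cb; apply: (ncrat_ext (e0 := e0)) => m Z U V Z0 HU HV.
  have [Ze [FZ eZ]] := He0 _ _ Z0.
  rewrite -(evalsto_inj (evalsto0 k0 Z) HV) {V HV}.
  rewrite (evalsto_inj HU (entry_evalsto psi b eZ)).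
  apply/matrixP=> r s; pose v := \col_l (FZ *m map_mx (in_alg _) b) l 0 r s.
  transitivity ((psi *m v) 0 0); last first.
    rewrite Hpsi; first by rewrite !mxE.
    (* For fixed [Z], [r], [s] the derivative is a linear combination of its left factors, which are
       defined at [X] because [e] is. *)
    exists (\sum_(t <- D | t.1 == i) (nceval Z t.2.2 r s) *: nceval X t.2.1).
    have -> : (cst c *m M *m cst (A i *m v)) 0 0 =
      \sum_(t <- D | t.1 == i) (nceval Z t.2.2 r s) *: ncrat_of t.2.1.
      apply: (ncrat_ext (e0 := e0)) => p Y U' V Y0 HU' HV.
      have [Ye [FY eY]] := He0 _ _ Y0.
      rewrite (evalsto_inj HU' (entry_evalsto c _ eY)).
      have dY := dD _ _ Ye.
      have : evalsto Y (\sum_(t <- D | t.1 == i) nceval Z t.2.2 r s *: ncrat_of t.2.1)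
        (\sum_(t <- D | t.1 == i) nceval Z t.2.2 r s *: nceval Y t.2.1).
        rewrite big_seq_cond [X in evalsto _ _ X]big_seq_cond; apply: evalsto_sum => t.
        by move=> /andP[/(allP dY)/andP[d1 _] _]; apply/evalstoZ/evalsto_of.
      move=> /(evalsto_inj HV) ->; apply/matrixP => r' s'.
      rewrite [RHS]summxE (eq_bigr (fun t => nceval Y t.2.1 r' s' * nceval Z t.2.2 r s)).
        rewrite (core i _ _ _ _ _ _ Y0 Z0 eY eZ) mul_map_in_algE summxE.
        apply: eq_bigr => l _; rewrite mxE mxE mulr_suml; apply: eq_bigr => l' _.
        rewrite [v l' 0]mxE; ring.
      by move=> t _; rewrite mxE mulrC.
    rewrite big_seq_cond [X in evalsto _ _ X]big_seq_cond; apply: evalsto_sum => t.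
    by move=> /andP[/(allP (dD _ _ Xe))/andP[d1 _] _]; apply/evalstoZ/evalsto_of.
  rewrite -mulmxA map_in_alg_mulE summxE mxE; apply: eq_bigr => l _.
  by rewrite !mxE.
Qed.

(** The mirror image of [defined_left]: fixing [Y] leaves the right factors of the derivative. Rows
    enter transposed because [subspace_full] speaks of columns. *)
Lemma defined_right d (A : 'I_g -> 'M[k]_d) M (c : 'rV[k]_d) (b : 'cV[k]_d) f n
    (X : 'I_g -> 'M[k]_n.+1) V0 :
  M *m pencil_mx k0 A = 1%:M -> pencil_mx k0 A *m M = 1%:M ->
  f = (cst c *m M *m cst b) 0 0 -> evalsto X f V0 ->
  (forall v : 'cV[k]_d, (cst c *m M *m cst v) 0 0 = 0 -> v = 0) ->
  forall i (u : 'rV[k]_d), exists V, evalsto X ((cst (u *m A i) *m M *m cst b) 0 0) V.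
Proof.
move=> ML LM fE [e [eE Xe _]] Oc i u; rewrite -[u]trmxK.
have [|e0 [D [dD He0 core]]] := derivative_at (c := c) (b := b) (e := e) ML LM.
  by rewrite eE.
move: {u}(u^T).
apply: subspace_full => [|a u v [U HU] [V HV]|psi Hpsi].
- by exists 0; rewrite trmx0 mul0mx map_mx0 !mul0mx mxE; apply: evalsto0.
- exists (a *: U + V).
  have -> : (cst ((a *: u + v)^T *m A i) *m M *m cst b) 0 0 =
    a *: (cst (u^T *m A i) *m M *m cst b) 0 0 + (cst (v^T *m A i) *m M *m cst b) 0 0.
    rewrite -!mulmxA !map_in_alg_mulE scaler_sumr -big_split; apply: eq_bigr => l _ /=.
    by rewrite linearP mulmxDl -scalemxAl mxE [X in (X + _) *: _]mxE scalerDl scalerA.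
  exact/evalstoD/HV/evalstoZ.
- apply: trmx_inj; rewrite trmx0.
  apply: Oc; apply: (ncrat_ext (e0 := e0)) => m Y U V Y0 HU HV.
  have [Ye [FY eY]] := He0 _ _ Y0.
  rewrite -(evalsto_inj (evalsto0 k0 Y) HV) {V HV}.
  rewrite (evalsto_inj HU (entry_evalsto c psi^T eY)).
  apply/matrixP=> r s; pose v := \col_l (map_mx (in_alg _) c *m FY) 0 l r s.
  transitivity ((psi *m v) 0 0); last first.
    rewrite Hpsi; first by rewrite !mxE.
    exists (\sum_(t <- D | t.1 == i) (nceval Y t.2.1 r s) *: nceval X t.2.2).
    have -> : (cst (v^T *m A i) *m M *m cst b) 0 0 =
      \sum_(t <- D | t.1 == i) (nceval Y t.2.1 r s) *: ncrat_of t.2.2.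
      apply: (ncrat_ext (e0 := e0)) => p Z U' V Z0 HU' HV.
      have [Ze [FZ eZ]] := He0 _ _ Z0.
      rewrite (evalsto_inj HU' (entry_evalsto _ b eZ)).
      have dZ := dD _ _ Ze.
      have : evalsto Z (\sum_(t <- D | t.1 == i) nceval Y t.2.1 r s *: ncrat_of t.2.2)
        (\sum_(t <- D | t.1 == i) nceval Y t.2.1 r s *: nceval Z t.2.2).
        rewrite big_seq_cond [X in evalsto _ _ X]big_seq_cond; apply: evalsto_sum => t.
        by move=> /andP[/(allP dZ)/andP[_ d2] _]; apply/evalstoZ/evalsto_of.
      move=> /(evalsto_inj HV) ->; apply/matrixP => r' s'.
      rewrite [RHS]summxE (eq_bigr (fun t => nceval Y t.2.1 r s * nceval Z t.2.2 r' s')).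
        rewrite (core i _ _ _ _ _ _ Y0 Z0 eY eZ) -mulmxA map_in_alg_mulE summxE exchange_big.
        apply: eq_bigr => l _; rewrite mxE mxE mulr_suml; apply: eq_bigr => l' _.
        rewrite [v^T _ _]mxE [v l' 0]mxE; ring.
      by move=> t _; rewrite mxE.
    rewrite big_seq_cond [X in evalsto _ _ X]big_seq_cond; apply: evalsto_sum => t.
    by move=> /andP[/(allP (dD _ _ Xe))/andP[_ d2] _]; apply/evalstoZ/evalsto_of.
  rewrite mul_map_in_algE summxE mxE; apply: eq_bigr => l _.
  by rewrite !mxE.
Qed.

Lemma inverse_expand (R : algType k) (x : 'I_g -> R) d (A : 'I_g -> 'M[k]_d) M :
  M *m gpencil x A = 1%:M -> gpencil x A *m M = 1%:M ->
  M = 1%:M + M *m gsum x A /\ M = 1%:M + gsum x A *m M.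
Proof.
rewrite mulmxBr mulmxBl mulmx1 mul1mx => /eqP E1 /eqP E2.
by split; apply/eqP; rewrite -subr_eq.
Qed.

Lemma mul_gsumE (R : algType k) (x : 'I_g -> R) p q r (A : 'I_g -> 'M[k]_(q, r))
    (M : 'M[R]_(p, q)) i j :
  (M *m gsum x A) i j = \sum_l (M *m map_mx (in_alg R) (A l)) i j * x l.
Proof.
rewrite mxE; under eq_bigr do rewrite gsumE mulr_sumr.
rewrite exchange_big; apply: eq_bigr => l _ /=; rewrite mul_map_in_algE mulr_suml.
by apply: eq_bigr => m _; rewrite -scalerAr -scalerAl.
Qed.

Lemma gsum_mulE (R : algType k) (x : 'I_g -> R) p q r (A : 'I_g -> 'M[k]_(p, q))
    (M : 'M[R]_(q, r)) i j :
  (gsum x A *m M) i j = \sum_l x l * (map_mx (in_alg R) (A l) *m M) i j.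
Proof.
rewrite mxE; under eq_bigr do rewrite gsumE mulr_suml.
rewrite exchange_big; apply: eq_bigr => l _ /=; rewrite map_in_alg_mulE mulr_sumr.
by apply: eq_bigr => m _; rewrite -scalerAr -scalerAl.
Qed.

Lemma entry_delta p q (M : 'M[T]_(p, q)) i j :
  (cst (delta_mx 0 i : 'rV_p) *m M *m cst (delta_mx j 0 : 'cV_q)) 0 0 = M i j.
Proof.
rewrite bilin_entry (bigD1 i) //= [X in _ + X]big1 ?addr0 => [|i' /negPf ii].
  rewrite (bigD1 j) //= [X in _ + X]big1 ?addr0 => [|j' /negPf jj].
    by rewrite !mxE !eqxx mulr1 scale1r.
  by rewrite !mxE jj mulr0 scale0r.
by apply: big1 => j' _; rewrite !mxE ii mul0r scale0r.
Qed.

(** Observability in the sense of systems theory: the output row [c] detects every nonzero state.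
    [controllable] is the dual condition on [b]. *)
Definition observable d (M : 'M[T]_d) (c : 'rV[k]_d) : Prop :=
  forall v : 'cV[k]_d, (cst c *m M *m cst v) 0 0 = 0 -> v = 0.

Definition controllable d (M : 'M[T]_d) (b : 'cV[k]_d) : Prop :=
  forall u : 'rV[k]_d, (cst u *m M *m cst b) 0 0 = 0 -> u = 0.

(** Off the free locus [M] itself has a value. Conversely, the identities M = 1 + M N and M = 1 + N
    M, with N = sum A_i x_i, reduce first the entries of c M and then those of M to functions
    covered by [defined_left] and [defined_right]. *)
Lemma ncrat_dom_realization d (A : 'I_g -> 'M[k]_d) M c b :
  M *m pencil_mx k0 A = 1%:M -> pencil_mx k0 A *m M = 1%:M ->
  observable M c -> controllable M b ->
  ncrat_dom ((cst c *m M *m cst b) 0 0) = ~` free_locus A.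
Proof.
move=> ML LM Oc Cb; apply/seteqP; split=> -[n X] /=; last first.
  move=> /(pencil_inverse_at k0)[M' [F [M'L _ eM']]]; apply/ncrat_domP.
  have -> : M = M' by rewrite -[M']mulmx1 -LM mulmxA M'L mul1mx.
  by eexists; apply: entry_evalsto eM'.
move=> /ncrat_domP[V HV].
have [EL ER] := inverse_expand ML LM.
have row_def l : exists V, evalsto X ((cst c *m M *m cst (delta_mx l 0 : 'cV_d)) 0 0) V.
  have -> : (cst c *m M *m cst (delta_mx l 0 : 'cV_d)) 0 0 =
      (cst (c *m (delta_mx l 0 : 'cV_d))) 0 0 +
      \sum_i (cst c *m M *m cst (A i *m (delta_mx l 0 : 'cV_d))) 0 0 * ncvar k0 i.
    by rewrite -mul_gsumE -gsum_mulr {1}EL mulmxDr mulmx1 mulmxDl mxE map_mxM !mulmxA.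
  have H i : exists V, evalsto X ((cst c *m M *m cst (A i *m (delta_mx l 0 : 'cV_d))) 0 0) V.
    exact: (defined_left ML LM erefl HV Cb).
  eexists; apply: evalstoD; first exact: evmx_const.
  by apply: evalsto_sum => i _; apply: evalstoM (svalP (cid (H i))) (evalsto_var k0 X i).
have ent j l : exists V, evalsto X (M j l) V.
  have [V' HV'] := row_def l.
  have H i : exists V, evalsto X ((cst ((delta_mx 0 j : 'rV_d) *m A i) *m M *m cst (delta_mx l 0 : 'cV_d)) 0 0) V.
    exact: (defined_right ML LM erefl HV' Oc).
  rewrite ER mxE gsum_mulE; eexists; apply: evalstoD; first exact: evmx1.
  apply: evalsto_sum => i _; apply: evalstoM; first exact: evalsto_var.
  rewrite -entry_delta mulmxA -map_mxM; exact: (svalP (cid (H i))).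
have [F eM] := evmx_choice ent.
by apply/free_locusPn/flatmx_unitP; exists F; have [] := inverse_at ML LM eM.
Qed.

End MinimalRealization.

(** * Existence of minimal realizations *)

Section PencilInverse.
Variables (k : fieldType) (k0 : [pchar k] =i pred0) (g : nat).
Local Notation T := (ncrat k0 g).
Local Notation cst := (map_mx (in_alg T)).
Local Notation O := ((fun=> 0) : 'I_g -> 'M[k]_1).

Lemma gsum_at0 (R : algType k) p q (A : 'I_g -> 'M[k]_(p, q)) :
  gsum ((fun=> 0) : 'I_g -> R) A = 0.
Proof. by apply: big1 => i _; rewrite scale0r. Qed.

Lemma free_locus_at0 d (A : 'I_g -> 'M[k]_d) : ~ free_locus A (existT _ 0 O).
Proof.
by apply/free_locusPn; rewrite /gpencil gsum_at0 subr0 flatmx1 unitmx1.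
Qed.

(** At the origin every monic pencil has value 1, so it is invertible over the rational
    functions. *)
Definition pencil_inv d (A : 'I_g -> 'M[k]_d) : 'M[T]_d :=
  sval (cid (pencil_inverse_at k0 (@free_locus_at0 d A))).

Section OnePencil.
Variables (d : nat) (A : 'I_g -> 'M[k]_d).

Lemma pencil_invl : pencil_inv A *m pencil_mx k0 A = 1%:M.
Proof. by rewrite /pencil_inv; case: cid => M /= [F []]. Qed.

Lemma pencil_invr : pencil_mx k0 A *m pencil_inv A = 1%:M.
Proof. by rewrite /pencil_inv; case: cid => M /= [F []]. Qed.

Lemma pencil_inv_uniq M : pencil_mx k0 A *m M = 1%:M -> M = pencil_inv A.
Proof. by move=> LM; rewrite -[LHS]mul1mx -pencil_invl -mulmxA LM mulmx1. Qed.

Lemma pencil_inv_at0 : evmx O (pencil_inv A) 1%:M.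
Proof.
rewrite /pencil_inv; case: cid => M /= [F [ML LM eM]].
have [] := inverse_at ML LM eM; rewrite /gpencil gsum_at0 subr0 mulmx1 => E _.
by rewrite -E.
Qed.

Lemma pencil_inv_col : pencil_inv A = 1%:M + gsum (@ncvar k k0 g) A *m pencil_inv A.
Proof. by have [] := inverse_expand pencil_invl pencil_invr. Qed.

Lemma pencil_inv_row : pencil_inv A = 1%:M + pencil_inv A *m gsum (@ncvar k k0 g) A.
Proof. by have [] := inverse_expand pencil_invl pencil_invr. Qed.

End OnePencil.

Definition realization d (A : 'I_g -> 'M[k]_d) (c : 'rV[k]_d) (b : 'cV[k]_d) : T :=
  (cst c *m pencil_inv A *m cst b) 0 0.

Lemma realizesP d (A : 'I_g -> 'M[k]_d) b c f :
  realizes A b c f <-> f = realization A c^T b.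
Proof.
rewrite /realization -map_trmx; split=> [[M [ML LM /(congr1 (fun N : 'M_1 => N 0 0))]]|->].
  by rewrite mxE mulr1n => ->; rewrite (pencil_inv_uniq LM).
exists (pencil_inv A); split; [exact: pencil_invl|exact: pencil_invr|].
exact/esym/mx11_scalar.
Qed.

Lemma realization_system d (A : 'I_g -> 'M[k]_d) (u : 'cV[T]_d) b c :
  u = cst b + gsum (@ncvar k k0 g) A *m u ->
  (cst c *m u) 0 0 = realization A c b.
Proof.
move=> E; have -> : u = pencil_inv A *m cst b; last by rewrite mulmxA.
rewrite -[LHS]mul1mx -(pencil_invl A) -mulmxA; congr (_ *m _).
by rewrite mulmxBl mul1mx {1}E addrK.
Qed.

(** The common point [X] ensures that no expression here takes the junk value of [ncrat_of]. *)
Lemma ncrat_ofD n (X : 'I_g -> 'M[k]_n.+1) e1 e2 : ncdef X e1 -> ncdef X e2 ->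
  ncrat_of k0 (NcAdd e1 e2) = ncrat_of k0 e1 + ncrat_of k0 e2.
Proof.
move=> d1 d2; have ne : exprdom (NcAdd e1 e2) !=set0.
  by exists (existT _ n X); rewrite /exprdom /= d1.
apply: (ncrat_ext (e0 := nd_mk ne)) => m Y U V dY HU HV.
move: (dY) => /= /andP[Y1 Y2].
rewrite (evalsto_inj HU (evalsto_of k0 dY)).
by rewrite (evalsto_inj HV (evalstoD (evalsto_of k0 Y1) (evalsto_of k0 Y2))).
Qed.

Lemma ncrat_ofM n (X : 'I_g -> 'M[k]_n.+1) e1 e2 : ncdef X e1 -> ncdef X e2 ->
  ncrat_of k0 (NcMul e1 e2) = ncrat_of k0 e1 * ncrat_of k0 e2.
Proof.
move=> d1 d2; have ne : exprdom (NcMul e1 e2) !=set0.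
  by exists (existT _ n X); rewrite /exprdom /= d1.
apply: (ncrat_ext (e0 := nd_mk ne)) => m Y U V dY HU HV.
move: (dY) => /= /andP[Y1 Y2].
rewrite (evalsto_inj HU (evalsto_of k0 dY)).
by rewrite (evalsto_inj HV (evalstoM (evalsto_of k0 Y1) (evalsto_of k0 Y2))).
Qed.

Lemma ncrat_ofV n (X : 'I_g -> 'M[k]_n.+1) e : ncdef X (NcInv e) ->
  ncrat_of k0 e * ncrat_of k0 (NcInv e) = 1.
Proof.
move=> d; have ne : exprdom (NcInv e) !=set0 by exists (existT _ n X).
apply: (ncrat_ext (e0 := nd_mk ne)) => m Y U V dY HU HV.
move: (dY) => /= /andP[Y1 Y2].
rewrite (evalsto_inj HU (evalstoM (evalsto_of k0 Y1) (evalsto_of k0 dY))).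
by rewrite (evalsto_inj HV (evalsto1 k0 Y)) /= divrr.
Qed.

Lemma ncrat_of_const c : ncrat_of k0 (@NcConst k g c) = c%:A.
Proof.
apply: (ncrat_ext (e0 := nd_const g c)) => m Y U V dY HU HV.
rewrite (evalsto_inj HU (evalsto_of k0 (e := NcConst c) isT)).
by rewrite (evalsto_inj HV (evalsto_const k0 Y c)).
Qed.

Lemma ncrat_of_var i : ncrat_of k0 (@NcVar k g i) = ncvar k0 i.
Proof.
apply: (ncrat_ext (e0 := nd_const g 0)) => m Y U V dY HU HV.
rewrite (evalsto_inj HU (evalsto_of k0 (e := NcVar i) isT)).
by rewrite (evalsto_inj HV (evalsto_var k0 Y i)).
Qed.

Lemma ncrat_of_val (e : ndexpr k g) : ncrat_of k0 (val e) = \pi_T e.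
Proof.
apply: (ncrat_ext (e0 := e)) => m Y U V dY HU HV.
rewrite (evalsto_inj HU (evalsto_of k0 dY)).
by rewrite (evalsto_inj HV (evalsto_expr erefl dY)).
Qed.

Lemma gsum_mx11 (a : 'I_g -> k) :
  gsum (@ncvar k k0 g) (fun i => (a i)%:M : 'M_1) = (\sum_i a i *: ncvar k0 i)%:M.
Proof.
apply/matrixP=> i j; rewrite gsumE !ord1 [RHS]mxE mulr1n.
by apply: eq_bigr => l _; rewrite mxE mulr1n.
Qed.

Lemma map_scalar_alg p (a : k) : cst (a%:M : 'M_p) = (a%:A : T)%:M.
Proof. by rewrite map_scalar_mx. Qed.

Lemma cst_scaleE p q (a : k) (M : 'M[k]_(p, q)) : cst (a *: M) = a%:A *: cst M.
Proof. by rewrite map_mxZ. Qed.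

Lemma gsumZ p q a (A : 'I_g -> 'M[k]_(p, q)) :
  gsum (@ncvar k k0 g) (fun i => a *: A i) = a%:A *: gsum (@ncvar k k0 g) A.
Proof.
apply/matrixP=> i j; rewrite gsumE mxE gsumE mulr_sumr.
by apply: eq_bigr => l _; rewrite mxE -scalerAl mul1r scalerA.
Qed.

Lemma gsumB p q (A B : 'I_g -> 'M[k]_(p, q)) :
  gsum (@ncvar k k0 g) (fun i => A i - B i) =
  gsum (@ncvar k k0 g) A - gsum (@ncvar k k0 g) B.
Proof.
apply/matrixP=> i j; rewrite gsumE [RHS]mxE [X in _ + X]mxE !gsumE -sumrB.
by apply: eq_bigr => l _; rewrite !mxE scalerBl.
Qed.

Lemma mulmx_algr p q r a (M : 'M[T]_(p, q)) (N : 'M[T]_(q, r)) :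
  M *m (a%:A *: N) = a%:A *: (M *m N).
Proof.
apply/matrixP=> i j; rewrite !mxE mulr_sumr; apply: eq_bigr => l _.
by rewrite mxE -!scalerAl !mul1r scalerAr.
Qed.

(** The state [u] is carried as a solution of a linear system, which makes every case a block
    computation. The value c b at the origin is recorded because the case of an inverse divides by
    it. *)
Lemma expr_realization e : ncdef O e ->
  exists d (A : 'I_g -> 'M[k]_d) (c : 'rV[k]_d) (b : 'cV[k]_d) (u : 'cV[T]_d),
    [/\ u = cst b + gsum (@ncvar k k0 g) A *m u,
        (ncrat_of k0 e)%:M = cst c *m u & nceval O e = c *m b].
Proof.
elim: e => [a|i|e1 IH1 e2 IH2|e1 IH1 e2 IH2|e IH] /=.
- move=> _; exists 1, (fun=> 0), a%:M, 1%:M, 1%:M; split.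
  + by rewrite gsum0 // mul0mx addr0 map_mx1.
  + by rewrite mulmx1 ncrat_of_const map_scalar_alg.
  + by rewrite mulmx1 -[1]/(1%:M) scale_scalar_mx mulr1.
- move=> _; exists (1 + 1)%N, (fun l => block_mx 0 ((l == i)%:R%:M : 'M_1) 0 0),
    (row_mx 1%:M 0), (col_mx 0 1%:M), (col_mx (ncvar k0 i)%:M 1%:M); split.
  + rewrite gsum_block gsum_mx11 !(gsum0 _ (fun=> erefl)) mul_block_col map_col_mx.
    rewrite map_mx0 map_mx1 !mul0mx !add0r add_col_mx addr0 mulmx1 add0r.
    rewrite (bigD1 i) //= eqxx scale1r big1 ?addr0 // => l /negPf ->; exact: scale0r.
  + by rewrite ncrat_of_var map_row_mx map_mx1 map_mx0 mul_row_col mul1mx mul0mx addr0.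
  + by rewrite mul_row_col mulmx0 mul0mx addr0.
- move=> /andP[O1 O2]; have [d1 [A1 [c1 [b1 [u1 [E1 F1 V1]]]]]] := IH1 O1.
  have [d2 [A2 [c2 [b2 [u2 [E2 F2 V2]]]]]] := IH2 O2.
  exists (d1 + d2)%N, (fun i => block_mx (A1 i) 0 0 (A2 i)), (row_mx c1 c2),
    (col_mx b1 b2), (col_mx u1 u2); split.
  + rewrite gsum_block !(gsum0 _ (fun=> erefl)) mul_block_col map_col_mx.
    by rewrite !mul0mx addr0 add0r add_col_mx -E1 -E2.
  + by rewrite (ncrat_ofD O1 O2) map_row_mx mul_row_col -F1 -F2 raddfD.
  + by rewrite mul_row_col -V1 -V2.
- move=> /andP[O1 O2]; have [d1 [A1 [c1 [b1 [u1 [E1 F1 V1]]]]]] := IH1 O1.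
  have [d2 [A2 [c2 [b2 [u2 [E2 F2 V2]]]]]] := IH2 O2.
  (* Series connection: the first state is multiplied by the output c2 u2 of the second factor. *)
  exists (d1 + d2)%N, (fun i => block_mx (A1 i) (b1 *m c2 *m A2 i) 0 (A2 i)),
    (row_mx c1 0), (col_mx (b1 *m c2 *m b2) b2), (col_mx (u1 *m (cst c2 *m u2)) u2).
  split.
  + rewrite gsum_block (gsum0 _ (fun=> erefl)) mul_block_col map_col_mx add_col_mx.
    rewrite mul0mx add0r -E2; congr col_mx.
    rewrite -gsum_mull !map_mxM {1}E1 mulmxDl addrA addrAC; congr (_ + _).
      by rewrite {1}E2 !mulmxDr !mulmxA.
    by rewrite !mulmxA.
  + rewrite (ncrat_ofM O1 O2) map_row_mx mul_row_col map_mx0 mul0mx addr0.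
    by rewrite scalar_mxM F1 F2 !mulmxA.
  + by rewrite mul_row_col mul0mx addr0 -[_ * _]/(_ *m _) V1 V2 !mulmxA.
- move=> /andP[Oe ue]; have [d [A [c [b [u [E F V]]]]]] := IH Oe.
  have FV : ncrat_of k0 e * ncrat_of k0 (NcInv e) = 1.
    by apply: (ncrat_ofV (X := O)); rewrite /= Oe.
  set t := ncrat_of k0 (NcInv e) in FV *.
  pose dl := (c *m b) 0 0.
  have cb : c *m b = dl%:M by apply: mx11_scalar.
  have dl0 : dl != 0.
    by apply: contraTneq ue => d0; rewrite V cb d0 raddf0 unitr0.
  (* With z = u t the equation e t = 1 reads c z = 1. Solving it for t introduces [dl^-1], and
     substituting t into the equation for z gives the new pencil. *)
  exists (1 + d)%N, (fun i => block_mx 0 (- dl^-1 *: (c *m A i)) 0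
    (A i - dl^-1 *: (b *m c *m A i))), (row_mx 1%:M 0),
    (col_mx (dl^-1)%:M (dl^-1 *: b)), (col_mx t%:M (u *m t%:M)).
  pose N := gsum (@ncvar k k0 g) A.
  pose z := u *m t%:M.
  have zE : z = cst b *m t%:M + N *m z by rewrite /z {1}E mulmxDl mulmxA.
  have cz : cst c *m z = 1%:M by rewrite /z mulmxA -F -scalar_mxM FV.
  have tE : t%:M = (dl^-1)%:A *: (1%:M - cst c *m (N *m z)) :> 'M_1.
    have : cst c *m z = dl%:A *: t%:M + cst c *m (N *m z).
      by rewrite {1}zE mulmxDr !mulmxA -map_mxM cb map_scalar_alg mul_scalar_mx.
    rewrite cz => /eqP; rewrite -subr_eq => /eqP ->.
    rewrite scalerA -scalerAl mul1r scalerA mulVf // scale1r scale1r //.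
  split.
  + rewrite gsum_block !(gsum0 _ (fun=> erefl)) mul_block_col map_col_mx add_col_mx.
    rewrite !mul0mx !add0r -/z; congr col_mx.
      rewrite map_scalar_alg tE gsumZ -gsum_mull -/N -scalemxAl -mulmxA scalerBr.
      by rewrite scale_scalar_mx mulr1 [(- _)%:A]scaleNr scaleNr.
    rewrite [LHS]zE tE mulmx_algr mulmxBr mulmx1 gsumB gsumZ.
    have -> : gsum (@ncvar k k0 g) (fun i => b *m c *m A i) = cst b *m (cst c *m N).
      by rewrite -gsum_mull map_mxM mulmxA.
    rewrite -/N mulmxBl -scalemxAl cst_scaleE scalerBr -!mulmxA.
    by rewrite -!addrA [- _ + _]addrC.
  + by rewrite map_row_mx map_mx0 map_mx1 mul_row_col mul1mx mul0mx addr0.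
  + rewrite mul_row_col mul0mx addr0 mul1mx V cb; exact: invmx_scalar.
Qed.

Lemma dom0_expr f : ncrat_dom f (ncorigin k g) ->
  exists d (A : 'I_g -> 'M[k]_d) c b, f = realization A c b.
Proof.
move=> [e <- De]; have [d [A [c [b [u [E F _]]]]]] := expr_realization De.
exists d, A, c, b; rewrite -(realization_system c E) -F mxE mulr1n.
exact/esym/ncrat_of_val.
Qed.

(* Evaluate at the triangular points [[0, W], [0, Z]]. *)
Lemma ncvar_cancell (h : 'I_g -> T) : (forall i, exists V, evalsto O (h i) V) ->
  \sum_i ncvar k0 i * h i = 0 -> forall i, h i = 0.
Proof.
move=> H sum0 i.
have /choice[E HE] j : exists e : ndexpr k g, \pi_T e = h j /\ ncdef O (val e).
  by have [V [e [? ? _]]] := H j; exists e.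
have [e0 He0] := common_domain_of k0 (E i) (fun (j : 'I_g) (_ : 'I_1) => E j).
apply: (ncrat_ext (e0 := e0)) => n Z U V /He0[_ Ze] HU HV.
rewrite (evalsto_inj HV (evalsto0 k0 Z)) {HV}.
have HUi := evalsto_expr (HE i).1 (Ze i 0); rewrite (evalsto_inj HU HUi).
apply/matrixP=> r s; rewrite [RHS]mxE.
pose W j : 'M[k]_(1, n.+1) := if j == i then delta_mx 0 r else 0.
pose P j := btri (O j) (W j) (Z j).
have Hj j : exists X, evalsto P (h j) (btri (nceval O (val (E j))) X (nceval Z (val (E j)))).
  have [D [_ ED]] := nceval_btri (val (E j)).
  have [dP EP] := ED _ _ _ W _ (HE j).2 (Ze j 0); have := evalsto_expr (HE j).1 dP.
  by rewrite EP => HX; eexists; apply: HX.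
have [X HX] := choice Hj.
have : evalsto P (\sum_j ncvar k0 j * h j)
   (\sum_j P j * btri (nceval O (val (E j))) (X j) (nceval Z (val (E j)))).
  by apply: evalsto_sum => j _; apply: evalstoM (evalsto_var k0 P j) (HX j).
rewrite sum0 => /(evalsto_inj (evalsto0 k0 P)).
under eq_bigr do rewrite btriM.
rewrite btri_sum -btri0 => /btri_inj[_ /matrixP/(_ 0 s) + _].
rewrite mxE summxE (bigD1 i) //= big1 ?addr0 => [|j /negPf ji].
  rewrite /W eqxx mul0mx add0r -rowE mxE => <- //.
by rewrite /W ji !mul0mx addr0 mxE.
Qed.

(** The mirror image of [ncvar_cancell], at the points [[Z, W], [0, 0]]. *)
Lemma ncvar_cancelr (h : 'I_g -> T) : (forall i, exists V, evalsto O (h i) V) ->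
  \sum_i h i * ncvar k0 i = 0 -> forall i, h i = 0.
Proof.
move=> H sum0 i.
have /choice[E HE] j : exists e : ndexpr k g, \pi_T e = h j /\ ncdef O (val e).
  by have [V [e [? ? _]]] := H j; exists e.
have [e0 He0] := common_domain_of k0 (E i) (fun (j : 'I_g) (_ : 'I_1) => E j).
apply: (ncrat_ext (e0 := e0)) => n Z U V /He0[_ Ze] HU HV.
rewrite (evalsto_inj HV (evalsto0 k0 Z)) {HV}.
have HUi := evalsto_expr (HE i).1 (Ze i 0); rewrite (evalsto_inj HU HUi).
apply/matrixP=> r s; rewrite [RHS]mxE.
pose W j : 'M[k]_(n.+1, 1) := if j == i then delta_mx s 0 else 0.
pose P j := btri (Z j) (W j) (O j).
have Hj j : exists X, evalsto P (h j) (btri (nceval Z (val (E j))) X (nceval O (val (E j)))).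
  have [D [_ ED]] := nceval_btri (val (E j)).
  have [dP EP] := ED _ _ _ W _ (Ze j 0) (HE j).2; have := evalsto_expr (HE j).1 dP.
  by rewrite EP => HX; eexists; apply: HX.
have [X HX] := choice Hj.
have : evalsto P (\sum_j h j * ncvar k0 j)
   (\sum_j btri (nceval Z (val (E j))) (X j) (nceval O (val (E j))) * P j).
  by apply: evalsto_sum => j _; apply: evalstoM (HX j) (evalsto_var k0 P j).
rewrite sum0 => /(evalsto_inj (evalsto0 k0 P)).
under eq_bigr do rewrite btriM.
rewrite btri_sum -btri0 => /btri_inj[_ /matrixP/(_ r 0) + _].
rewrite mxE summxE (bigD1 i) //= big1 ?addr0 => [|j /negPf ji].
  rewrite /W eqxx mulmx0 addr0 -colE mxE => <- //.
by rewrite /W ji !mulmx0 addr0 mxE.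
Qed.

Lemma const_alg_inj (a : k) : (a%:A : T) = 0 -> a = 0.
Proof.
move=> a0; have := evalsto_const k0 O a; rewrite a0 => /(evalsto_inj (evalsto0 k0 O)).
by move=> /matrixP/(_ 0 0); rewrite !mxE mulr1.
Qed.

Lemma realization_at0 d (A : 'I_g -> 'M[k]_d) c b :
  exists V, evalsto O (realization A c b) V.
Proof. by eexists; apply: (entry_evalsto c b (pencil_inv_at0 A)). Qed.

Lemma realization_colE d (A : 'I_g -> 'M[k]_d) (c : 'rV[k]_d) b :
  realization A c b = ((c *m b) 0 0)%:A + \sum_i ncvar k0 i * realization A (c *m A i) b.
Proof.
rewrite {1}/realization pencil_inv_col mulmxDr mulmxDl mxE mulmx1 -map_mxM mxE.
congr (_ + _); rewrite mulmxA gsum_mull -mulmxA gsum_mulE; apply: eq_bigr => i _.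
by rewrite /realization !mulmxA.
Qed.

Lemma realization_rowE d (A : 'I_g -> 'M[k]_d) (c : 'rV[k]_d) b :
  realization A c b = ((c *m b) 0 0)%:A + \sum_i realization A c (A i *m b) * ncvar k0 i.
Proof.
rewrite {1}/realization pencil_inv_row mulmxDr mulmxDl mxE mulmx1 -map_mxM mxE.
by congr (_ + _); rewrite mulmxA -mulmxA gsum_mulr mul_gsumE.
Qed.

(** The value at the origin gives c b = 0, after which the leading variables cancel. Hence the rows
    [c] with zero realization form a subspace invariant under the [A i]. *)
Lemma realization0_row d (A : 'I_g -> 'M[k]_d) (c : 'rV[k]_d) b :
  realization A c b = 0 -> c *m b = 0 /\ forall i, realization A (c *m A i) b = 0.
Proof.
rewrite realization_colE => E.
have cb : (c *m b) 0 0 = 0.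
  apply: const_alg_inj.
  have : evalsto O (((c *m b) 0 0)%:A + \sum_i ncvar k0 i * realization A (c *m A i) b)
      (((c *m b) 0 0)%:A + \sum_(i < g) 0 * sval (cid (realization_at0 A (c *m A i) b))).
    apply: evalstoD; first exact: evalsto_const.
    apply: evalsto_sum => i _; apply: evalstoM (evalsto_var k0 O i) _.
    exact: (svalP (cid (realization_at0 A (c *m A i) b))).
  rewrite E big1 ?addr0 => [|i _]; last by rewrite mul0r.
  move=> /(evalsto_inj (evalsto0 k0 O)) /matrixP/(_ 0 0); rewrite !mxE mulr1 => <-.
  by rewrite scale0r.
split; first by rewrite [LHS]mx11_scalar cb raddf0.
apply: ncvar_cancell; last by move: E; rewrite cb scale0r add0r.
by move=> i; apply: realization_at0.
Qed.

Lemma realization0_col d (A : 'I_g -> 'M[k]_d) (c : 'rV[k]_d) b :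
  realization A c b = 0 -> c *m b = 0 /\ forall i, realization A c (A i *m b) = 0.
Proof.
move=> E; have [cb _] := realization0_row E; split=> //.
apply: ncvar_cancelr; first by move=> i; apply: realization_at0.
by move: E; rewrite realization_rowE cb mxE scale0r add0r.
Qed.

Lemma pencil_inv_block d1 d2 (A : 'I_g -> 'M[k]_d1) B (D : 'I_g -> 'M[k]_d2) :
  pencil_inv (fun i => block_mx (A i) (B i) 0 (D i)) =
  block_mx (pencil_inv A) (pencil_inv A *m gsum (@ncvar k k0 g) B *m pencil_inv D)
           0 (pencil_inv D).
Proof.
by apply/esym/pencil_inv_uniq/gpencil_block_inv; apply: pencil_invr.
Qed.

Lemma pencil_inv_sim d1 d2 (S : 'M[k]_(d1, d2)) S' (A : 'I_g -> 'M[k]_d2) (B : 'I_g -> 'M[k]_d1) :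
  S *m S' = 1%:M -> S' *m S = 1%:M -> (forall i, S *m A i = B i *m S) ->
  pencil_inv A = cst S' *m pencil_inv B *m cst S.
Proof.
by move=> SS' S'S E; apply/esym/pencil_inv_uniq/(gpencil_sim_inv SS' S'S E)/pencil_invr.
Qed.

Lemma realization_sim d1 d2 (S : 'M[k]_(d1, d2)) S' (A : 'I_g -> 'M[k]_d2)
    (B : 'I_g -> 'M[k]_d1) c b :
  S *m S' = 1%:M -> S' *m S = 1%:M -> (forall i, S *m A i = B i *m S) ->
  realization A c b = realization B (c *m S') (S *m b).
Proof.
by move=> *; rewrite /realization (pencil_inv_sim (S := S) (S' := S') (B := B)) // !map_mxM !mulmxA.
Qed.

(** The rows of [S] are a basis of a complement of the row space of [B], followed by a basis of that
    space; its invariance makes the lower left block vanish. *)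
Lemma block_form d (A : 'I_g -> 'M[k]_d) (B : 'M[k]_d) :
  (forall i, (B *m A i <= B)%MS) ->
  exists d1 d2 (S : 'M[k]_(d1 + d2, d)) (S' : 'M[k]_(d, d1 + d2)) A11 A12 A22,
    [/\ (d1 + d2)%N = d, d2 = \rank B, S *m S' = 1%:M /\ S' *m S = 1%:M,
        forall i, S *m A i = block_mx (A11 i) (A12 i) 0 (A22 i) *m S &
        (dsubmx S :=: B)%MS].
Proof.
move=> stab; pose R := row_base B; pose C := row_base B^C%MS; pose S := col_mx C R.
have dE : (\rank B^C%MS + \rank B)%N = d by rewrite mxrank_compl subnK // rank_leq_col.
have full : row_full S.
  rewrite /row_full -[\rank S]/(\rank (col_mx C R)) -addsmxE.
  have -> : \rank (C + R)%MS = \rank (B + B^C)%MS.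
    by rewrite addsmxC (adds_eqmx (eq_row_base B) (eq_row_base _)).
  exact: addsmx_compl_full.
have free : row_free S by rewrite /row_free (eqP full) dE.
pose N i := S *m A i *m pinvmx S.
have NE i : S *m A i = N i *m S by rewrite /N -mulmxA mulVpmx // mulmx1.
exists (\rank B^C%MS), (\rank B), S, (pinvmx S), (fun i => ulsubmx (N i)),
  (fun i => ursubmx (N i)), (fun i => drsubmx (N i)).
split=> //; [by split; [apply: mulmxVp|apply: mulVpmx]| |by rewrite col_mxKd; apply: eq_row_base].
move=> i; rewrite NE; congr (_ *m _); rewrite -[LHS]submxK; congr block_mx.
have /submxP[X EX] : (R *m A i <= R)%MS.
  rewrite eq_row_base (submx_trans _ (stab i)) // submxMr //.
  by rewrite eq_row_base.
rewrite /dlsubmx.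
have -> : dsubmx (N i) = R *m A i *m pinvmx S.
  by rewrite /N -!mul_dsub_mx col_mxKd.
have -> : R *m A i = row_mx 0 X *m S by rewrite mul_row_col mul0mx add0r.
by rewrite -mulmxA mulmxVp // mulmx1 row_mxKl.
Qed.

Lemma realizationP d (A : 'I_g -> 'M[k]_d) a c c' b :
  realization A (a *: c + c') b = a *: realization A c b + realization A c' b.
Proof.
rewrite /realization -!mulmxA !map_in_alg_mulE scaler_sumr -big_split.
by apply: eq_bigr => l _ /=; rewrite !mxE scalerDl scalerA.
Qed.

Lemma realization0l d (A : 'I_g -> 'M[k]_d) b : realization A 0 b = 0.
Proof. by rewrite /realization map_mx0 !mul0mx mxE. Qed.

Lemma realization0r d (A : 'I_g -> 'M[k]_d) c : realization A c 0 = 0.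
Proof. by rewrite /realization map_mx0 !mulmx0 mxE. Qed.

Lemma realization_block d1 d2 (A : 'I_g -> 'M[k]_d1) B (D : 'I_g -> 'M[k]_d2) c1 c2 b1 b2 :
  realization (fun i => block_mx (A i) (B i) 0 (D i)) (row_mx c1 c2) (col_mx b1 b2) =
  realization A c1 b1 +
  (cst c1 *m pencil_inv A *m gsum (@ncvar k k0 g) B *m pencil_inv D *m cst b2) 0 0 +
  realization D c2 b2.
Proof.
rewrite /realization pencil_inv_block map_row_mx map_col_mx mul_row_block mul_row_col.
by rewrite !mulmx0 addr0 mulmxDl !mulmxA !mxE addrA.
Qed.

(** The rows [u] with u L_A^-1 b = 0 form an invariant space. In adapted coordinates the lower part
    of [b] is zero, so only the upper block contributes. *)
Lemma uncontrollable_reduce d (A : 'I_g -> 'M[k]_d) c b :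
  ~ controllable (pencil_inv A) b ->
  exists d' (A' : 'I_g -> 'M[k]_d') c' b', (d' < d)%N /\
    realization A c b = realization A' c' b'.
Proof.
move=> /existsNP[u /not_implyP[u0 /eqP un0]].
have [||B HB] := @subspace_mx k d (fun u => realization A u b = 0).
- exact: realization0l.
- by move=> a v w v0 w0; rewrite realizationP v0 w0 scaler0 addr0.
have [|d1 [d2 [S [S' [A11 [A12 [A22 [dE d2E [SS' S'S] SA HS]]]]]]]] := @block_form d A B.
  move=> i; apply/row_subP=> j; rewrite row_mul; apply/HB.
  by have /HB/realization0_row[_] := row_sub j B.
exists d1, A11, (lsubmx (c *m S')), (usubmx (S *m b)); split.
  rewrite -dE -[X in (X < _)%N]addn0 ltn_add2l d2E lt0n mxrank_eq0.
  by apply: contraNneq un0 => B0; rewrite -submx0 -B0; apply/HB.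
rewrite (realization_sim c b SS' S'S SA) -[c *m S']hsubmxK -[S *m b]vsubmxK.
have -> : dsubmx (S *m b) = 0.
  rewrite -mul_dsub_mx; apply/row_matrixP => i; rewrite row_mul row0.
  by have /HB/realization0_row[] : (row i (dsubmx S) <= B)%MS by rewrite -HS row_sub.
rewrite realization_block map_mx0 mulmx0 mxE realization0r !addr0.
by rewrite row_mxKl col_mxKu.
Qed.

(** The annihilator of the columns [w] with c L_A^-1 w = 0 is invariant and contains [c], so in
    adapted coordinates only the lower block contributes. *)
Lemma unobservable_reduce d (A : 'I_g -> 'M[k]_d) c b :
  ~ observable (pencil_inv A) c ->
  exists d' (A' : 'I_g -> 'M[k]_d') c' b', (d' < d)%N /\
    realization A c b = realization A' c' b'.
Proof.
move=> /existsNP[v /not_implyP[v0 /eqP vn0]].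
pose G (u : 'rV[k]_d) := forall w, realization A c w = 0 -> u *m w = 0.
have [||B HB] := @subspace_mx k d G.
- by move=> w _; rewrite mul0mx.
- by move=> a u u' Gu Gu' w w0; rewrite mulmxDl -scalemxAl Gu // Gu' // scaler0 addr0.
have [|d1 [d2 [S [S' [A11 [A12 [A22 [dE d2E [SS' S'S] SA HS]]]]]]]] := @block_form d A B.
  move=> i; apply/row_subP=> j; rewrite row_mul; apply/HB => w w0.
  have /HB Gj := row_sub j B; rewrite -mulmxA; apply: Gj.
  by have [_] := realization0_col w0.
exists d2, A22, (rsubmx (c *m S')), (dsubmx (S *m b)); split.
  rewrite -[X in (_ < X)%N]dE -[X in (X < _)%N]add0n ltn_add2r lt0n.
  apply: contraNneq vn0 => d10.
  have full : row_full B by rewrite /row_full -d2E -[X in _ == X]dE d10.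
  apply/eqP/row_matrixP=> i; rewrite rowE row0.
  by rewrite (proj2 (HB (delta_mx 0 i)) (submx_full _ full) v v0).
have /HB : G c by move=> w /realization0_row[].
rewrite -HS => /submxP[Y cY].
rewrite (realization_sim c b SS' S'S SA) -[c *m S']hsubmxK -[S *m b]vsubmxK.
have -> : lsubmx (c *m S') = 0.
  have -> : c = row_mx 0 Y *m S by rewrite -[S]vsubmxK mul_row_col mul0mx add0r.
  by rewrite -mulmxA SS' mulmx1 row_mxKl.
rewrite realization_block map_mx0 !mul0mx mxE realization0l !add0r.
by rewrite row_mxKr col_mxKd.
Qed.

Lemma minimal_realization f : ncrat_dom f (ncorigin k g) ->
  exists d (A : 'I_g -> 'M[k]_d) c b,
    [/\ f = realization A c b, observable (pencil_inv A) c &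
        controllable (pencil_inv A) b].
Proof.
move=> /dom0_expr[d]; elim/ltn_ind: d => d IH [A [c [b fE]]].
have [Oc|/(unobservable_reduce b)[d' [A' [c' [b' [lt E]]]]]] := pselect (observable (pencil_inv A) c); last first.
  by apply: (IH d') => //; exists A', c', b'; rewrite fE.
have [Cb|/(uncontrollable_reduce c)[d' [A' [c' [b' [lt E]]]]]] := pselect (controllable (pencil_inv A) b); last first.
  by apply: (IH d') => //; exists A', c', b'; rewrite fE.
by exists d, A, c, b.
Qed.

Lemma realization_dom d (A : 'I_g -> 'M[k]_d) c b :
  observable (pencil_inv A) c -> controllable (pencil_inv A) b ->
  ncrat_dom (realization A c b) = ~` free_locus A.
Proof.
by move=> Oc Cb; apply: ncrat_dom_realization Oc Cb; [apply: pencil_invl|apply: pencil_invr].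
Qed.

End PencilInverse.

(** * Polynomial evaluations, irreducible pencils and kernels *)

(* Noncommutative polynomials without constant term. *)
Inductive ncpoly0 (k : Type) (g : nat) : Type :=
  | NpZero
  | NpVar of 'I_g
  | NpAdd of ncpoly0 k g & ncpoly0 k g
  | NpMul of ncpoly0 k g & ncpoly0 k g
  | NpScale of k & ncpoly0 k g.
Arguments NpZero {k g}.
Arguments NpVar {k g}.
Arguments NpAdd {k g}.
Arguments NpMul {k g}.
Arguments NpScale {k g}.

Section NonunitalPolynomials.
Variables (k : fieldType) (g : nat).
Local Notation np := (ncpoly0 k g).

Section Npeval.
Variables (d : nat) (A : 'I_g -> 'M[k]_d).

Fixpoint npeval (p : np) : 'M[k]_d :=
  match p with
  | NpZero => 0
  | NpVar i => A i
  | NpAdd p q => npeval p + npeval q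
  | NpMul p q => npeval p *m npeval q
  | NpScale a p => a *: npeval p
  end.

Definition npsum (s : seq np) : np := foldr NpAdd NpZero s.

Lemma npeval_sum I (r : seq I) (F : I -> np) :
  npeval (npsum [seq F i | i <- r]) = \sum_(i <- r) npeval (F i).
Proof. by elim: r => [|i r IH]; rewrite ?big_nil // big_cons -IH. Qed.

End Npeval.

Lemma npeval_sim d1 d2 (S : 'M[k]_(d1, d2)) (A : 'I_g -> 'M[k]_d2) (B : 'I_g -> 'M[k]_d1) p :
  (forall i, S *m A i = B i *m S) -> S *m npeval A p = npeval B p *m S.
Proof.
move=> SA; elim: p => [|i|p IHp q IHq|p IHp q IHq|a p IH] /=.
- by rewrite mulmx0 mul0mx.
- exact: SA.
- by rewrite mulmxDr mulmxDl IHp IHq.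
- by rewrite mulmxA IHp -mulmxA IHq mulmxA.
- by rewrite -scalemxAr -scalemxAl IH.
Qed.

Lemma npeval_block d1 d2 (A : 'I_g -> 'M[k]_d1) B (D : 'I_g -> 'M[k]_d2) p :
  exists N, npeval (fun i => block_mx (A i) (B i) 0 (D i)) p =
            block_mx (npeval A p) N 0 (npeval D p).
Proof.
elim: p => [|i|p [M IHp] q [N IHq]|p [M IHp] q [N IHq]|a p [M IH]] /=.
- by exists 0; rewrite -[0 in LHS](@block_mx0 _ d1 d2 d1 d2).
- by exists (B i).
- by exists (M + N); rewrite IHp IHq add_block_mx addr0.
- exists (npeval A p *m N + M *m npeval D q); rewrite IHp IHq mulmx_block.
  by rewrite !mulmx0 !mul0mx !addr0 add0r.
- by exists (a *: M); rewrite IH scale_block_mx scaler0.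
Qed.

Fixpoint npexpr (p : np) : ncexpr k g :=
  match p with
  | NpZero => NcConst 0
  | NpVar i => NcVar i
  | NpAdd p q => NcAdd (npexpr p) (npexpr q)
  | NpMul p q => NcMul (npexpr p) (npexpr q)
  | NpScale a p => NcMul (NcConst a) (npexpr p)
  end.

Lemma npexprP n (X : 'I_g -> 'M[k]_n.+1) p :
  ncdef X (npexpr p) /\ nceval X (npexpr p) = npeval X p.
Proof.
elim: p => [|i|p [dp Ep] q [dq Eq]|p [dp Ep] q [dq Eq]|a p [dp Ep]] //=.
- by rewrite scale0r.
- by rewrite dp dq Ep Eq.
- by rewrite dp dq Ep Eq.
- by rewrite dp Ep -scalerAl mul1r.
Qed.

Lemma npeval_at0 n p : npeval ((fun=> 0) : 'I_g -> 'M[k]_n) p = 0.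
Proof.
elim: p => [|i|p Ep q Eq|p Ep q Eq|a p Ep] //=.
- by rewrite Ep Eq addr0.
- by rewrite Ep mul0mx.
- by rewrite Ep scaler0.
Qed.

(** Equivalently, p(B) |-> p(A) is a well-defined map from the algebra generated by [B] onto that
    generated by [A]. *)
Definition kerle d d' (B : 'I_g -> 'M[k]_d') (A : 'I_g -> 'M[k]_d) : Prop :=
  forall p, npeval B p = 0 -> npeval A p = 0.

Lemma kerle_sim_block d d1 d2 (A : 'I_g -> 'M[k]_d) (S : 'M[k]_(d1 + d2, d)) S' A11 A12 A22 :
  S *m S' = 1%:M -> (forall i, S *m A i = block_mx (A11 i) (A12 i) 0 (A22 i) *m S) ->
  kerle A A11 /\ kerle A A22.
Proof.
move=> SS' SA; suff H p : npeval A p = 0 -> npeval A11 p = 0 /\ npeval A22 p = 0.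
  by split=> p /H[].
move=> p0; have [N E] := npeval_block A11 A12 A22 p.
have := npeval_sim p SA; rewrite p0 mulmx0 E => /(congr1 (mulmx^~ S')).
rewrite mul0mx -mulmxA SS' mulmx1 -(@block_mx0 _ d1 d2 d1 d2).
by move=> /(@eq_block_mx _ d1 d2 d1 d2)[].
Qed.

(** * Kernel inclusion and free loci *)

Section KernelLocus.
Variables (n d d' : nat) (A : 'I_g -> 'M[k]_d) (B : 'I_g -> 'M[k]_d').
Variable (X : 'I_g -> 'M[k]_n.+1).
Local Notation Mn := 'M[k]_n.+1.

(** The coefficient of the matrix unit E_ab when [U] is read in M_e(k) (x) M_n(k). *)
Definition slicemx e (U : 'M[Mn]_e) a b : 'M[k]_e := \matrix_(i, j) U i j a b.

(** Corresponding slices are values at [A] and [B] of one polynomial, so under [kerle B A] the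
    equation [V = 0] forces [U = 0]. *)
Definition slice_rel (U : 'M[Mn]_d) (V : 'M[Mn]_d') : Prop := forall a b,
  exists p, npeval A p = slicemx U a b /\ npeval B p = slicemx V a b.

Lemma slicemx_inj e (U : 'M[Mn]_e) : (forall a b, slicemx U a b = 0) -> U = 0.
Proof.
move=> H; apply/matrixP=> i j; apply/matrixP=> a b.
by have /matrixP/(_ i j) := H a b; rewrite !mxE.
Qed.

Lemma slicemxP e c (U V : 'M[Mn]_e) a b :
  slicemx (c%:M *: U + V) a b = c *: slicemx U a b + slicemx V a b.
Proof.
have E i j : (c%:M *: U + V) i j = c *: U i j + V i j.
  rewrite [LHS]mxE [X in X + _]mxE; congr (_ + _); exact: mul_scalar_mx.
by apply/matrixP=> i j; rewrite mxE E !mxE.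
Qed.

Lemma slicemxM e (U V : 'M[Mn]_e) a b :
  slicemx (U *m V) a b = \sum_c slicemx U a c *m slicemx V c b.
Proof.
apply/matrixP=> i j; rewrite !mxE !summxE.
transitivity (\sum_l \sum_c U i l a c * V l j c b).
  by apply: eq_bigr => l _; apply: mxE.
rewrite exchange_big; apply: eq_bigr => c _; rewrite mxE.
by apply: eq_bigr => l _; rewrite !mxE.
Qed.

Lemma slice_relP c U V U' V' : slice_rel U V -> slice_rel U' V' ->
  slice_rel (c%:M *: U + U') (c%:M *: V + V').
Proof.
move=> R R' a b; have [p [pA pB]] := R a b; have [q [qA qB]] := R' a b.
by exists (NpAdd (NpScale c p) q); rewrite /= pA pB qA qB !slicemxP.
Qed.

Lemma slice_relM U V U' V' : slice_rel U V -> slice_rel U' V' ->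
  slice_rel (U *m U') (V *m V').
Proof.
move=> R R' a b.
have /choice[p Hp] c := R a c; have /choice[q Hq] c := R' c b.
exists (npsum [seq NpMul (p c) (q c) | c <- enum 'I_n.+1]).
rewrite !npeval_sum !big_enum !slicemxM /=; split; apply: eq_bigr => c _;
by rewrite ?(Hp c).1 ?(Hp c).2 ?(Hq c).1 ?(Hq c).2.
Qed.

Lemma slice_rel_gsum : slice_rel (gsum X A) (gsum X B).
Proof.
move=> a b; exists (npsum [seq NpScale (X l a b) (NpVar l) | l <- enum 'I_g]).
rewrite !npeval_sum !big_enum /=; split; apply/matrixP=> i j;
by rewrite !mxE gsumE !summxE; apply: eq_bigr => l _; rewrite !mxE mulrC.
Qed.

(** The inverse F' of L_B(X) is a polynomial in it; U is its counterpart at [A]. From SB F' L_B - SB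
    = 0 follows SA U L_A = SA, so 1 + SA U inverts L_A(X). The factors SA and SB remove constant
    terms, about which [kerle] says nothing. *)
Lemma kerle_unit : kerle B A ->
  flatmx (gpencil X B) \in unitmx -> flatmx (gpencil X A) \in unitmx.
Proof.
move=> kBA; have R0 := slice_rel_gsum.
set SA := gsum X A in R0; set SB := gsum X B in R0.
pose G V := exists U, slice_rel (SA *m U) (SB *m V).
have subE e (U V : 'M[Mn]_e) : U - V = (-1)%:M *: V + U.
  by rewrite addrC -[- V]scaleN1r raddfN.
have cen e c (U V : 'M[Mn]_e) : U *m (c%:M *: V) = c%:M *: (U *m V).
  apply/matrixP=> i j; rewrite !mxE mulr_sumr; apply: eq_bigr => l _; rewrite mxE.
  have com (M : Mn) : c%:M * M = M * c%:M by apply: etrans (mul_scalar_mx c M) _; apply/esym/mul_mx_scalar.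
  by rewrite !mulrA com.
move=> /(flatmx_unit_closed (G := G))[].
- by exists 1%:M; rewrite !mulmx1.
- move=> a V V' [U RU] [U' RU']; exists (a%:M *: U + U').
  by rewrite !mulmxDr !cen; apply: slice_relP.
- move=> V [U RU]; exists (U *m gpencil X A).
  rewrite !mulmxA !mulmxBr !mulmx1 !subE; apply: slice_relP => //.
  exact: slice_relM.
move=> F' [LF FL [U RU]].
have E : SA *m U *m gpencil X A = SA.
  have : slice_rel (SA *m U *m gpencil X A - SA) (SB *m F' *m gpencil X B - SB).
    rewrite !mulmxBr !mulmx1 !subE; apply: slice_relP => //; apply: slice_relP => //.
    exact: slice_relM.
  rewrite -[SB *m F' *m _]mulmxA FL mulmx1 subrr => R; apply/eqP; rewrite -subr_eq0; apply/eqP.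
  apply: slicemx_inj => a b; have [p [<- pB]] := R a b; apply: kBA.
  by rewrite pB; apply/matrixP=> i j; rewrite !mxE.
apply/flatmx_unitP; exists (SA *m U + 1%:M); apply: mulmx1_flat.
by rewrite mulmxDl E mul1mx addrC subrK.
Qed.

End KernelLocus.

Lemma kerle_locus d d' (A : 'I_g -> 'M[k]_d) (B : 'I_g -> 'M[k]_d') :
  kerle B A -> free_locus A `<=` free_locus B.
Proof.
move=> kBA [n X]; apply: contrapT => /not_implyP[ZA /free_locusPn/(kerle_unit kBA)].
by move=> /free_locusPn.
Qed.

(** The nonzero coefficient excludes size 0 and the zero pencil of size 1, whose free locus is
    empty. *)
Definition irr_pencil d (A : 'I_g -> 'M[k]_d) : Prop :=
  (exists i, A i != 0) /\
  forall U : 'M[k]_d, (forall i, (U *m A i <= U)%MS) -> U = 0 \/ row_full U.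

Lemma irr_size d (A : 'I_g -> 'M[k]_d) : irr_pencil A -> (0 < d)%N.
Proof.
by move=> [[i Ai] _]; case: d A Ai => // A; rewrite [A i]flatmx0 eqxx.
Qed.

Lemma irr_invariant d (A : 'I_g -> 'M[k]_d) (G : 'rV[k]_d -> Prop) :
  irr_pencil A -> G 0 -> (forall a u v, G u -> G v -> G (a *: u + v)) ->
  (forall i u, G u -> G (u *m A i)) ->
  (forall u, G u -> u = 0) \/ (forall u, G u).
Proof.
move=> [_ irrA] G0 GL GA; have [B HB] := subspace_mx G0 GL.
have [|B0|full] := irrA B.
- move=> i; apply/row_subP=> j; rewrite row_mul; apply/HB/GA/HB; exact: row_sub.
- by left=> u /HB; rewrite B0 submx0 => /eqP.
- by right=> u; apply/HB/submx_full.
Qed.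

(** * Density for two-sided ideals of an irreducible algebra *)

Section IdealUnit.
Variables (d : nat) (A : 'I_g -> 'M[k]_d) (I : 'M[k]_d -> Prop).
Hypotheses (irrA : irr_pencil A) (I0 : I 0).
Hypothesis IL : forall a M N, I M -> I N -> I (a *: M + N).
Hypothesis IA : forall i M, I M -> I (A i *m M) /\ I (M *m A i).
Hypothesis Ialg : forall M, I M -> exists p, npeval A p = M.
Hypothesis Inz : exists2 M, I M & M != 0.

(** The vectors killed by [I] form an invariant subspace; were it everything, [I] would be zero. *)
Lemma ideal_faithful (u : 'rV[k]_d) : (forall s, I s -> u *m s = 0) -> u = 0.
Proof.
move: u; have [|||H|H] := irr_invariant (G := fun u : 'rV[k]_d => forall s, I s -> u *m s = 0) irrA.
- by move=> s _; rewrite mul0mx.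
- by move=> a u v Hu Hv s Is; rewrite mulmxDl -scalemxAl Hu // Hv // scaler0 addr0.
- by move=> i u Hu s Is; rewrite -mulmxA; apply: Hu; have [] := IA i Is.
- exact: H.
- have [M IM /eqP[]] := Inz; apply/row_matrixP => i.
  by rewrite row0 rowE; apply: H.
Qed.

Lemma ideal_npeval p M : I M -> I (npeval A p *m M).
Proof.
elim: p M => [|i|p IHp q IHq|p IHp q IHq|a p IH] M IM /=.
- by rewrite mul0mx.
- by have [] := IA i IM.
- by rewrite mulmxDl -[_ *m M]scale1r; apply: IL; [apply: IHp|apply: IHq].
- by rewrite -mulmxA; apply/IHp/IHq.
- by rewrite -scalemxAl -[_ *: _]addr0; apply: IL => //; apply: IH.
Qed.

(* Jacobson density for a two-sided ideal, at the identity matrix. *)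
Lemma ideal_density m (V : 'M[k]_(m, d)) : exists2 t, I t & V *m t = V.
Proof.
elim: m V => [|m IH] V; first by exists 0 => //; rewrite [RHS]flatmx0 [LHS]flatmx0.
pose V' : 'M[k]_(1 + m, d) := V; rewrite -[V]/V' -[V']vsubmxK.
set v := usubmx V'; set W := dsubmx V'.
have [t It Wt] := IH W.
pose G u := exists j, [/\ I j, W *m j = 0 & v *m j = u].
have [|||Gv|Gv] := irr_invariant (G := G) irrA.
- by exists 0; rewrite !mulmx0.
- move=> a u u' [j [Ij Wj <-]] [j' [Ij' Wj' <-]]; exists (a *: j + j'); split.
  + exact: IL.
  + by rewrite mulmxDr -scalemxAr Wj Wj' scaler0 addr0.
  + by rewrite mulmxDr -scalemxAr.
- move=> i u [j [Ij Wj <-]]; exists (j *m A i); split; last by rewrite mulmxA.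
    by have [] := IA i Ij.
  by rewrite mulmxA Wj mul0mx.
(* If [v] is killed by every element of [I] that kills [W], then v (t s - s) = 0 for all s in [I],
   so v t - v is killed by [I]. *)
- exists t => //; apply: etrans (mul_col_mx v W t) _; rewrite Wt; congr col_mx.
  apply/eqP; rewrite -subr_eq0; apply/eqP/ideal_faithful => s Is.
  rewrite mulmxBl -mulmxA -mulmxBr; apply: Gv; exists (t *m s - s); split=> //.
    have [p tE] := Ialg It; rewrite -tE addrC -scaleN1r; apply: IL => //.
    exact: ideal_npeval.
  by rewrite mulmxBr mulmxA Wt subrr.
(* Otherwise some [j] killing [W] corrects v t to v. *)
- have [j [Ij Wj vj]] := Gv (v - v *m t); exists (t + j).
    by rewrite -[t]scale1r; apply: IL.
  apply: etrans (mul_col_mx v W _) _.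
  by rewrite !mulmxDr Wt Wj vj addr0 addrCA subrr addr0.
Qed.

Lemma ideal_unit : I 1%:M.
Proof. by have [t It] := ideal_density 1%:M; rewrite mul1mx => <-. Qed.

End IdealUnit.

Lemma irr_unit d (A : 'I_g -> 'M[k]_d) : irr_pencil A ->
  exists p, npeval A p = 1%:M.
Proof.
move=> irrA; apply: (ideal_unit irrA (I := fun M => exists p, npeval A p = M)) => //.
- by exists NpZero.
- by move=> a M N [p <-] [q <-]; exists (NpAdd (NpScale a p) q).
- by move=> i M [p <-]; split; [exists (NpMul (NpVar i) p)|exists (NpMul p (NpVar i))].
- by have [[i Ai] _] := irrA; exists (A i) => //; exists (NpVar i).
Qed.

(** The values p(A) with p(B) = 0 form a two-sided ideal of the algebra of [A], nonzero when
    [kerle B A] fails. *)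
Lemma irr_kernel_unit d d' (A : 'I_g -> 'M[k]_d) (B : 'I_g -> 'M[k]_d') :
  irr_pencil A -> ~ kerle B A -> exists p, npeval B p = 0 /\ npeval A p = 1%:M.
Proof.
move=> irrA nk; apply: (ideal_unit irrA
  (I := fun M => exists p, npeval B p = 0 /\ npeval A p = M)).
- by exists NpZero.
- move=> a M N [p [p0 <-]] [q [q0 <-]]; exists (NpAdd (NpScale a p) q).
  by rewrite /= p0 q0 scaler0 addr0.
- move=> i M [p [p0 <-]]; split; [exists (NpMul (NpVar i) p)|exists (NpMul p (NpVar i))].
    by rewrite /= p0 mulmx0.
  by rewrite /= p0 mul0mx.
- by move=> M [p [_ <-]]; exists p.
- move: nk => /existsNP[p /not_implyP[p0 /eqP pN0]].
  by exists (npeval A p) => //; exists p.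
Qed.

(* Take V with the fewest rows such that V p(B) = 0 implies p(A) = 0, and let v be
   one of its rows.  On the right ideal of the p killing the other rows of V,
   v p(B) |-> u p(A) is well defined, commutes with the actions, and is onto. *)
Lemma irr_kernel_rows d d' (A : 'I_g -> 'M[k]_d) (B : 'I_g -> 'M[k]_d') :
  irr_pencil A -> kerle B A ->
  exists S : 'M[k]_(d, d'), row_free S /\
    (row_full S -> forall i, A i *m S = S *m B i).
Proof.
move=> irrA kBA.
pose Q m := `[< exists V : 'M[k]_(m, d'), forall p, V *m npeval B p = 0 -> npeval A p = 0 >].
have Q0 : exists m, Q m.
  by exists d'; apply/asboolP; exists 1%:M => p; rewrite mul1mx; apply: kBA.
case: (ex_minnP Q0) => -[|m] /asboolP[V HV] mmin.
  have [[i /eqP Ai] _] := irrA; case: Ai; apply: (HV (NpVar i)).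
  by apply/matrixP=> -[].
pose V1 : 'M[k]_(1 + m, d') := V; pose v := usubmx V1; pose W := dsubmx V1.
have {}HV p : W *m npeval B p = 0 -> v *m npeval B p = 0 -> npeval A p = 0.
  move=> Wp vp; apply: HV; rewrite -[V]/V1 -[V1]vsubmxK.
  by apply: etrans (mul_col_mx v W _) _; rewrite Wp vp col_mx0.
(* By minimality of the number of rows, [W] alone does not suffice. *)
have [p0 [Wp0 Ap0]] : exists p, W *m npeval B p = 0 /\ npeval A p <> 0.
  apply: contrapT => /forallNP H.
  suff /mmin : Q m by rewrite ltnn.
  by apply/asboolP; exists W => p Wp; apply: contrapT => Ap; apply: (H p).
have [i ui] : exists i, row i (npeval A p0) != 0.
  apply: contrapT => /forallNP H; apply: Ap0; apply/row_matrixP=> i; rewrite row0.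
  by apply/eqP; have /negP := H i; rewrite negbK.
pose u : 'rV[k]_d := delta_mx 0 i.
pose G w := exists p, W *m npeval B p = 0 /\ u *m npeval A p = w.
have [|||G0|] := irr_invariant (G := G) irrA.
- by exists NpZero; rewrite /= !mulmx0.
- move=> a w w' [p [Wp <-]] [q [Wq <-]]; exists (NpAdd (NpScale a p) q) => /=.
  by rewrite !mulmxDr -!scalemxAr Wp Wq scaler0 addr0.
- move=> j w [p [Wp <-]]; exists (NpMul p (NpVar j)).
  by rewrite /= !mulmxA Wp mul0mx.
- move/eqP: ui => []; apply: G0; exists p0; split=> //; by rewrite -rowE.
move=> full.
have /choice[P HP] j : exists p, W *m npeval B p = 0 /\ u *m npeval A p = delta_mx 0 j.
  exact: full.
(* Row j is the image of the unit row e_j = u P_j(A) under the inverse correspondence u p(A) |-> v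
   p(B). *)
pose S := \matrix_j (v *m npeval B (P j)).
pose comb (a : 'rV[k]_d) := npsum [seq NpScale (a 0 j) (P j) | j <- enum 'I_d].
have combW a : W *m npeval B (comb a) = 0.
  rewrite npeval_sum big_enum mulmx_sumr big1 // => j _.
  by rewrite /= -scalemxAr (HP j).1 scaler0.
have combA a : u *m npeval A (comb a) = a.
  rewrite npeval_sum big_enum mulmx_sumr [RHS]row_sum_delta; apply: eq_bigr => j _.
  by rewrite /= -scalemxAr (HP j).2.
have combB a : v *m npeval B (comb a) = a *m S.
  rewrite npeval_sum big_enum mulmx_sumr mulmx_sum_row; apply: eq_bigr => j _.
  by rewrite /= -scalemxAr rowK.
exists S; split.
  rewrite -kermx_eq0; apply/rowV0P => a /sub_kermxP aS.
  by rewrite -(combA a) (HV _ (combW a)) ?mulmx0 // combB.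
move=> Sfull j; apply/row_matrixP=> l; rewrite !row_mul rowK.
(* [q] measures the failure of row [l] of the intertwining relation, while W q(B) = 0 and u q(A) =
   0. *)
pose q := NpAdd (NpMul (P l) (NpVar j)) (NpScale (-1) (comb (row l (A j)))).
have Wq : W *m npeval B q = 0.
  by rewrite /= mulmxDr mulmxA (HP l).1 mul0mx add0r -scalemxAr combW scaler0.
have uq : u *m npeval A q = 0.
  rewrite /= mulmxDr mulmxA (HP l).2 -scalemxAr combA scaleN1r -rowE subrr //.
have vq : v *m npeval B q = v *m npeval B (P l) *m B j - row l (A j) *m S.
  by rewrite /= mulmxDr mulmxA -scalemxAr combB scaleN1r.
have [a Ea] : exists a : 'rV_d, v *m npeval B q = a *m S.
  by apply/submxP/submx_full.
(* Subtracting a combination with the same effect on [v] gives a polynomial killing all of [V],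
   hence zero at [A]; applied to [u] this yields a = 0. *)
pose q' := NpAdd q (NpScale (-1) (comb a)).
have Aq' : npeval A q' = 0.
  apply: HV; first by rewrite /= mulmxDr Wq add0r -scalemxAr combW scaler0.
  by rewrite /= mulmxDr Ea -scalemxAr combB scaleN1r subrr.
have a0 : a = 0.
  have : u *m npeval A q' = 0 by rewrite Aq' mulmx0.
  rewrite [npeval A q']/= mulmxDr uq add0r -scalemxAr combA => /eqP.
  by rewrite scaleN1r oppr_eq0 => /eqP.
by move: vq; rewrite Ea a0 mul0mx => /esym/eqP; rewrite subr_eq0 => /eqP ->.
Qed.

End NonunitalPolynomials.

(** * Free loci of irreducible pencils *)

Section Separation.
Variables (k : fieldType) (k0 : [pchar k] =i pred0) (g : nat).
Local Notation T := (ncrat k0 g).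

(** The exchange of tensor factors, which turns the pencil of [A] at [X] into the pencil of [X] at
    [A]. *)
Definition swapmx m n (U : 'M['M[k]_m]_n) : 'M['M[k]_n]_m :=
  \matrix_(a, b) \matrix_(i, j) U i j a b.

Lemma swapmxE m n (U : 'M['M[k]_m]_n) a b i j : swapmx U a b i j = U i j a b.
Proof. by rewrite !mxE. Qed.

Lemma swapmxM m n (U V : 'M['M[k]_m.+1]_n.+1) :
  swapmx (U *m V) = swapmx U *m swapmx V.
Proof.
apply/matrixP=> a b; apply/matrixP=> i j; rewrite !mxE !summxE.
transitivity (\sum_l \sum_c U i l a c * V l j c b).
  by apply: eq_bigr => l _; apply: mxE.
rewrite exchange_big; apply: eq_bigr => c _ /=; apply/esym; apply: etrans (mxE _ _ _ _) _.
by apply: eq_bigr => l _; rewrite !mxE.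
Qed.

Lemma swapmx1 m n : swapmx (1%:M : 'M['M[k]_m.+1]_n.+1) = 1%:M.
Proof.
apply/matrixP=> a b; apply/matrixP=> i j; rewrite swapmxE.
have E (R : nzRingType) p (r s : 'I_p) : (1%:M : 'M[R]_p) r s = (r == s)%:R by rewrite mxE.
rewrite !E.
by case: (eqVneq i j) => [->|/negPf nij]; case: (eqVneq a b) => [->|/negPf nab];
  rewrite ?mulr1n ?mulr0n !mxE ?eqxx ?nij ?nab.
Qed.

Lemma swapmx_pencil m n (A : 'I_g -> 'M[k]_n.+1) (X : 'I_g -> 'M[k]_m.+1) :
  swapmx (gpencil X A) = gpencil A X.
Proof.
apply/matrixP=> a b; apply/matrixP=> i j; rewrite swapmxE !gpencilE !mxE.
rewrite !summxE; congr (_ - _); last by apply: eq_bigr => l _; rewrite !mxE mulrC.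
by case: (eqVneq i j) => [->|/negPf nij]; case: (eqVneq a b) => [->|/negPf nab];
  rewrite ?mulr1n ?mulr0n !mxE ?eqxx ?nij ?nab.
Qed.

Lemma free_locus_swap m n (A : 'I_g -> 'M[k]_n.+1) (X : 'I_g -> 'M[k]_m.+1) :
  free_locus A (existT _ m X) -> free_locus X (existT _ n A).
Proof.
move=> AX; apply: contrapT => /free_locusPn/flatmx_unitP[F E].
suff : ~ free_locus A (existT _ m X) by [].
apply/free_locusPn/flatmx_unitP; exists (swapmx F).
by rewrite -swapmx1 -E swapmxM swapmx_pencil.
Qed.

Lemma free_locus_size0 (A : 'I_g -> 'M[k]_0) : free_locus A = set0.
Proof.
apply/seteqP; split=> -[n X] // AX; suff : ~ free_locus A (existT _ n X) by [].
by apply/free_locusPn/flatmx_unitP; exists 0; apply/matrixP=> -[].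
Qed.

(* X is a minimal realization of (1 - p)^-1, whose domain at the point A is governed
   by det (1 - p(A)); the roles of A and X in 1 - sum A_i (x) X_i are symmetric. *)
Lemma separating_point (p : ncpoly0 k g) : exists X : ncpoint k g,
  (forall d (B : 'I_g -> 'M[k]_d), npeval B p = 0 -> ~ free_locus B X) /\
  (forall d (A : 'I_g -> 'M[k]_d), (0 < d)%N -> npeval A p = 1%:M -> free_locus A X).
Proof.
pose q := NcAdd (NcConst 1) (NcMul (NcConst (-1)) (npexpr p)).
have qE n (Y : 'I_g -> 'M[k]_n.+1) : ncdef Y q /\ nceval Y q = 1 - npeval Y p.
  have [dp Ep] := npexprP Y p; rewrite /= dp Ep; split=> //.
  by rewrite scale1r scaleN1r mulN1r.
pose O : 'I_g -> 'M[k]_1 := fun=> 0.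
have invdef n (Y : 'I_g -> 'M[k]_n.+1) : npeval Y p = 0 -> ncdef Y (NcInv q).
  move=> p0; rewrite -[ncdef _ _]/(ncdef Y q && (nceval Y q \is a GRing.unit)).
  by have [-> ->] := qE _ Y; rewrite p0 subr0 unitr1.
have dO : ncdef O (NcInv q) by apply: invdef; rewrite npeval_at0.
pose f := ncrat_of k0 (NcInv q).
have qf : ncrat_of k0 q * f = 1 by apply: ncrat_ofV dO.
have domf n (Y : 'I_g -> 'M[k]_n.+1) : ncdef Y (NcInv q) -> ncrat_dom f (existT _ n Y).
  by move=> dY; apply/ncrat_domP; eexists; apply: evalsto_of dY.
have [d0 [X [c [b [fE Oc Cb]]]]] := minimal_realization (domf _ _ dO).
have domE := realization_dom Oc Cb; rewrite -fE in domE.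
case: d0 X c b fE Oc Cb domE => [|n] X c b fE _ _ domE.
  have f0 : f = 0 by rewrite fE /realization mxE big_ord0.
  by move: qf; rewrite f0 mulr0 => /esym/eqP; rewrite oner_eq0.
exists (existT _ n X); split=> [[|d] B Bp|[|d] A // _ Ap].
- by rewrite free_locus_size0.
- move=> /free_locus_swap BX; have := domf _ _ (invdef _ _ Bp).
  by rewrite domE => /(_ BX).
apply: contrapT => AX.
(* A value of [f] at [A] contradicts q f = 1, since [q] has value 0 there. *)
have : ncrat_dom f (existT _ d A) by rewrite domE => /free_locus_swap.
move=> /ncrat_domP[V fV]; have [dq Eq] := qE _ A.
have := evalstoM (evalsto_of k0 dq) fV; rewrite qf Eq Ap.
rewrite -[1%:M]/(1 : 'M_d.+1) subrr mul0r; exact: evalsto0_neq.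
Qed.

Lemma irr_locus_kerle d d' (A : 'I_g -> 'M[k]_d) (B : 'I_g -> 'M[k]_d') :
  irr_pencil A -> free_locus A `<=` free_locus B -> kerle B A.
Proof.
move=> irrA AB; apply: contrapT => /(irr_kernel_unit irrA)[p [Bp Ap]].
have [X [HB HA]] := separating_point p.
by apply: (HB _ _ Bp); apply/AB/HA => //; apply: irr_size irrA.
Qed.

Lemma irr_locus_union d d1 d2 (A : 'I_g -> 'M[k]_d) (B1 : 'I_g -> 'M[k]_d1)
    (B2 : 'I_g -> 'M[k]_d2) :
  irr_pencil A -> free_locus A `<=` free_locus B1 `|` free_locus B2 ->
  free_locus A `<=` free_locus B1 \/ free_locus A `<=` free_locus B2.
Proof.
move=> irrA AB.
have [/kerle_locus|/(irr_kernel_unit irrA)[p1 [Bp1 Ap1]]] := pselect (kerle B1 A).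
  by left.
have [/kerle_locus|/(irr_kernel_unit irrA)[p2 [Bp2 Ap2]]] := pselect (kerle B2 A).
  by right.
have [X [HB HA]] := separating_point (NpMul p1 p2).
have /AB[] : free_locus A X.
- by apply: HA; [apply: irr_size irrA|rewrite /= Ap1 Ap2 mulmx1].
- by move=> /HB[] /=; rewrite Bp1 mul0mx.
- by move=> /HB[] /=; rewrite Bp2 mulmx0.
Qed.

(** Kernel inclusion provides [d] independent rows of length [d'], by [irr_kernel_rows]. *)
Lemma irr_minimal d (A : 'I_g -> 'M[k]_d) : irr_pencil A -> minimal_pencil A.
Proof.
move=> irrA d' B BA.
have [|S [freeS _]] := irr_kernel_rows (B := B) irrA.
  by apply: irr_locus_kerle => //; rewrite BA.
by rewrite -(eqP freeS) rank_leq_col.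
Qed.

Lemma irr_similar d (A B : 'I_g -> 'M[k]_d) : irr_pencil A -> free_locus A = free_locus B ->
  exists S, S \in unitmx /\ forall i, A i *m S = S *m B i.
Proof.
move=> irrA BA; have [|S [freeS simS]] := irr_kernel_rows (B := B) irrA.
  by apply: irr_locus_kerle => //; rewrite BA.
exists S; rewrite -row_free_unit; split=> //; apply: simS.
by rewrite row_full_unit -row_free_unit.
Qed.

Lemma gen_mxalgP d (A : 'I_g -> 'M[k]_d) M :
  gen_mxalg A M <-> exists p, npeval A p = M.
Proof.
split=> [/(_ [set N | exists p, npeval A p = N])|[p <-] C [[[C0 CL] CM] CA]].
  apply; split; last by move=> _ [i _ <-]; exists (NpVar i).
  split; last by move=> M' N [p <-] [q <-]; exists (NpMul p q).
  split; first by exists NpZero.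
  by move=> a M' N [p <-] [q <-]; exists (NpAdd (NpScale a p) q).
elim: p => [|i|p IHp q IHq|p IHp q IHq|a p IH] //=.
- by apply: CA; exists i.
- by rewrite -[npeval A p]scale1r; apply: CL.
- exact: CM.
- by rewrite -[_ *: _]addr0; apply: CL.
Qed.

(** Every nonzero ideal contains the identity by [ideal_unit]. *)
Lemma irr_simple d (A : 'I_g -> 'M[k]_d) : irr_pencil A -> simple_mxalg (gen_mxalg A).
Proof.
move=> irrA; have [e eA] := irr_unit irrA; split.
  exists 1%:M, 1%:M; split; try by apply/gen_mxalgP; exists e.
  by rewrite mulmx1 -mxrank_eq0 mxrank1 -lt0n (irr_size irrA).
move=> I [IS [I0 IL] IM].
have [In0|Iz] := pselect (exists2 M, I M & M != 0); last first.
  left; apply/seteqP; split=> [M IM0|_ -> //]; apply: contrapT => M0; apply: Iz.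
  by exists M => //; apply/eqP.
right; apply/seteqP; split=> // M SM; rewrite -[M]mulmx1.
apply: (proj1 (IM _ _ SM _)).
apply: (ideal_unit irrA) => //; last by move=> N /IS/gen_mxalgP.
by move=> i N IN; apply: IM => //; apply/gen_mxalgP; exists (NpVar i).
Qed.

End Separation.

(** * Composition series and the theorem *)

Section Combinations.
Variables (k : fieldType) (T : algType k).
Implicit Types (S : set T) (f h : T) (s t : seq T).

Lemma ncpoly_sub S S' f : S `<=` S' -> is_ncpoly_in S f -> is_ncpoly_in S' f.
Proof. by move=> SS' [p Hp ->]; exists p => // m y mp ym; apply/SS'/(Hp m). Qed.

Lemma ncpoly_const S (a : k) : is_ncpoly_in S a%:A.
Proof.
exists [:: (a, [::])]; last by rewrite big_seq1 big_nil.
by move=> m y; rewrite inE => /eqP ->.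
Qed.

Lemma ncpoly_mem S f : S f -> is_ncpoly_in S f.
Proof.
move=> Sf; exists [:: (1, [:: f])]; last by rewrite !big_seq1 scale1r.
by move=> m y; rewrite inE => /eqP -> /=; rewrite inE => /eqP ->.
Qed.

Lemma ncpolyD S f h : is_ncpoly_in S f -> is_ncpoly_in S h -> is_ncpoly_in S (f + h).
Proof.
move=> [p Hp ->] [q Hq ->]; exists (p ++ q); last by rewrite big_cat.
by move=> m y; rewrite mem_cat => /orP[/Hp|/Hq]; apply.
Qed.

Lemma ncpolyM S f h : is_ncpoly_in S f -> is_ncpoly_in S h -> is_ncpoly_in S (f * h).
Proof.
move=> [p Hp ->] [q Hq ->].
exists [seq (m.1 * m'.1, m.2 ++ m'.2) | m <- p, m' <- q].
  move=> _ y /allpairsP[[m m'] /= [mp mq ->]] /=.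
  by rewrite mem_cat => /orP[/(Hp _ _ mp)|/(Hq _ _ mq)].
rewrite big_allpairs_dep mulr_suml; apply: eq_bigr => m _; rewrite mulr_sumr.
by apply: eq_bigr => m' _; rewrite /= big_cat -scalerAl -scalerAr scalerA.
Qed.

Lemma ncpolyZ S a f : is_ncpoly_in S f -> is_ncpoly_in S (a *: f).
Proof. by move=> Hf; rewrite -[f]mul1r scalerAl; apply: ncpolyM => //; apply: ncpoly_const. Qed.

Lemma ncpoly_sum S I (r : seq I) (P : pred I) (F : I -> T) :
  (forall i, P i -> is_ncpoly_in S (F i)) -> is_ncpoly_in S (\sum_(i <- r | P i) F i).
Proof.
move=> H; apply: (big_ind (is_ncpoly_in S)) => //; last exact: ncpolyD.
by rewrite -(scale0r 1); apply: ncpoly_const.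
Qed.

Lemma in_span0 s : in_span s 0.
Proof. by exists (fun=> 0); rewrite big1 // => i _; rewrite scale0r. Qed.

Lemma in_spanP s a f h : in_span s f -> in_span s h -> in_span s (a *: f + h).
Proof.
move=> [c ->] [c' ->]; exists (fun i => a * c i + c' i).
rewrite scaler_sumr -big_split; apply: eq_bigr => i _ /=.
by rewrite scalerDl scalerA.
Qed.

Lemma in_spanZ s a f : in_span s f -> in_span s (a *: f).
Proof. by move=> Hf; rewrite -[_ *: _]addr0; apply/in_spanP/in_span0. Qed.

Lemma in_span_sum s I (r : seq I) (F : I -> T) :
  (forall i, in_span s (F i)) -> in_span s (\sum_(i <- r) F i).
Proof.
move=> H; elim: r => [|i r IH]; rewrite ?big_nil ?big_cons; first exact: in_span0.
by rewrite -[F i]scale1r; apply: in_spanP.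
Qed.

Lemma in_span_cons s f h : in_span s h -> in_span (f :: s) h.
Proof.
move=> [c ->]; exists (fun i => oapp c 0 (unlift ord0 i)).
rewrite big_ord_recl /= unlift_none scale0r add0r; apply: eq_bigr => i _.
by rewrite liftK.
Qed.

Lemma in_span_head s f : in_span (f :: s) f.
Proof.
exists (fun i => (i == ord0)%:R); rewrite big_ord_recl /= scale1r big1 ?addr0 // => i _.
by rewrite scale0r.
Qed.

Lemma span_basis t : exists s, [/\ {subset s <= t}, lin_indep s &
  forall f, f \in t -> in_span s f].
Proof.
elim: t => [|f t [s [st ls ts]]]; first by exists [::]; split=> // c _ [].
have [fs|nfs] := pselect (in_span s f).
  exists s; split=> // [x /st xt|h]; first by rewrite inE xt orbT.
  by rewrite inE => /predU1P[->|/ts].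
exists (f :: s); split.
- by move=> x; rewrite !inE => /predU1P[->|/st ->]; rewrite ?eqxx ?orbT.
- move=> c; rewrite big_ord_recl /= => E.
  have c0 : c ord0 = 0.
    apply/eqP; apply: contra_notT nfs => c0.
    exists (fun i => - (c ord0)^-1 * c (lift ord0 i)).
    move/eqP: E; rewrite addr_eq0 => /eqP /(congr1 (GRing.scale (c ord0)^-1)).
    rewrite scalerA mulVf // scale1r => ->; rewrite scalerN -scaleNr scaler_sumr.
    by apply: eq_bigr => i _; rewrite scalerA.
  move: E; rewrite c0 scale0r add0r => /ls cs i.
  by case: (unliftP ord0 i) => [j|] ->.
- move=> h; rewrite inE => /predU1P[->|/ts hs]; first exact: in_span_head.
  exact: in_span_cons.
Qed.

Lemma in_span_ncpoly S s f : (forall y, y \in s -> S y) -> in_span s f -> is_ncpoly_in S f.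
Proof.
move=> sS [c ->]; apply: ncpoly_sum => i _; apply/ncpolyZ/ncpoly_mem/sS.
exact: mem_nth.
Qed.

End Combinations.

Section Main.
Variables (k : fieldType) (k0 : [pchar k] =i pred0) (g : nat).
Local Notation T := (ncrat k0 g).
Local Notation cst := (map_mx (in_alg T)).

(** Induction along a composition series: a pencil neither zero nor irreducible has a proper nonzero
    invariant subspace, and [block_form] splits it. *)
Lemma pencil_ind (Q : forall d, ('I_g -> 'M[k]_d) -> Prop) :
  (forall d, Q d (fun=> 0)) ->
  (forall d A, irr_pencil A -> Q d A) ->
  (forall d d1 d2 (A : 'I_g -> 'M[k]_d) (S : 'M[k]_(d1 + d2, d)) S' A11 A12 A22,
     (d1 < d)%N -> (d2 < d)%N -> S *m S' = 1%:M -> S' *m S = 1%:M ->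
     (forall i, S *m A i = block_mx (A11 i) (A12 i) 0 (A22 i) *m S) ->
     Q d1 A11 -> Q d2 A22 -> Q d A) ->
  forall d A, Q d A.
Proof.
move=> Q0 Qirr Qblock; elim/ltn_ind => d IH A.
have [/Qirr//|/not_andP[/forallNP A0|]] := pselect (irr_pencil A).
  have -> : A = fun=> 0; last exact: Q0.
  by apply/funext=> i; apply/eqP; have /negP := A0 i; rewrite negbK.
move=> /existsNP[U /not_implyP[stab /not_orP[U0 nfull]]].
have [d1 [d2 [S [S' [A11 [A12 [A22 [dE d2E [SS' S'S] SA _]]]]]]]] := block_form stab.
have d1d : (d1 < d)%N.
  by rewrite -dE -[X in (X < _)%N]addn0 ltn_add2l d2E lt0n mxrank_eq0; apply/eqP.
have d2d : (d2 < d)%N.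
  by rewrite d2E ltn_neqAle rank_leq_col andbT; apply/negP.
by apply: (Qblock _ _ _ A S S' A11 A12 A22) => //; apply: IH.
Qed.

Lemma kerle_trans d1 d2 d3 (A : 'I_g -> 'M[k]_d1) (B : 'I_g -> 'M[k]_d2) (C : 'I_g -> 'M[k]_d3) :
  kerle A B -> kerle B C -> kerle A C.
Proof. by move=> AB BC p /AB/BC. Qed.

Section Npprod.
Variables (d : nat) (A : 'I_g -> 'M[k]_d).

Definition npprod (ps : seq (ncpoly0 k g)) : 'M[k]_d :=
  foldr (fun p M => npeval A p *m M) 1%:M ps.

Lemma npprod_cat s t : npprod (s ++ t) = npprod s *m npprod t.
Proof. by elim: s => [|p s IH] /=; rewrite ?mul1mx // IH mulmxA. Qed.

Lemma npprod_cons p s : exists q, npprod (p :: s) = npeval A q.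
Proof.
elim: s p => [|q s IH] p; first by exists p; rewrite /= mulmx1.
by have [r E] := IH q; exists (NpMul p r); rewrite /= -E.
Qed.

(** Nilpotency of the algebra generated by [A], as the factors have no constant term. *)
Definition nil_pencil : Prop := exists N, forall ps, size ps = N -> npprod ps = 0.

End Npprod.

(** If all composition factors are zero, the algebra is nilpotent. Otherwise one of them is
    irreducible, and it has size [d] only if no splitting took place. *)
Lemma nil_or_irr d (A : 'I_g -> 'M[k]_d) :
  nil_pencil A \/ exists d1 (A1 : 'I_g -> 'M[k]_d1),
    [/\ irr_pencil A1, kerle A A1, (d1 <= d)%N & d1 = d -> irr_pencil A].
Proof.
elim/pencil_ind: d / A => [d|d A irrA|d d1 d2 A S S' A11 A12 A22 d1d d2d SS' S'S SA H1 H2].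
- by left; exists 1%N => -[|p [|//]] //= _; rewrite npeval_at0 mul0mx.
- by right; exists d, A; split=> // p.
have [k1 k2] := kerle_sim_block SS' SA.
case: H1 => [[N1 H1]|[e [B [irrB kB le _]]]]; last first.
  right; exists e, B; split=> //; first exact: kerle_trans kB.
    exact: leq_trans le (ltnW d1d).
  by move=> E; move: (leq_ltn_trans le d1d); rewrite E ltnn.
case: H2 => [[N2 H2]|[e [B [irrB kB le _]]]]; last first.
  right; exists e, B; split=> //; first exact: kerle_trans kB.
    exact: leq_trans le (ltnW d2d).
  by move=> E; move: (leq_ltn_trans le d2d); rewrite E ltnn.
left; exists (N1 + N2)%N => ps sz.
pose B i := block_mx (A11 i) (A12 i) 0 (A22 i).
have BE s : exists N, npprod B s = block_mx (npprod A11 s) N 0 (npprod A22 s).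
  elim: s => [|p s [N IH]] /=; first by exists 0; rewrite -scalar_mx_block.
  have [N' ->] := npeval_block A11 A12 A22 p; rewrite IH mulmx_block.
  by rewrite !mulmx0 !mul0mx !addr0 add0r; eexists.
have AB s : S *m npprod A s = npprod B s *m S.
  elim: s => [|p s IH] /=; first by rewrite mulmx1 mul1mx.
  by rewrite mulmxA (npeval_sim p SA) -mulmxA IH mulmxA.
rewrite -[npprod A ps]mul1mx -S'S -mulmxA AB -[ps](cat_take_drop N1) npprod_cat.
have [N ->] := BE (take N1 ps); have [N' ->] := BE (drop N1 ps).
(* The first [N1] factors kill the upper diagonal block and the remaining [N2] the lower one, so the
   product of the two triangular matrices is 0. *)
have -> : npprod A11 (take N1 ps) = 0 by apply: H1; rewrite size_takel // sz leq_addr.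
have -> : npprod A22 (drop N1 ps) = 0 by apply: H2; rewrite size_drop sz addKn.
rewrite mulmx_block !mulmx0 !mul0mx !addr0 block_mx0.
by rewrite mul0mx mulmx0.
Qed.

(** A simple algebra is not nilpotent, so there is an irreducible factor [A1]. The kernel of p(A)
    |-> p(A1) is a proper ideal, hence 0; the free loci agree and minimality forces equal sizes. *)
Lemma minimal_simple_irr d (A : 'I_g -> 'M[k]_d) :
  minimal_pencil A -> simple_mxalg (gen_mxalg A) -> irr_pencil A.
Proof.
move=> minA [[M [N [/gen_mxalgP[p pM] /gen_mxalgP[q qN] MN]]] simA].
have [[n0 nil]|[d1 [A1 [irr1 kA led H]]]] := nil_or_irr A; last first.
  apply: H; apply/eqP; rewrite eqn_leq led /=; apply: (minA d1 A1).
  apply/seteqP; split; apply: kerle_locus => //.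
  pose I M := exists p, npeval A1 p = 0 /\ npeval A p = M.
  have [|I0|IT] := simA I.
  - split.
    + by move=> _ [r [_ <-]]; apply/gen_mxalgP; exists r.
    + split; first by exists NpZero.
      move=> a _ _ [r [r0 <-]] [s [s0 <-]]; exists (NpAdd (NpScale a r) s).
      by rewrite /= r0 s0 scaler0 addr0.
    + move=> _ _ /gen_mxalgP[r <-] [s [s0 <-]]; split.
        by exists (NpMul r s); rewrite /= s0 mulmx0.
      by exists (NpMul s r); rewrite /= s0 mul0mx.
  - move=> r r0; have : I (npeval A r) by exists r.
    by rewrite I0.
  (* If the kernel were everything, a polynomial with value 1 at [A1] would have value 0 there. *)
  have [e e1] := irr_unit irr1.
  have : I (npeval A e) by rewrite IT; apply/gen_mxalgP; exists e.
  move=> [r [r0 rA]]; have := kA (NpAdd r (NpScale (-1) e)).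
  rewrite /= r0 e1 rA scaleN1r subrr => /(_ erefl) /eqP.
  by rewrite add0r scaleN1r oppr_eq0 -mxrank_eq0 mxrank1 -leqn0 leqNgt (irr_size irr1).
(* A nonzero product of maximal length annihilates the algebra on both sides. *)
exfalso.
pose P n := `[< forall ps, size ps = n -> npprod A ps = 0 >].
have exP : exists n, P n by exists n0; apply/asboolP.
case: (ex_minnP exP) => n /asboolP Pn nmin.
pose K M := (exists r, npeval A r = M) /\ forall r, npeval A r *m M = 0 /\ M *m npeval A r = 0.
have [|K0|KT] := simA K.
- split.
  + by move=> _ [[r <-] _]; apply/gen_mxalgP; exists r.
  + split; first by split; [exists NpZero|move=> r; rewrite mulmx0 mul0mx].
    move=> a _ _ [[r <-] Hr] [[s <-] Hs]; split; first by exists (NpAdd (NpScale a r) s).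
    move=> u; have [-> ->] := (mulmxDr (npeval A u) (a *: npeval A r) (npeval A s),
      mulmxDl (a *: npeval A r) (npeval A s) (npeval A u)).
    have [r1 r2] := Hr u; have [s1 s2] := Hs u.
    by rewrite -scalemxAr -scalemxAl r1 r2 s1 s2 scaler0 addr0.
  + move=> _ _ /gen_mxalgP[r <-] [[s <-] Hs]; have [s1 s2] := Hs r; rewrite s1 s2.
    by split; (split; [exists NpZero|move=> u; rewrite mulmx0 mul0mx]).
(* The lengths 0 and 1 are excluded by M N being nonzero. *)
- case: n Pn nmin => [|[|n]] Pn nmin.
  + by move/eqP: MN => []; rewrite -[M]mul1mx -[1%:M]/(npprod A [::]) Pn // !mul0mx.
  + by move/eqP: MN => []; rewrite -pM -[npeval A p]mulmx1 -[_ *m 1%:M]/(npprod A [:: p]) Pn // mul0mx.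
  have /existsNP[ps /not_implyP[sz nz]] : ~ forall ps, size ps = n.+1 -> npprod A ps = 0.
    move=> H; suff /nmin : P n.+1 by rewrite ltnn.
    exact/asboolP.
  apply: nz; suff : K (npprod A ps) by rewrite K0.
  split.
    by case: ps sz => // r ps _; have [q' ->] := npprod_cons A r ps; exists q'.
  move=> r; split; first by rewrite -[_ *m _]/(npprod A (r :: ps)) Pn //= sz.
  have -> : npprod A ps *m npeval A r = npprod A (ps ++ [:: r]).
    by rewrite npprod_cat /= mulmx1.
  by rewrite Pn // size_cat sz addn1.
have [_ /(_ q)] : K M by rewrite KT; apply/gen_mxalgP; exists p.
by rewrite qN => -[_ E]; rewrite E eqxx in MN.
Qed.

(** The rows [u] with u L_A^-1 b = 0 form an invariant subspace; it is not everything, because they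
    satisfy u b = 0. *)
Lemma irr_controllable d (A : 'I_g -> 'M[k]_d) b : irr_pencil A -> b != 0 ->
  controllable (pencil_inv k0 A) b.
Proof.
move=> irrA b0; have [|||//|Gall] := irr_invariant
  (G := fun u => realization k0 A u b = 0) irrA.
- exact: realization0l.
- by move=> a u v u0 v0; rewrite realizationP u0 v0 scaler0 addr0.
- by move=> i u /realization0_row[].
move/eqP: b0 => []; apply/row_matrixP=> i; rewrite rowE row0.
by have [] := realization0_row (Gall (delta_mx 0 i)).
Qed.

Lemma irr_observable d (A : 'I_g -> 'M[k]_d) c : irr_pencil A -> c != 0 ->
  observable (pencil_inv k0 A) c.
Proof.
move=> irrA c0; have [|||G0|Gall] := irr_invariant
  (G := fun u => forall v, realization k0 A c v = 0 -> u *m v = 0) irrA.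
- by move=> v _; rewrite mul0mx.
- by move=> a u u' Hu Hu' v v0; rewrite mulmxDl -scalemxAl Hu // Hu' // scaler0 addr0.
- move=> i u Hu v v0; rewrite -mulmxA; apply: Hu.
  by have [_] := realization0_col v0.
- by move/eqP: c0 => []; apply: G0 => v /realization0_row[].
move=> v v0; apply/row_matrixP=> i; rewrite rowE row0; exact: Gall.
Qed.

Lemma irr_dom d (A : 'I_g -> 'M[k]_d) c b : irr_pencil A -> c != 0 -> b != 0 ->
  ncrat_dom (realization k0 A c b) = ~` free_locus A.
Proof.
by move=> irrA c0 b0; apply: realization_dom; [apply: irr_observable|apply: irr_controllable].
Qed.

Lemma delta_mx_neq0 p q (i : 'I_p) (j : 'I_q) : delta_mx i j != 0 :> 'M[k]_(p, q).
Proof.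
by apply/eqP => /matrixP/(_ i j)/eqP; rewrite !mxE !eqxx oner_eq0.
Qed.

Lemma irr_entry d (A : 'I_g -> 'M[k]_d) i j : irr_pencil A ->
  irreducible_ncrat (pencil_inv k0 A i j) /\
  ncrat_dom (pencil_inv k0 A i j) = ~` free_locus A.
Proof.
move=> irrA; have E : pencil_inv k0 A i j = realization k0 A (delta_mx 0 i) (delta_mx j 0).
  by rewrite /realization entry_delta.
split; last by rewrite E irr_dom // delta_mx_neq0.
exists d, A, (delta_mx j 0), (delta_mx i 0); split.
- exact: irr_minimal.
- exact: irr_simple.
- by apply/realizesP; rewrite trmx_delta.
Qed.

Lemma Dom0_locus (D : set (ncpoint k g)) : Dom0 k0 D ->
  exists d (B : 'I_g -> 'M[k]_d), D = ~` free_locus B.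
Proof.
move=> [f -> /minimal_realization[d [B [c [b [-> Oc Cb]]]]]].
by exists d, B; apply: realization_dom.
Qed.

Lemma irr_coirreducible d (A : 'I_g -> 'M[k]_d) : irr_pencil A ->
  coirreducible k0 (~` free_locus A).
Proof.
move=> irrA; split.
  have i0 : 'I_d := Ordinal (irr_size irrA).
  have [_ E] := irr_entry i0 i0 irrA; exists (pencil_inv k0 A i0 i0); first by rewrite E.
  rewrite E; exact: free_locus_at0.
move=> [D1 [D2 [/Dom0_locus[d1 [B1 D1E]] /Dom0_locus[d2 [B2 D2E]] [_ n1] [_ n2] E]]].
have [|H|H] := @irr_locus_union k k0 g d d1 d2 A B1 B2 irrA.
- move=> X AX; apply: contrapT => /not_orP[nB1 nB2].
  suff : (~` free_locus A) X by [].
  by rewrite E D1E D2E.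
- by apply: n1; rewrite D1E => X nB1 AX; apply/nB1/H.
- by apply: n2; rewrite D2E => X nB2 AX; apply/nB2/H.
Qed.

(** No set is strictly larger. This domain pads the list in the theorem, which has to be
    nonempty. *)
Lemma coirreducible_setT : coirreducible k0 (setT : set (ncpoint k g)).
Proof.
have E : ncrat_dom (ncconst k0 g 1) = setT.
  by apply/seteqP; split=> // -[n X] _; exists (nd_const g 1).
split; first by exists (ncconst k0 g 1); rewrite E.
by move=> [D1 [_ [_ _ [_ nD1] _ _]]]; apply: nD1.
Qed.

(** Any pencil realizes the zero function; for [f] nonzero both [b] and [c] are nonzero, as
    [irr_dom] requires. *)
Lemma irreducible_realization f : irreducible_ncrat f -> f != 0 ->
  exists d (A : 'I_g -> 'M[k]_d) c b,
    [/\ irr_pencil A, f = realization k0 A c b & ncrat_dom f = ~` free_locus A].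
Proof.
move=> [d [A [b [c [minA simA /realizesP ->]]]]] f0.
have irrA := minimal_simple_irr minA simA.
exists d, A, c^T, b; split=> //; apply: irr_dom => //; apply: contraNneq f0 => ->.
  by rewrite realization0l.
by rewrite realization0r.
Qed.

(** Irreducible pencils with the same free locus are similar, so every nonzero irreducible function
    with domain [D] is a combination of the entries of one inverse pencil. Zero lies in every
    span. *)
Lemma spanning_family_exists (D : set (ncpoint k g)) :
  exists s : seq T, spanning_family D s.
Proof.
have [[f0 [irr0 f0n dom0]]|none] := pselect (exists f : T,
  [/\ irreducible_ncrat f, f != 0 & ncrat_dom f = D]); last first.
  exists [::]; split=> //; first by move=> c _ [].
  move=> f irrf fD; have [->|fn] := eqVneq f 0; first exact: in_span0.
  by case: none; exists f.
have [d [A [c0 [b0 [irrA _ E]]]]] := irreducible_realization irr0 f0n.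
pose t := [seq pencil_inv k0 A ij.1 ij.2 | ij <- enum {: 'I_d * 'I_d}].
have [s [st ls ts]] := span_basis t.
exists s; split=> //.
  by move=> f /st/mapP[ij _ ->]; have [] := irr_entry ij.1 ij.2 irrA.
have span_entry i j : in_span s (pencil_inv k0 A i j).
  by apply: ts; apply/mapP; exists (i, j); rewrite ?mem_enum.
move=> f irrf fD; have [->|fn] := eqVneq f 0; first exact: in_span0.
have [d' [A' [c [b [irrA' fE E']]]]] := irreducible_realization irrf fn.
have locE : free_locus A = free_locus A'.
  by apply: setC_inj; rewrite -E -E' fD.
have dE : d' = d.
  apply/eqP; rewrite eqn_leq (irr_minimal k0 irrA' locE).
  by rewrite (irr_minimal k0 irrA (esym locE)).
subst d'; have [S [uS SA]] := irr_similar k0 irrA locE.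
have SA' i : S *m A' i = A i *m S by rewrite SA.
rewrite fE (realization_sim k0 c b (mulmxV uS) (mulVmx uS) SA').
rewrite /realization bilin_entry; do 2!apply: in_span_sum => ?; exact/in_spanZ/span_entry.
Qed.

(** * Decomposition of domains and functions *)

Section Decomposition.
Variable R : set (ncpoint k g) -> seq T.
Hypothesis HR : forall D, coirreducible k0 D -> spanning_family D (R D).

Definition letters (Ds : seq (set (ncpoint k g))) : set T :=
  range (@ncvar k k0 g) `|` [set f | exists2 D, D \in Ds & f \in R D].

(** A zero pencil has inverse 1 and contributes no domain; an irreducible one contributes the
    complement of its free locus. For a triangular pencil, the corner of the inverse is the product
    of the diagonal inverses with a matrix of linear forms in between. *)
Lemma locus_decomposition d (A : 'I_g -> 'M[k]_d) :
  exists Ds : seq (set (ncpoint k g)), [/\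
    forall D, D \in Ds -> coirreducible k0 D,
    forall X, ~ free_locus A X <-> forall D, D \in Ds -> D X &
    forall i j, is_ncpoly_in (letters Ds) (pencil_inv k0 A i j)].
Proof.
elim/pencil_ind: d / A => [d|d A irrA|d d1 d2 A S S' A11 A12 A22 _ _ SS' S'S SA].
- exists [::]; split=> // [X|i j].
    split=> // _; case: X => n X; apply/free_locusPn.
    by rewrite /gpencil gsum0 // subr0 flatmx1 unitmx1.
  have <- : 1%:M = pencil_inv k0 ((fun=> 0) : 'I_g -> 'M[k]_d).
    apply: pencil_inv_uniq; rewrite mulmx1 -[pencil_mx k0 _]/(gpencil _ _).
    by rewrite /gpencil gsum0 // subr0.
  by rewrite mxE -scaler_nat; apply: ncpoly_const.
- have co := irr_coirreducible irrA; exists [:: ~` free_locus A]; split.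
  + by move=> D; rewrite inE => /eqP ->.
  + move=> X; split=> [nX D|]; first by rewrite inE => /eqP ->.
    by move=> /(_ (~` free_locus A)); apply; rewrite inE.
  + move=> i j; have [_ _ span] := HR co.
    apply: in_span_ncpoly (span _ (irr_entry i j irrA).1 (irr_entry i j irrA).2).
    by move=> y yR; right; exists (~` free_locus A); rewrite ?inE.
move=> [Ds1 [co1 loc1 pol1]] [Ds2 [co2 loc2 pol2]].
exists (Ds1 ++ Ds2); split.
- by move=> D; rewrite mem_cat => /orP[/co1|/co2].
- move=> X; have [k1 k2] := kerle_sim_block SS' SA; split=> [nX D|HX].
    rewrite mem_cat => /orP[|]; move: D.
      by apply/loc1 => /(kerle_locus k1).
    by apply/loc2 => /(kerle_locus k2).
  have /loc1 : forall D, D \in Ds1 -> D X by move=> D D1; apply: HX; rewrite mem_cat D1.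
  have /loc2 : forall D, D \in Ds2 -> D X by move=> D D2; apply: HX; rewrite mem_cat D2 orbT.
  case: X {HX} => n X /free_locusPn/flatmx_unitP[F2 E2] /free_locusPn/flatmx_unitP[F1 E1].
  apply/free_locusPn/flatmx_unitP; eexists.
  exact: (gpencil_sim_inv SS' S'S SA (gpencil_block_inv _ E1 E2)).
have sub1 : letters Ds1 `<=` letters (Ds1 ++ Ds2).
  by move=> f [|[D D1 fD]]; [left|right; exists D; rewrite ?mem_cat ?D1].
have sub2 : letters Ds2 `<=` letters (Ds1 ++ Ds2).
  by move=> f [|[D D2 fD]]; [left|right; exists D; rewrite ?mem_cat ?D2 ?orbT].
have polM m n p (M : 'M[T]_(m, n)) (N : 'M[T]_(n, p)) :
    (forall i j, is_ncpoly_in (letters (Ds1 ++ Ds2)) (M i j)) ->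
    (forall i j, is_ncpoly_in (letters (Ds1 ++ Ds2)) (N i j)) ->
    forall i j, is_ncpoly_in (letters (Ds1 ++ Ds2)) ((M *m N) i j).
  by move=> HM HN i j; rewrite mxE; apply: ncpoly_sum => l _; apply: ncpolyM.
have polC m n (M : 'M[k]_(m, n)) i j : is_ncpoly_in (letters (Ds1 ++ Ds2)) (cst M i j).
  by rewrite mxE; apply: ncpoly_const.
rewrite (pencil_inv_sim k0 SS' S'S SA) pencil_inv_block.
apply/polM/polC/polM; first exact: polC.
have H1 i j : is_ncpoly_in (letters (Ds1 ++ Ds2)) (pencil_inv k0 A11 i j).
  exact: ncpoly_sub sub1 (pol1 i j).
have H2 i j : is_ncpoly_in (letters (Ds1 ++ Ds2)) (pencil_inv k0 A22 i j).
  exact: ncpoly_sub sub2 (pol2 i j).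
have H0 m n i j : is_ncpoly_in (letters (Ds1 ++ Ds2)) ((0 : 'M[T]_(m, n)) i j).
  by rewrite -(map_mx0 (in_alg T)); apply: polC.
move=> i j; case: (split_ordP i) => i' ->; case: (split_ordP j) => j' ->;
  rewrite ?block_mxEul ?block_mxEur ?block_mxEdl ?block_mxEdr //.
apply: (polM _ _ _ _ _) => //; apply: (polM _ _ _ _ _) => // a b; rewrite gsumE.
by apply: ncpoly_sum => l _; apply/ncpolyZ/ncpoly_mem; left; exists l.
Qed.

End Decomposition.

End Main.

Theorem theorem3 (k : fieldType) (k0 : [pchar k] =i pred0) (g : nat) :
  (forall D : set (ncpoint k g), coirreducible k0 D ->
     exists s : seq (ncrat k0 g), spanning_family D s) /\
  (forall R : set (ncpoint k g) -> seq (ncrat k0 g),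
     (forall D, coirreducible k0 D -> spanning_family D (R D)) ->
   forall f : ncrat k0 g, ncrat_dom f (ncorigin k g) ->
   exists (s : nat) (D : 'I_s -> set (ncpoint k g)),
     [/\ (0 < s)%N,
         forall i, coirreducible k0 (D i),
         ncrat_dom f = \bigcap_(i in [set: 'I_s]) D i &
         is_ncpoly_in
           (range (@ncvar k k0 g) `|` \bigcup_(i in [set: 'I_s]) [set` R (D i)])
           f]).
Proof.
split=> [D _|R HR f /minimal_realization[d [A [c [b [fE Oc Cb]]]]]].
  exact: spanning_family_exists.
have [Ds [co loc pol]] := locus_decomposition HR A.
(* The whole space is prepended to make the number of domains positive; [Ds] is empty when all
   composition factors of [A] are zero. *)
exists (size Ds).+1, (fun i => nth setT (setT :: Ds) i); split=> //.
- case=> [[|i] lt] /=; first exact: coirreducible_setT.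
  by apply/co/mem_nth.
- rewrite fE (realization_dom Oc Cb); apply/seteqP; split=> X.
    move=> /loc HX [[|i] lt] _ //=.
    exact: (HX (nth setT Ds i) (mem_nth setT (lt : (i < size Ds)%N))).
  move=> HX; apply/loc => D /(nthP setT)[i lt <-].
  exact: (HX (Ordinal (lt : (i.+1 < (size Ds).+1)%N))).
rewrite fE /realization bilin_entry; do 2!apply: ncpoly_sum => ? _.
apply/ncpolyZ; apply: ncpoly_sub (pol _ _) => y [|[D /(nthP setT)[i lt <-] yD]].
  by left.
by right; exists (Ordinal (lt : (i.+1 < (size Ds).+1)%N)).
Qed.
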